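(* Let $P$ be an orthogonal projector on $L^2(\mathbb{R}^2)$ which admits an exponentially localized kernel. Then the following statements are equivalent: (1) $P$ admits an exponentially localized generalized Wannier basis. (2) $P$ admits an $s$-localized generalized Wannier basis for some $s > 5/2$.
   Context: Write $\langle \boldsymbol{x} \rangle := \sqrt{1+|\boldsymbol{x}|^2}$, where $|\cdot|$ is the Euclidean norm. Exponentially localized kernel: a bounded linear operator $A$ on $L^2(\mathbb{R}^2)$ admits an exponentially localized kernel if it has an integral kernel $A(\cdot,\cdot):\mathbb{R}^2\times\mathbb{R}^2\to\mathbb{C}$ and there are finite constants $C>0$, $\gamma>0$ (the rate) with $|A(\boldsymbol{x},\boldsymbol{x}')| \le C e^{-\gamma|\boldsymbol{x}-\boldsymbol{x}'|}$ for a.e. $(\boldsymbol{x},\boldsymbol{x}')$. $s$-localized generalized Wannier basis ($s>0$): an orthonormal family $\{\psi_\alpha\}_{\alpha\in\mathcal{I}}\subseteq L^2(\mathbb{R}^2)$ that is an orthonormal basis of $\mathrm{range}(P)$, for which there exist a finite constant $C>0$ and points $\{\boldsymbol{\mu}_\alpha\}_{\alpha\in\mathcal{I}}\subseteq\mathbb{R}^2$ (center points) such that for all $\alpha\in\mathcal{I}$, $\int_{\mathbb{R}^2}\langle \boldsymbol{x}-\boldsymbol{\mu}_\alpha\rangle^{2s}|\psi_\alpha(\boldsymbol{x})|^2\,d\boldsymbol{x}\le C$. Exponentially localized generalized Wannier basis: an orthonormal basis $\{\psi_\alpha\}_{\alpha\in\mathcal{I}}$ of $\mathrm{range}(P)$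 for which there exist finite constants $C>0$, $\gamma>0$ and points $\{\boldsymbol{\mu}_\alpha\}_{\alpha\in\mathcal{I}}\subseteq\mathbb{R}^2$ such that for all $\alpha\in\mathcal{I}$, $\int_{\mathbb{R}^2} e^{2\gamma\langle \boldsymbol{x}-\boldsymbol{\mu}_\alpha\rangle}|\psi_\alpha(\boldsymbol{x})|^2\,d\boldsymbol{x}\le C$. *)

(* Defs.v *)
From HB Require Import structures.
From mathcomp Require Import all_boot all_order all_algebra.
From mathcomp Require Import all_classical all_reals all_analysis.
From mathcomp.real_closed Require Import complex.

Set Implicit Arguments.
Unset Strict Implicit.
Unset Printing Implicit Defensive.

Import Order.TTheory GRing.Theory Num.Theory.
Import numFieldNormedType.Exports.

Local Open Scope classical_set_scope.
Local Open Scope ring_scope.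
Local Open Scope complex_scope.
Local Notation normc := Normc.normc.

Section ComplexL2.
Context {d : measure_display} {T : measurableType d} {R : realType}.
Implicit Types (f g : T -> R[i]).

Definition cmeasurable_fun f : Prop :=
  measurable_fun setT (fun x => complex.Re (f x)) /\
  measurable_fun setT (fun x => complex.Im (f x)).

Variable mu : {measure set T -> \bar R}.

Definition cintegrable f : Prop :=
  mu.-integrable setT (fun x => (complex.Re (f x))%:E) /\
  mu.-integrable setT (fun x => (complex.Im (f x))%:E).

Definition cintegral f : R[i] :=
  Complex (\int[mu]_x complex.Re (f x)) (\int[mu]_x complex.Im (f x)).

Definition L2norm f : \bar R := ('N[mu]_2%:E [(fun x => (normc (f x))%:E)])%E.

(* The elements of the Hilbert space L^2(mu; C) are represented by functions
   in [L2], two representatives being identified when they are [ae_eq]. *)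
Definition L2 f : Prop := cmeasurable_fun f /\ (L2norm f < +oo)%E.

(* Linear in the first argument. *)
Definition inner f g : R[i] := cintegral (fun x => f x * conjc (g x)).

Implicit Type A : (T -> R[i]) -> (T -> R[i]).

(* Only the values of [A] on [L2] matter, and these only up to [ae_eq]. *)
Definition bounded_linear_operator A : Prop :=
  [/\ forall f, L2 f -> L2 (A f),
      forall f g, L2 f -> L2 g -> ae_eq mu setT f g ->
        ae_eq mu setT (A f) (A g),
      forall (c : R[i]) f g, L2 f -> L2 g ->
        ae_eq mu setT (A (fun x => c * f x + g x))
                      (fun x => c * A f x + A g x) &
      exists M : R, forall f, L2 f -> (L2norm (A f) <= M%:E * L2norm f)%E].

Definition orthogonal_projector A : Prop :=
  [/\ bounded_linear_operator A,
      forall f, L2 f -> ae_eq mu setT (A (A f)) (A f) &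
      forall f g, L2 f -> L2 g -> inner (A f) g = inner f (A g)].

Definition L2range A f : Prop :=
  L2 f /\ exists2 g, L2 g & ae_eq mu setT f (A g).

Definition orthonormal_family (I : Type) (psi : I -> T -> R[i]) : Prop :=
  (forall a, L2 (psi a)) /\
  (forall a b, inner (psi a) (psi b) = `[< a = b >]%:R).

(* Completeness: finite linear combinations of the [psi a] are dense in the
   range of [A]. *)
Definition orthonormal_basis_of_range A (I : Type) (psi : I -> T -> R[i]) :
    Prop :=
  [/\ orthonormal_family psi,
      forall a, L2range A (psi a) &
      forall f, L2range A f -> forall e : R, 0 < e ->
        exists s : seq (R[i] * I),
          (L2norm (fun x => (f x - \sum_(p <- s) p.1 * psi p.2 x)%R)
             < e%:E)%E].

End ComplexL2.

Section IntegralKernel.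
Context {d : measure_display} {T : measurableType d} {R : realType}.
Variable mu : {measure set T -> \bar R}.

(* [A f x] is the absolutely convergent integral of [K (x, .) * f], for almost
   every [x]. *)
Definition integral_kernel (A : (T -> R[i]) -> (T -> R[i]))
    (K : T * T -> R[i]) : Prop :=
  cmeasurable_fun K /\
  forall f, L2 mu f ->
    {ae mu, forall x,
      cintegrable mu (fun y => K (x, y) * f y) /\
      A f x = cintegral mu (fun y => K (x, y) * f y)}.

End IntegralKernel.

Section Plane.
Context {R : realType}.

Local Notation plane := (measurableTypeR R * measurableTypeR R)%type.

Definition lebesgue2 : set plane -> \bar R :=
  (@lebesgue_measure R \x @lebesgue_measure R)%E.

HB.instance Definition _ := Measure.on lebesgue2.

(* Canonical inference does not find the sigma-finite structure of a product of
   sigma-finite measures; it is needed to form [lebesgue2 \x lebesgue2]. *)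
Let lebesgue2_sigma_finite : sigma_finite setT lebesgue2.
Proof.
have /sigma_finiteP[F [TF ndF Foo]] := sigma_finiteT (@lebesgue_measure R).
exists (fun n => F n `*` F n).
  rewrite -setXTT TF predeqE => -[x y]; split.
    move=> [/= [n _ Fnx] [k _ Fky]]; exists (maxn n k) => //; split.
    - by move: x Fnx; exact/subsetPset/ndF/leq_maxl.
    - by move: y Fky; exact/subsetPset/ndF/leq_maxr.
  by move=> [n _ []/= ? ?]; split; exists n.
move=> k; have [? ?] := Foo k.
split; first exact: measurableX.
rewrite /lebesgue2 product_measure1E//.
by rewrite lte_mul_pinfty// ge0_fin_numE.
Qed.

HB.instance Definition _ := Measure_isSigmaFinite.Build _ _ _ lebesgue2
  lebesgue2_sigma_finite.

(* Euclidean norm; the library norm on [R * R] is the sup norm. *)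
Definition enorm (x : R * R) : R := Num.sqrt (x.1 ^+ 2 + x.2 ^+ 2).

Definition jbracket (x : R * R) : R := Num.sqrt (1 + enorm x ^+ 2).

Implicit Type P : (R * R -> R[i]) -> (R * R -> R[i]).

Definition exp_localized_kernel P : Prop :=
  exists2 K : (R * R) * (R * R) -> R[i],
    integral_kernel lebesgue2 P K &
    exists C gamma : R, [/\ 0 < C, 0 < gamma &
      {ae (lebesgue2 \x lebesgue2)%E, forall z,
        normc (K z) <= C * expR (- gamma * enorm (z.1 - z.2))}].

Definition s_localized_wannier_basis P (s : R)
    (I : Type) (psi : I -> R * R -> R[i]) : Prop :=
  [/\ 0 < s, orthonormal_basis_of_range lebesgue2 P psi &
      exists (C : R) (m : I -> R * R), 0 < C /\
        forall a, (\int[lebesgue2]_x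
          (jbracket (x - m a) `^ (2 * s) * normc (psi a x) ^+ 2)%:E
            <= C%:E)%E].

Definition exp_localized_wannier_basis P
    (I : Type) (psi : I -> R * R -> R[i]) : Prop :=
  orthonormal_basis_of_range lebesgue2 P psi /\
  exists (C gamma : R) (m : I -> R * R), [/\ 0 < C, 0 < gamma &
    forall a, (\int[lebesgue2]_x
      (expR (2 * gamma * jbracket (x - m a)) * normc (psi a x) ^+ 2)%:E
        <= C%:E)%E].

Definition admits_exp_localized_wannier_basis P : Prop :=
  exists (I : Type) (psi : I -> R * R -> R[i]),
    exp_localized_wannier_basis P psi.

Definition admits_s_localized_wannier_basis P (s : R) : Prop :=
  exists (I : Type) (psi : I -> R * R -> R[i]),
    s_localized_wannier_basis P s psi.

End Plane.

(* Main.v *)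
(* Exponential localization gives every polynomial moment, hence (1) => (2).

   (2) => (1).  Cut psi_a off outside the region <x - mu_a> <= L and project
   back: phi_a = P (psi_a 1_{<x - mu_a> <= L}) decays exponentially around
   mu_a.  By the decay of the kernel of P and the moment bound, the entries of
   E = Gram(phi) - 1 are at most rho(L) <mu_a - mu_b>^(-5/2) with rho(L) -> 0
   as L grows (this is where s > 5/2 enters), and they also decay exponentially
   in |mu_a - mu_b| at a rate independent of L.  Since the local density
   sum_a |psi_a(x)|^2 is bounded, sum_b <mu_a - mu_b>^(-5/2) is bounded uniformly
   in a, so for L large and th small the weighted row sums
   sum_b |E_ab| e^(th |mu_a - mu_b|) are small.  This norm is submultiplicative,
   so the Newton iteration phi <- (1 - E/2) phi converges to an orthonormal
   family chi = Gram(phi)^(-1/2) phi with exponential decay of rate th; E is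
   truncated at each step so that only finite sums occur.  Finally chi is so
   close to psi in the l^2 operator sense that it is complete in the range of P. *)
Require Import Defs.
From mathcomp Require Import all_boot all_order all_algebra.
From mathcomp Require Import all_classical all_reals all_analysis.
From mathcomp.real_closed Require Import complex.
From mathcomp Require Import measurable_realfun ring lra.
Import Order.TTheory GRing.Theory Num.Theory.
Import numFieldNormedType.Exports.
Set Implicit Arguments.
Unset Strict Implicit.
Unset Printing Implicit Defensive.
Local Open Scope classical_set_scope.
Local Open Scope ring_scope.
Local Open Scope complex_scope.
Local Notation normc := Normc.normc.

(** * Complex-valued square-integrable functions *)

(** The two bounds on the Gram error are complementary. Enlarging L makes the polynomial bound small
    but inflates the constant of the exponential one, since the amplitude of phi_a carries a factor
    e^(gL); neither bound alone makes an exponentially weighted row sum small. Once L is fixed, the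
    exponential bound disposes of the pairs of centers beyond some radius, and a rate th small
    compared with the inverse of that radius lets the polynomial bound control the others.

    The exponent 5/2 exceeds the dimension 2, so <x>^(-5/2) is integrable on the plane; it is below
    s, so the part cut off gains the factor L^(5/2 - s).

    The index type is arbitrary and no l^2 space over it is built: each matrix identity is stated
    over a finite list of indices, and truncation makes the rows of the correction finite. The
    discarded entries remain in the next error, so a step only halves the error instead of squaring
    it; this still makes the increments summable and keeps the amplitudes bounded. *)

Section ComplexNorm.
Context {R : realType}.
Implicit Types z w : R[i].

Lemma normc_ge0 z : 0 <= normc z.
Proof. by case: z => a b; exact: sqrtr_ge0. Qed.

Lemma sqr_normcE z : normc z ^+ 2 = complex.Re z ^+ 2 + complex.Im z ^+ 2.
Proof. by case: z => a b; rewrite sqr_sqrtr// addr_ge0// sqr_ge0. Qed.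

Lemma normr_Re_le z : `|complex.Re z| <= normc z.
Proof.
rewrite -(ler_pXn2r (n := 2))// ?nnegrE ?normc_ge0// real_normK ?num_real//.
by rewrite sqr_normcE lerDl sqr_ge0.
Qed.

Lemma normr_Im_le z : `|complex.Im z| <= normc z.
Proof.
rewrite -(ler_pXn2r (n := 2))// ?nnegrE ?normc_ge0// real_normK ?num_real//.
by rewrite sqr_normcE lerDr sqr_ge0.
Qed.

Lemma normc_le_ReIm z : normc z <= `|complex.Re z| + `|complex.Im z|.
Proof.
rewrite -(ler_pXn2r (n := 2))// ?nnegrE ?normc_ge0 ?addr_ge0//.
rewrite sqr_normcE -(real_normK (num_real (complex.Re z))).
rewrite -(real_normK (num_real (complex.Im z))).
by have := normr_ge0 (complex.Re z); have := normr_ge0 (complex.Im z); nra.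
Qed.

Lemma normc_conj z : normc (conjc z) = normc z.
Proof. by case: z => a b; rewrite /= sqrrN. Qed.

Lemma normcD_le z w : normc (z + w) <= normc z + normc w.
Proof. exact: le_normcD. Qed.

Lemma normcN_eq z : normc (- z) = normc z.
Proof. exact: normcN. Qed.

Lemma normc_real (x : R) : normc x%:C = `|x|.
Proof. by rewrite /= expr0n addr0 sqrtr_sqr. Qed.

Lemma ReD z w : complex.Re (z + w) = complex.Re z + complex.Re w.
Proof. by case: z; case: w. Qed.

Lemma ImD z w : complex.Im (z + w) = complex.Im z + complex.Im w.
Proof. by case: z; case: w. Qed.

Lemma ReN z : complex.Re (- z) = - complex.Re z.
Proof. by case: z. Qed.

Lemma ImN z : complex.Im (- z) = - complex.Im z.
Proof. by case: z. Qed.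

Lemma ReM z w :
  complex.Re (z * w) = complex.Re z * complex.Re w - complex.Im z * complex.Im w.
Proof. by case: z; case: w. Qed.

Lemma ImM z w :
  complex.Im (z * w) = complex.Re z * complex.Im w + complex.Im z * complex.Re w.
Proof. by case: z => a b; case: w => c e /=; rewrite [b * c]mulrC. Qed.

Lemma mulc_conj z : z * conjc z = (normc z ^+ 2)%:C.
Proof.
by rewrite sqr_normcE; case: z => a b; apply/eqP; rewrite eq_complex /=; apply/andP;
  split; apply/eqP; ring.
Qed.

Lemma normc_sum (J : Type) (s : seq J) (F : J -> R[i]) :
  normc (\sum_(j <- s) F j) <= \sum_(j <- s) normc (F j).
Proof.
elim: s => [|j s ih]; first by rewrite !big_nil Normc.normc0.
by rewrite !big_cons (le_trans (normcD_le _ _))// lerD2l.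
Qed.

Lemma Re_sum (J : Type) (s : seq J) (F : J -> R[i]) :
  complex.Re (\sum_(j <- s) F j) = \sum_(j <- s) complex.Re (F j).
Proof.
by elim: s => [|j s ih]; rewrite ?big_nil// !big_cons ReD ih.
Qed.

Lemma conjcD z w : conjc (z + w) = conjc z + conjc w.
Proof. exact: rmorphD. Qed.

Lemma conjcN z : conjc (- z) = - conjc z.
Proof. exact: rmorphN. Qed.

Lemma conjcM z w : conjc (z * w) = conjc z * conjc w.
Proof. exact: rmorphM. Qed.

Lemma conjc_sum (J : Type) (s : seq J) (F : J -> R[i]) :
  conjc (\sum_(j <- s) F j) = \sum_(j <- s) conjc (F j).
Proof. exact: rmorph_sum. Qed.

End ComplexNorm.

Section L2Theory.
Context {d : measure_display} {T : measurableType d} {R : realType}.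
Variable mu : {measure set T -> \bar R}.
Implicit Types f g h : T -> R[i].

Lemma cmeasurableD f g : cmeasurable_fun f -> cmeasurable_fun g ->
  cmeasurable_fun (fun x => f x + g x).
Proof.
move=> [f1 f2] [g1 g2]; split.
  by under eq_fun do rewrite ReD; exact: measurable_funD.
by under eq_fun do rewrite ImD; exact: measurable_funD.
Qed.

Lemma cmeasurableM f g : cmeasurable_fun f -> cmeasurable_fun g ->
  cmeasurable_fun (fun x => f x * g x).
Proof.
move=> [f1 f2] [g1 g2]; split.
  by under eq_fun do rewrite ReM; apply: measurable_funB; exact: measurable_funM.
by under eq_fun do rewrite ImM; apply: measurable_funD; exact: measurable_funM.
Qed.

Lemma cmeasurable_cst (c : R[i]) : cmeasurable_fun (fun _ : T => c).
Proof. by split; exact: measurable_cst. Qed.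

Lemma cmeasurable_conj f : cmeasurable_fun f ->
  cmeasurable_fun (fun x => conjc (f x)).
Proof.
move=> [f1 f2]; split.
  by rewrite (_ : (fun x => _) = (fun x => complex.Re (f x)))//;
    apply/funext => x; case: (f x).
rewrite (_ : (fun x => _) = (fun x => - complex.Im (f x))); first exact: measurable_funN.
by apply/funext => x; case: (f x).
Qed.

Lemma measurable_sqrt : measurable_fun setT (@Num.sqrt R).
Proof. by apply: continuous_measurable_fun; exact: sqrt_continuous. Qed.

Lemma measurable_normc f : cmeasurable_fun f ->
  measurable_fun setT (fun x => normc (f x)).
Proof.
move=> [f1 f2].
rewrite (_ : (fun x => _) = (Num.sqrt \o
  (fun x => complex.Re (f x) ^+ 2 + complex.Im (f x) ^+ 2))).
  apply: measurableT_comp; first exact: measurable_sqrt.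
  by apply: measurable_funD; exact: measurable_funX.
by apply/funext => x /=; case: (f x).
Qed.

(** The squared norm is the working quantity because it expands bilinearly into Gram entries;
    [L2norm] is kept for the places where the triangle inequality must be lossless. *)
Definition nsq f : \bar R := (\int[mu]_x (normc (f x) ^+ 2)%:E)%E.

Lemma nsq_ge0 f : (0 <= nsq f)%E.
Proof. by apply: integral_ge0 => x _; rewrite lee_fin sqr_ge0. Qed.

Lemma L2norm_ge0 f : (0 <= L2norm mu f)%E.
Proof. exact: Lnorm_ge0. Qed.

Lemma L2norm_sqr f : (L2norm mu f `^ 2 = nsq f)%E.
Proof.
rewrite /L2norm powR_Lnorm//; apply: eq_integral => x _ /=.
by rewrite ger0_norm ?normc_ge0// powR_mulrn ?normc_ge0.
Qed.

Lemma L2norm_nsq f : (L2norm mu f = nsq f `^ 2^-1)%E.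
Proof.
by rewrite -L2norm_sqr -poweRrM mulfV// poweRe1// L2norm_ge0.
Qed.

Lemma L2norm_lty f : (L2norm mu f < +oo)%E <-> (nsq f < +oo)%E.
Proof.
split=> h; first by rewrite -L2norm_sqr poweR_lty.
by rewrite L2norm_nsq poweR_lty.
Qed.

Lemma L2P f : L2 mu f <-> cmeasurable_fun f /\ (nsq f < +oo)%E.
Proof. by split=> -[mf /L2norm_lty]. Qed.

Lemma L2norm_le f (c : R) : 0 <= c ->
  (L2norm mu f <= c%:E)%E <-> (nsq f <= (c ^+ 2)%:E)%E.
Proof.
move=> c0; rewrite -powR_mulrn//; split=> h.
  rewrite -L2norm_sqr -poweR_EFin gt0_ler_poweR// in_itv/= leey andbT ?lee_fin//.
  exact: L2norm_ge0.
rewrite L2norm_nsq (_ : c%:E = ((c `^ 2)%:E `^ 2^-1)%E).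
  by rewrite gt0_ler_poweR// in_itv/= leey andbT ?nsq_ge0// lee_fin powR_ge0.
by rewrite poweR_EFin -powRrM mulfV// powRr1.
Qed.

End L2Theory.

Section L2Closure.
Context {d : measure_display} {T : measurableType d} {R : realType}.
Variable mu : {measure set T -> \bar R}.
Implicit Types f g h : T -> R[i].

Lemma measurable_normcM f g : cmeasurable_fun f -> cmeasurable_fun g ->
  measurable_fun setT (fun x => normc (f x) * normc (g x)).
Proof. by move=> mf mg; apply: measurable_funM; exact: measurable_normc. Qed.

Lemma measurable_normc_sqr f : cmeasurable_fun f ->
  measurable_fun setT (fun x => (normc (f x) ^+ 2)%:E).
Proof.
by move=> mf; apply/measurable_EFinP/measurable_funX; exact: measurable_normc.
Qed.

Lemma nsq_le_ae f g : cmeasurable_fun f -> cmeasurable_fun g ->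
  {ae mu, forall x, normc (f x) <= normc (g x)} -> (nsq mu f <= nsq mu g)%E.
Proof.
move=> mf mg fg; apply: ae_ge0_le_integral => //.
- by move=> x _; rewrite lee_fin sqr_ge0.
- exact: measurable_normc_sqr.
- by move=> x _; rewrite lee_fin sqr_ge0.
- exact: measurable_normc_sqr.
- move: fg; apply: filterS => x fg _.
  by rewrite lee_fin ler_pXn2r// nnegrE normc_ge0.
Qed.

Lemma nsq_le f g : cmeasurable_fun f -> cmeasurable_fun g ->
  (forall x, normc (f x) <= normc (g x)) -> (nsq mu f <= nsq mu g)%E.
Proof. by move=> mf mg fg; apply: nsq_le_ae => //; exact: aeW. Qed.

Lemma nsq_ae_eq f g : cmeasurable_fun f -> cmeasurable_fun g ->
  ae_eq mu setT f g -> nsq mu f = nsq mu g.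
Proof.
move=> mf mg fg; apply/eqP; rewrite eq_le; apply/andP; split; apply: nsq_le_ae => //.
  by move: fg; apply: filterS => x /(_ I) ->.
by move: fg; apply: filterS => x /(_ I) ->.
Qed.

Lemma nsq_eq0 f : cmeasurable_fun f -> nsq mu f = 0%E ->
  ae_eq mu setT f (fun=> 0).
Proof.
move=> mf f0.
have /(ae_eq_integral_abs mu measurableT (measurable_normc_sqr mf)) :
    (\int[mu]_x `|(normc (f x) ^+ 2)%:E|)%E = 0%E.
  by rewrite -[RHS]f0; apply: eq_integral => x _; rewrite abse_EFin ger0_norm ?sqr_ge0.
apply: filterS => x /(_ I) [] /eqP.
by rewrite sqrf_eq0 => /eqP/Normc.eq0_normc.
Qed.

Lemma nsqZ (c : R[i]) f : cmeasurable_fun f ->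
  nsq mu (fun x => c * f x) = ((normc c ^+ 2)%:E * nsq mu f)%E.
Proof.
move=> mf; rewrite /nsq -ge0_integralZl_EFin//.
- by apply: eq_integral => x _; rewrite Normc.normcM exprMn EFinM.
- by move=> x _; rewrite lee_fin sqr_ge0.
- exact: measurable_normc_sqr.
- by rewrite sqr_ge0.
Qed.

Lemma nsqD_le f g : cmeasurable_fun f -> cmeasurable_fun g ->
  (nsq mu (fun x => f x + g x)%R <= 2%:E * nsq mu f + 2%:E * nsq mu g)%E.
Proof.
move=> mf mg; rewrite /nsq.
have m1 := measurable_normc_sqr mf; have m2 := measurable_normc_sqr mg.
rewrite -!ge0_integralZl_EFin//; try by move=> x _; rewrite lee_fin sqr_ge0.
rewrite -ge0_integralD//; try by move=> x _; rewrite mule_ge0// lee_fin sqr_ge0.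
- apply: ge0_le_integral => //.
  + by move=> x _; rewrite lee_fin sqr_ge0.
  + by apply: measurable_normc_sqr; exact: cmeasurableD.
  + by apply: emeasurable_funD; exact: measurable_funeM.
  move=> x _; rewrite -!EFinM -EFinD lee_fin.
  have := normcD_le (f x) (g x); have := normc_ge0 (f x + g x).
  have := sqr_ge0 (normc (f x) - normc (g x)).
  by have := normc_ge0 (f x); have := normc_ge0 (g x); nra.
- exact: measurable_funeM.
- exact: measurable_funeM.
Qed.

Lemma L2_measurable f : L2 mu f -> cmeasurable_fun f.
Proof. by case. Qed.

Lemma L2_nsq_fin f : L2 mu f -> nsq mu f \is a fin_num.
Proof. by move=> /L2P[_ fy]; rewrite ge0_fin_numE// nsq_ge0. Qed.

Lemma L2_nsq f : L2 mu f -> nsq mu f = (fine (nsq mu f))%:E.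
Proof. by move=> /L2_nsq_fin/fineK. Qed.

Lemma le_L2 f g : cmeasurable_fun f ->
  {ae mu, forall x, normc (f x) <= normc (g x)} -> L2 mu g -> L2 mu f.
Proof.
move=> mf fg /L2P[mg gy]; apply/L2P; split => //.
exact: le_lt_trans (nsq_le_ae mf mg fg) gy.
Qed.

Lemma L2_ae_eq f g : cmeasurable_fun g -> ae_eq mu setT f g -> L2 mu f -> L2 mu g.
Proof.
move=> mg fg; apply: le_L2 => //; move: fg; apply: filterS => x.
by move=> /(_ I) ->.
Qed.

Lemma L2D f g : L2 mu f -> L2 mu g -> L2 mu (fun x => f x + g x).
Proof.
move=> /L2P[mf fy] /L2P[mg gy]; apply/L2P; split; first exact: cmeasurableD.
apply: (le_lt_trans (nsqD_le mf mg)).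
by rewrite lte_add_pinfty// lte_mul_pinfty.
Qed.

Lemma L2Z (c : R[i]) f : L2 mu f -> L2 mu (fun x => c * f x).
Proof.
move=> Lf; have mf := L2_measurable Lf; apply/L2P; split.
  by apply: cmeasurableM => //; exact: cmeasurable_cst.
by rewrite nsqZ// (L2_nsq Lf) -EFinM ltry.
Qed.

Lemma L2N f : L2 mu f -> L2 mu (fun x => - f x).
Proof.
by move=> /(L2Z (-1)); rewrite (_ : (fun x => -1 * f x) = (fun x => - f x))//;
  apply/funext => x; rewrite mulN1r.
Qed.

Lemma L2B f g : L2 mu f -> L2 mu g -> L2 mu (fun x => f x - g x).
Proof. by move=> Lf Lg; apply: L2D => //; exact: L2N. Qed.

Lemma L2_cst0 : L2 mu (fun=> 0).
Proof.
apply/L2P; split; first exact: cmeasurable_cst.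
rewrite /nsq (eq_integral (fun=> 0%E)) ?integral0// => x _.
by rewrite Normc.normc0 expr0n.
Qed.

Lemma L2_sum (J : Type) (s : seq J) (F : J -> T -> R[i]) :
  (forall j, L2 mu (F j)) -> L2 mu (fun x => \sum_(j <- s) F j x).
Proof.
move=> LF; elim: s => [|j s ih].
  by under eq_fun do rewrite big_nil; exact: L2_cst0.
by under eq_fun do rewrite big_cons; exact: L2D.
Qed.

Lemma L2_lincomb (J : Type) (s : seq J) (c : J -> R[i]) (F : J -> T -> R[i]) :
  (forall j, L2 mu (F j)) -> L2 mu (fun x => \sum_(j <- s) c j * F j x).
Proof. by move=> LF; apply: L2_sum => j; exact: L2Z. Qed.

Lemma L2norm_triangle f g : cmeasurable_fun f -> cmeasurable_fun g ->
  (L2norm mu (fun x => f x + g x)%R <= L2norm mu f + L2norm mu g)%E.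
Proof.
move=> mf mg.
have := @minkowski_EFin _ _ _ mu _ _ 2 (measurable_normc mf) (measurable_normc mg).
move=> /(_ (ler1n _ 2)); apply: le_trans.
have nn h : L2norm mu h = Lnorm mu 2%:E (fun x => (normc (h x))%:E) by [].
set k := (X in (_ <= Lnorm _ _ X)%E).
(* Minkowski is applied to the real functions [|f|] and [|g|]; their sum, read as a complex-valued
   function, dominates [f + g] pointwise. *)
pose k' x : R[i] := (normc (f x) + normc (g x))%:C.
have mk : cmeasurable_fun k'.
  split; last exact: measurable_cst.
  by apply: measurable_funD; exact: measurable_normc.
have -> : (Lnorm mu 2%:E k = L2norm mu k').
  rewrite nn; congr (Lnorm _ _ _); apply/funext => x; rewrite normc_real.
  by rewrite ger0_norm// addr_ge0// normc_ge0.
rewrite !L2norm_nsq gt0_ler_poweR// ?in_itv/= ?nsq_ge0 ?leey//.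
apply: nsq_le => //; first exact: cmeasurableD.
move=> x; rewrite normc_real ger0_norm ?addr_ge0 ?normc_ge0//.
exact: normcD_le.
Qed.

Lemma integrable_normcM f g : L2 mu f -> L2 mu g ->
  mu.-integrable setT (fun x => (normc (f x) * normc (g x))%:E).
Proof.
move=> Lf Lg; have mf := L2_measurable Lf; have mg := L2_measurable Lg.
have i1 h : L2 mu h -> mu.-integrable setT (fun x => (normc (h x) ^+ 2)%:E).
  move=> /L2P[mh hy]; apply/integrableP; split; first exact: measurable_normc_sqr.
  apply: le_lt_trans hy; rewrite le_eqVlt; apply/orP; left; apply/eqP.
  by apply: eq_integral => x _; rewrite abse_EFin ger0_norm ?sqr_ge0.
have := integrableD measurableT (i1 _ Lf) (i1 _ Lg).
apply: le_integrable => //.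
  by apply/measurable_EFinP; exact: measurable_normcM.
move=> x _ /=; rewrite lee_fin.
rewrite !ger0_norm ?addr_ge0 ?mulr_ge0 ?sqr_ge0 ?normc_ge0//.
have := sqr_ge0 (normc (f x) - normc (g x)).
by have := sqr_ge0 (normc (f x)); have := sqr_ge0 (normc (g x)); nra.
Qed.

Lemma cintegrable_dom h (k : T -> R) : cmeasurable_fun h ->
  mu.-integrable setT (EFin \o k) -> (forall x, normc (h x) <= k x) ->
  cintegrable mu h.
Proof.
move=> [m1 m2] ik hk; split; apply: le_integrable ik => //.
- exact/measurable_EFinP.
- move=> x _ /=; rewrite lee_fin (le_trans (normr_Re_le _))//.
  by rewrite (le_trans (hk x))// ler_norm.
- exact/measurable_EFinP.
- move=> x _ /=; rewrite lee_fin (le_trans (normr_Im_le _))//.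
  by rewrite (le_trans (hk x))// ler_norm.
Qed.

Lemma cintegralD f g : cintegrable mu f -> cintegrable mu g ->
  cintegral mu (fun x => f x + g x) = cintegral mu f + cintegral mu g.
Proof.
move=> [f1 f2] [g1 g2]; rewrite /cintegral.
apply/eqP; rewrite eq_complex ReD ImD /=; apply/andP; split; apply/eqP.
  by rewrite -RintegralD//; apply: eq_Rintegral => x _; rewrite ReD.
by rewrite -RintegralD//; apply: eq_Rintegral => x _; rewrite ImD.
Qed.

Lemma cintegralZ (c : R[i]) f : cintegrable mu f ->
  cintegral mu (fun x => c * f x) = c * cintegral mu f.
Proof.
move=> [f1 f2]; rewrite /cintegral.
have iZ (a : R) (k : T -> R) : mu.-integrable setT (fun x => (k x)%:E) ->
    mu.-integrable setT (fun x => (a * k x)%:E).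
  by move=> ik; apply: eq_integrable (integrableZl measurableT a ik).
apply/eqP; rewrite eq_complex ReM ImM /=; apply/andP; split; apply/eqP.
  rewrite -!RintegralZl// -RintegralB//; try exact: iZ.
  by apply: eq_Rintegral => x _; rewrite ReM.
rewrite -!RintegralZl// -RintegralD//; try exact: iZ.
by apply: eq_Rintegral => x _; rewrite ImM.
Qed.

Lemma cintegral_conj f : cintegrable mu f ->
  cintegral mu (fun x => conjc (f x)) = conjc (cintegral mu f).
Proof.
move=> [f1 f2]; rewrite /cintegral /=; congr Complex.
  by apply: eq_Rintegral => x _; case: (f x).
rewrite -mulN1r -RintegralZl//.
by apply: eq_Rintegral => x _; case: (f x) => a b; rewrite mulN1r.
Qed.

(** Real and imaginary parts are estimated separately, whence the factor 2. *)
Lemma normc_cintegral_le h (c : R) : cmeasurable_fun h ->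
  (\int[mu]_x (normc (h x))%:E <= c%:E)%E -> normc (cintegral mu h) <= 2 * c.
Proof.
move=> mh hc; have [m1 m2] := mh.
have ih : mu.-integrable setT (fun x => (normc (h x))%:E).
  apply/integrableP; split; first by apply/measurable_EFinP/measurable_normc.
  apply: le_lt_trans (ltry c); apply: le_trans hc.
  by under eq_integral do rewrite abse_EFin ger0_norm ?normc_ge0//.
have [i1 i2] : cintegrable mu h by exact: cintegrable_dom ih _.
have key (k : T -> R) : mu.-integrable setT (EFin \o k) ->
    (forall x, `|k x| <= normc (h x)) -> `|\int[mu]_x k x| <= c.
  move=> ik kh; apply: le_trans (le_normr_Rintegral measurableT ik) _.
  rewrite -lee_fin; apply: le_trans hc; rewrite /Rintegral fineK.
    apply: ge0_le_integral => //.
    - by case/integrableP: (integrable_norm ik).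
    - by case/integrableP: ih.
    - by move=> x _; rewrite lee_fin.
  by apply: integrable_fin_num => //; exact: integrable_norm.
apply: le_trans (normc_le_ReIm _) _; rewrite /cintegral /=.
rewrite mulr2n mulrDl !mul1r lerD//; apply: key => // x.
  exact: normr_Re_le.
exact: normr_Im_le.
Qed.

Lemma cintegrable_inner f g : L2 mu f -> L2 mu g ->
  cintegrable mu (fun x => f x * conjc (g x)).
Proof.
move=> Lf Lg; apply: cintegrable_dom (integrable_normcM Lf Lg) _.
  apply: cmeasurableM; first exact: L2_measurable.
  by apply: cmeasurable_conj; exact: L2_measurable.
by move=> x; rewrite Normc.normcM normc_conj.
Qed.

Lemma innerDl f g h : L2 mu f -> L2 mu g -> L2 mu h ->
  inner mu (fun x => f x + g x) h = inner mu f h + inner mu g h.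
Proof.
move=> Lf Lg Lh; rewrite /inner -cintegralD; try exact: cintegrable_inner.
by congr cintegral; apply/funext => x; rewrite mulrDl.
Qed.

Lemma innerZl (c : R[i]) f h : L2 mu f -> L2 mu h ->
  inner mu (fun x => c * f x) h = c * inner mu f h.
Proof.
move=> Lf Lh; rewrite /inner -cintegralZ; last exact: cintegrable_inner.
by congr cintegral; apply/funext => x; rewrite mulrA.
Qed.

Lemma inner_conj f g : L2 mu f -> L2 mu g ->
  inner mu g f = conjc (inner mu f g).
Proof.
move=> Lf Lg; rewrite /inner -cintegral_conj; last exact: cintegrable_inner.
by congr cintegral; apply/funext => x; rewrite conjcM conjcK mulrC.
Qed.

Lemma innerDr f g h : L2 mu f -> L2 mu g -> L2 mu h ->
  inner mu h (fun x => f x + g x) = inner mu h f + inner mu h g.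
Proof.
move=> Lf Lg Lh; rewrite inner_conj ?innerDl ?conjcD//; last exact: L2D.
by rewrite -!inner_conj.
Qed.

Lemma inner0l h : L2 mu h -> inner mu (fun=> 0) h = 0.
Proof.
move=> Lh; rewrite -[RHS](mul0r (inner mu (fun=> 0) h)) -innerZl//.
  by congr inner; apply/funext => x; rewrite mul0r.
exact: L2_cst0.
Qed.

Lemma innerNl f h : L2 mu f -> L2 mu h -> inner mu (fun x => - f x) h = - inner mu f h.
Proof.
move=> Lf Lh; rewrite -[RHS]mulN1r -innerZl//.
by congr (inner _ _ _); apply/funext => x; rewrite mulN1r.
Qed.

Lemma innerNr f h : L2 mu f -> L2 mu h -> inner mu h (fun x => - f x) = - inner mu h f.
Proof.
move=> Lf Lh; rewrite inner_conj//; last exact: L2N.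
by rewrite innerNl// conjcN -inner_conj.
Qed.

Lemma innerBl f g h : L2 mu f -> L2 mu g -> L2 mu h ->
  inner mu (fun x => f x - g x) h = inner mu f h - inner mu g h.
Proof. by move=> Lf Lg Lh; rewrite innerDl ?innerNl//; exact: L2N. Qed.

Lemma innerBr f g h : L2 mu f -> L2 mu g -> L2 mu h ->
  inner mu h (fun x => f x - g x) = inner mu h f - inner mu h g.
Proof. by move=> Lf Lg Lh; rewrite innerDr ?innerNr//; exact: L2N. Qed.

Lemma inner_lincombl (J : Type) (s : seq J) (c : J -> R[i]) (F : J -> T -> R[i]) h :
  (forall j, L2 mu (F j)) -> L2 mu h ->
  inner mu (fun x => \sum_(j <- s) c j * F j x) h =
  \sum_(j <- s) c j * inner mu (F j) h.
Proof.
move=> LF Lh; elim: s => [|j s ih].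
  by under eq_fun do rewrite big_nil; rewrite big_nil inner0l.
under eq_fun do rewrite big_cons.
by rewrite big_cons innerDl ?ih ?innerZl//; [exact: L2Z|exact: L2_lincomb].
Qed.

Lemma inner_lincombr (J : Type) (s : seq J) (c : J -> R[i]) (F : J -> T -> R[i]) h :
  (forall j, L2 mu (F j)) -> L2 mu h ->
  inner mu h (fun x => \sum_(j <- s) c j * F j x) =
  \sum_(j <- s) conjc (c j) * inner mu h (F j).
Proof.
move=> LF Lh; rewrite inner_conj//; last exact: L2_lincomb.
rewrite inner_lincombl// conjc_sum; apply: eq_bigr => j _.
by rewrite conjcM -inner_conj.
Qed.

Lemma inner_self f : L2 mu f -> inner mu f f = (fine (nsq mu f))%:C.
Proof.
move=> Lf; rewrite /inner /cintegral; congr Complex.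
  by rewrite /Rintegral; congr fine; apply: eq_integral => x _; rewrite mulc_conj.
rewrite /Rintegral (eq_integral (fun=> 0%E)) ?integral0// => x _.
by rewrite mulc_conj.
Qed.

Lemma inner_ae_eq f f' g g' : L2 mu f -> L2 mu f' -> L2 mu g -> L2 mu g' ->
  ae_eq mu setT f f' -> ae_eq mu setT g g' -> inner mu f g = inner mu f' g'.
Proof.
move=> Lf Lf' Lg Lg' ff gg; have m u v : L2 mu u -> L2 mu v ->
    cmeasurable_fun (fun x => u x * conjc (v x)).
  move=> Lu Lv; apply: cmeasurableM; first exact: L2_measurable.
  by apply: cmeasurable_conj; exact: L2_measurable.
have [m1 m2] := m _ _ Lf Lg; have [m3 m4] := m _ _ Lf' Lg'.
rewrite /inner /cintegral /Rintegral.
congr (Complex (fine _) (fine _)); apply: ae_eq_integral => //;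
  (try exact/measurable_EFinP);
  by apply: filterS2 ff gg => x /(_ I) -> /(_ I) ->.
Qed.

End L2Closure.

Lemma geometric_small (R : realType) (K e : R) : 0 < e -> exists n, 2^-1 ^+ n * K < e.
Proof.
move=> e0; have c : (fun n => 2^-1 ^+ n * K) @ \oo --> (0 : R).
  rewrite -[X in _ --> X](mul0r K); apply: cvgMl.
  by apply: cvg_expr; rewrite ger0_norm ?invr_ge0// invf_lt1// ltr1n.
by have := cvgr_lt 0 c _ e0 => -[N _ hN]; exists N; exact: hN (leqnn N).
Qed.

Lemma ler_geometric (R : realType) (x y K : R) :
  (forall n, y <= x + 2^-1 ^+ n * K) -> y <= x.
Proof.
move=> h; rewrite leNgt; apply/negP => xy.
have yx : 0 < y - x by rewrite subr_gt0.
by have [n] := geometric_small K yx; have := h n; lra.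
Qed.

(** * Gram matrices, Bessel's inequality and completeness of a nearby family *)

Section GramMatrices.
Context {d : measure_display} {T : measurableType d} {R : realType}.
Variable mu : {measure set T -> \bar R}.
Context {I : eqType}.
Implicit Types (U : seq I) (c : I -> R[i]) (F psi chi : I -> T -> R[i]).

Lemma normc_inner_sym f g : L2 mu f -> L2 mu g ->
  normc (inner mu f g) = normc (inner mu g f).
Proof. by move=> Lf Lg; rewrite inner_conj// normc_conj. Qed.

Lemma nsq_lincomb F U c : (forall a, L2 mu (F a)) ->
  (fine (nsq mu (fun x => \sum_(a <- U) c a * F a x)))%:C =
  \sum_(a <- U) \sum_(b <- U) c a * conjc (c b) * inner mu (F a) (F b).
Proof.
move=> LF; have LS := L2_lincomb U c LF.
rewrite -inner_self// inner_lincombl//; apply: eq_bigr => a _.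
rewrite inner_lincombr// mulr_sumr; apply: eq_bigr => b _.
by rewrite mulrA.
Qed.

(** Schur test. The Gram matrix is Hermitian, so [|c a| |c b| <= (|c a|^2 + |c b|^2) / 2] followed
    by an exchange of the two sums turns a bound on the rows alone into a bound on the quadratic
    form. *)
Lemma nsq_lincomb_le F U c (rho : R) : (forall a, L2 mu (F a)) ->
  (forall a, \sum_(b <- U) normc (inner mu (F a) (F b)) <= rho) ->
  (nsq mu (fun x => \sum_(a <- U) c a * F a x)%R
     <= (rho * \sum_(a <- U) normc (c a) ^+ 2)%:E)%E.
Proof.
move=> LF hrho; have LS := L2_lincomb U c LF.
rewrite (L2_nsq LS) lee_fin.
set N := fine _.
have N0 : 0 <= N by rewrite fine_ge0// nsq_ge0.
have -> : N = normc (N%:C) by rewrite normc_real ger0_norm.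
rewrite /N nsq_lincomb//.
apply: le_trans (normc_sum _ _) _.
pose G a b := normc (inner mu (F a) (F b)).
have h1 : \sum_(a <- U) normc (\sum_(b <- U) c a * conjc (c b) * inner mu (F a) (F b))
   <= \sum_(a <- U) \sum_(b <- U)
       (2^-1 * (normc (c a) ^+ 2 * G a b) + 2^-1 * (normc (c b) ^+ 2 * G b a)).
  apply: ler_sum => a _; apply: le_trans (normc_sum _ _) _.
  apply: ler_sum => b _; rewrite !Normc.normcM normc_conj.
  rewrite /G (normc_inner_sym (LF b) (LF a)).
  set g := normc (inner _ _ _).
  have g0 : 0 <= g by exact: normc_ge0.
  have : 0 <= 2^-1 * (normc (c a) - normc (c b)) ^+ 2 * g.
    by apply: mulr_ge0 => //; apply: mulr_ge0 => //; exact: sqr_ge0.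
  by nra.
apply: le_trans h1 _.
under eq_bigr do rewrite big_split /=.
rewrite big_split /= [X in _ + X]exchange_big /= -mulr2n.
under eq_bigr do rewrite -mulr_sumr -mulr_sumr.
rewrite -mulr_sumr -[X in X <= _]mulr_natr mulrC mulrA mulfV// mul1r mulr_sumr.
apply: ler_sum => a _; rewrite mulrC ler_wpM2r ?sqr_ge0//.
exact: hrho.
Qed.

Lemma bessel psi U (k : T -> R[i]) : orthonormal_family mu psi -> uniq U ->
  L2 mu k -> \sum_(a <- U) normc (inner mu k (psi a)) ^+ 2 <= fine (nsq mu k).
Proof.
move=> [Lpsi opsi] uU Lk; pose c a := inner mu k (psi a).
have LS := L2_lincomb U c Lpsi.
pose S x := \sum_(a <- U) c a * psi a x.
have key : (fine (nsq mu (fun x => k x - S x)))%:C =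
    (fine (nsq mu k))%:C - \sum_(a <- U) (normc (c a) ^+ 2)%:C.
  rewrite -!inner_self//; last exact: L2B.
  rewrite innerBl//; last exact: L2B.
  rewrite !innerBr// inner_lincombr//.
  have -> : inner mu S S = \sum_(a <- U) (normc (c a) ^+ 2)%:C.
    rewrite inner_lincombl//; apply: eq_big_seq => a aU.
    rewrite inner_lincombr// (bigD1_seq a)//= big1 ?addr0.
      by rewrite opsi asboolT// mulr1 mulc_conj.
    by move=> b ba; rewrite opsi asboolF ?mulr0// => ab; rewrite ab eqxx in ba.
  have -> : inner mu S k = \sum_(a <- U) (normc (c a) ^+ 2)%:C.
    rewrite inner_lincombl//; apply: eq_bigr => a _.
    by rewrite (inner_conj Lk)// mulc_conj.
  have -> : \sum_(j <- U) conjc (c j) * inner mu k (psi j) =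
            \sum_(a <- U) (normc (c a) ^+ 2)%:C.
    by apply: eq_bigr => a _; rewrite mulrC mulc_conj.
  by rewrite subrr subr0.
have /(congr1 (@complex.Re R)) := key.
rewrite /= ReD ReN Re_sum /= => keyR.
by rewrite -subr_ge0 -keyR fine_ge0// nsq_ge0.
Qed.

Lemma nsq_orthonormal psi U c : orthonormal_family mu psi -> uniq U ->
  nsq mu (fun x => \sum_(a <- U) c a * psi a x) =
  (\sum_(a <- U) normc (c a) ^+ 2)%:E.
Proof.
move=> [Lpsi opsi] uU; rewrite (L2_nsq (L2_lincomb U c Lpsi)); congr (_%:E).
apply: (@complexI R); rewrite nsq_lincomb// rmorph_sum /=.
apply: eq_big_seq => a aU; rewrite (bigD1_seq a)//= big1 ?addr0.
  by rewrite opsi asboolT// mulr1 mulc_conj.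
by move=> b ba; rewrite opsi asboolF ?mulr0// => ab; rewrite ab eqxx in ba.
Qed.

(** Completeness provides lists in which an index may recur, whereas orthonormal expansions sum over
    distinct indices. [U] and [c] do not depend on [F]: merging acts on the coefficients alone. *)
Lemma lincomb_merge (s : seq (R[i] * I)) : exists2 U, uniq U & exists c,
  forall F x, \sum_(p <- s) p.1 * F p.2 x = \sum_(a <- U) c a * F a x.
Proof.
exists (undup (map snd s)); first exact: undup_uniq.
exists (fun a => \sum_(p <- s | p.2 == a) p.1) => F x.
under [RHS]eq_bigr do rewrite mulr_suml.
under [RHS]eq_bigr do rewrite big_mkcond.
rewrite exchange_big /=; apply: eq_big_seq => p ps.
rewrite (bigD1_seq p.2) ?undup_uniq ?mem_undup ?map_f//= eqxx big1 ?addr0//.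
by move=> a; rewrite eq_sym => /negbTE ->.
Qed.

Variable A : (T -> R[i]) -> (T -> R[i]).

Lemma L2rangeD (c : R[i]) f g : bounded_linear_operator mu A ->
  L2range mu A f -> L2range mu A g -> L2range mu A (fun x => c * f x + g x).
Proof.
move=> [_ _ Alin _] [Lf [f0 Lf0 ff0]] [Lg [g0 Lg0 gg0]]; split.
  by apply: L2D => //; exact: L2Z.
exists (fun x => c * f0 x + g0 x); first by apply: L2D => //; exact: L2Z.
have := Alin c f0 g0 Lf0 Lg0.
by apply: filterS3 ff0 gg0 => x /(_ Logic.I) -> /(_ Logic.I) -> /(_ Logic.I) ->.
Qed.

Lemma L2range0 : bounded_linear_operator mu A -> L2range mu A (fun=> 0).
Proof.
move=> [_ _ Alin _]; have L0 := L2_cst0 mu; split => //.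
exists (fun=> 0) => //; have := Alin (-1) (fun=> 0) (fun=> 0) L0 L0.
apply: filterS => x /(_ Logic.I) h _.
rewrite -[LHS](addNr (A (fun=> 0) x)) -mulN1r -h.
by congr (A _ x); apply/funext => y; rewrite mulr0 addr0.
Qed.

Lemma L2range_lincomb F U c : bounded_linear_operator mu A ->
  (forall a, L2range mu A (F a)) ->
  L2range mu A (fun x => \sum_(a <- U) c a * F a x).
Proof.
move=> hA RF; elim: U => [|a U ih].
  by under eq_fun do rewrite big_nil; exact: L2range0.
by under eq_fun do rewrite big_cons; exact: L2rangeD.
Qed.

Lemma L2rangeB_lincomb f F U c : bounded_linear_operator mu A ->
  L2range mu A f -> (forall a, L2range mu A (F a)) ->
  L2range mu A (fun x => f x - \sum_(a <- U) c a * F a x).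
Proof.
move=> hA Rf RF.
have := L2rangeD (-1) hA (L2range_lincomb U c hA RF) Rf.
by under eq_fun do rewrite mulN1r addrC.
Qed.

(* Replacing [psi] by [chi] in an approximation of [f] leaves a residual of at
   most half the squared norm; iterating makes it arbitrarily small. *)
Lemma near_basis_complete psi chi (q : R) : bounded_linear_operator mu A ->
  orthonormal_basis_of_range mu A psi -> orthonormal_family mu chi ->
  (forall a, L2range mu A (chi a)) -> 0 <= q -> 16 * q <= 1 ->
  (forall U c, uniq U ->
    (nsq mu (fun x => \sum_(a <- U) c a * (psi a x - chi a x))%R
      <= (q * \sum_(a <- U) normc (c a) ^+ 2)%:E)%E) ->
  orthonormal_basis_of_range mu A chi.
Proof.
move=> hA [opsi Rpsi dpsi] ochi Rchi q0 q1 hq; split => //.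
have Lpsi a : L2 mu (psi a) by have [? _] := opsi.
have Lchi a : L2 mu (chi a) by have [? _] := ochi.
have step f : L2range mu A f -> exists s : seq (R[i] * I),
    fine (nsq mu (fun x => f x - \sum_(p <- s) p.1 * chi p.2 x)) <=
    2^-1 * fine (nsq mu f).
  move=> Rf; have [Lf _] := Rf; set N := fine (nsq mu f).
  have : 0 <= N by rewrite fine_ge0// nsq_ge0.
  rewrite le_eqVlt => /predU1P[N0|N0].
    exists [::]; under eq_fun do rewrite big_nil subr0.
    by rewrite -/N -N0 mulr0.
  (* If [nsq r <= N / 16], then [nsq S <= 2 N + N / 8], and the new residual [r + D] has squared
     norm at most [N / 8 + 2 q (17 / 8) N <= N / 2], because [16 * q <= 1]. *)
  pose e := Num.sqrt (N / 16).
  have e0 : 0 < e by rewrite sqrtr_gt0 divr_gt0.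
  have e2 : e ^+ 2 = N / 16 by rewrite sqr_sqrtr// divr_ge0// ltW.
  have [s0 hs0] := dpsi f Rf e e0.
  have [U uU [c hc]] := lincomb_merge s0.
  exists [seq (c a, a) | a <- U].
  under eq_fun do rewrite big_map /=.
  pose S x := \sum_(a <- U) c a * psi a x.
  have LS : L2 mu S by exact: L2_lincomb.
  pose r x := f x - S x.
  have Lr : L2 mu r by exact: L2B.
  have hr : (nsq mu r <= (N / 16)%:E)%E.
    rewrite -e2 -(L2norm_le _ _ (ltW e0)); apply/ltW; move: hs0.
    by under eq_fun do rewrite hc.
  pose D x := \sum_(a <- U) c a * (psi a x - chi a x).
  have LD : L2 mu D by apply: L2_lincomb => a; exact: L2B.
  have hD := hq U c uU; rewrite -/D in hD.
  have -> : (fun x => f x - \sum_(a <- U) c a * chi a x) = (fun x => r x + D x).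
    apply/funext => x; rewrite /r /D /S.
    under [X in _ = _ + X]eq_bigr do rewrite mulrBr.
    by rewrite sumrB addrA subrK.
  have n1 := nsqD_le mu (L2_measurable Lr) (L2_measurable LD).
  have LNr := L2N Lr.
  have n2 := nsqD_le mu (L2_measurable Lf) (L2_measurable LNr).
  have eS : (fun x => f x + - r x) = S by apply/funext => x; rewrite /r; ring.
  have eN : nsq mu (fun x => - r x) = nsq mu r.
    by apply: eq_integral => x _; rewrite normcN_eq.
  rewrite eS eN (nsq_orthonormal c opsi uU) in n2.
  move: n1 n2 hr hD; rewrite (L2_nsq (L2D Lr LD)) (L2_nsq Lr) (L2_nsq LD) (L2_nsq Lf).
  rewrite -!EFinM -!EFinD !lee_fin -/N => n1 n2 hr hD.
  set C := \sum_(a <- U) _ in n2 hD.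
  have hqC : q * C <= q * (2 * N + 2 * (N / 16)).
    by rewrite ler_wpM2l//; lra.
  have : 16 * q * N <= N by rewrite -[leRHS]mul1r ler_wpM2r// ltW.
  by lra.
have iter n : forall f, L2range mu A f -> exists s : seq (R[i] * I),
    fine (nsq mu (fun x => f x - \sum_(p <- s) p.1 * chi p.2 x)) <=
    2^-1 ^+ n * fine (nsq mu f).
  elim: n => [|n ih] f Rf.
    exists [::]; under eq_fun do rewrite big_nil subr0.
    by rewrite expr0 mul1r.
  have [s hs] := step f Rf.
  have Rf' : L2range mu A (fun x => f x - \sum_(p <- s) p.1 * chi p.2 x).
    have [U uU [c hc]] := lincomb_merge s.
    under eq_fun do rewrite hc.
    exact: L2rangeB_lincomb.
  have [s' hs'] := ih _ Rf'.
  exists (s ++ s').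
  have -> : (fun x => f x - \sum_(p <- s ++ s') p.1 * chi p.2 x) =
      (fun x => f x - \sum_(p <- s) p.1 * chi p.2 x - \sum_(p <- s') p.1 * chi p.2 x).
    by apply/funext => x; rewrite big_cat opprD addrA.
  apply: le_trans hs' _; rewrite exprSr -mulrA ler_wpM2l//.
move=> f Rf e e0.
have e2 : 0 < (e / 2) ^+ 2 by rewrite exprn_gt0// divr_gt0.
have [n hn] := geometric_small (fine (nsq mu f)) e2.
have [s hs] := iter n f Rf; exists s.
have Lres : L2 mu (fun x => f x - \sum_(p <- s) p.1 * chi p.2 x).
  have [Lf _] := Rf; apply: L2B => //.
  have [U uU [c hc]] := lincomb_merge s.
  by under eq_fun do rewrite hc; exact: L2_lincomb.
apply: (@le_lt_trans _ _ (e / 2)%:E); last by rewrite lte_fin; lra.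
apply/L2norm_le; first by rewrite divr_ge0// ltW.
rewrite (L2_nsq Lres) lee_fin.
exact: le_trans hs (ltW hn).
Qed.

End GramMatrices.

(** * Integrable weights on the plane *)

Section LineIntegral.
Context {R : realType}.
Local Notation leb := (@lebesgue_measure R).

(** The exponent 5/4 is half that of [weight], so that a product of two such factors, one per
    coordinate, dominates the inverse weight; it exceeds 1, so each factor is integrable. *)
Definition line_decay (x : R) : R := (1 + `|x|) `^ (- (5 / 4)).

Lemma continuous_line_decay : continuous line_decay.
Proof.
move=> x; rewrite /line_decay.
apply: (@continuous_comp _ _ _ (fun x : R => 1 + `|x|) (fun y => y `^ (- (5 / 4)))).
  by apply: continuousD; [exact: cst_continuous|exact: norm_continuous].
have p : 0 < 1 + `|x| by rewrite ltr_pwDl.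
apply/differentiable_continuous/derivable1_diffP.
by apply: derivable_powR; rewrite in_itv/= andbT.
Qed.

Lemma line_decay_ge0 x : 0 <= line_decay x.
Proof. exact: powR_ge0. Qed.

Lemma integral_line_decay : (\int[leb]_x (line_decay x)%:E)%E = 8%:E.
Proof.
rewrite ge0_symfun_integralT; last first.
- by move=> x; rewrite /line_decay /= normrN.
- exact: continuous_line_decay.
- exact: line_decay_ge0.
pose f (x : R) : R := (1 + x) `^ (- (5 / 4)).
(* [F] is the primitive of [f] that vanishes at infinity; each half line contributes [- F 0 = 4]. *)
pose F (x : R) : R := - 4 * (1 + x) `^ (- (1 / 4)).
have dF (x : R) : 0 <= x -> is_derive x 1 F (f x).
  move=> x0; have p : 0 < 1 + x by rewrite ltr_pwDl.
  have h1 := @is_derive1_powR R (- (1 / 4)) (1 + x) p.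
  have h2 : is_derive x 1 (fun x : R => 1 + x) 1.
    by have := is_deriveD (is_derive_cst (1 : R) x 1) (is_derive_id x 1); rewrite add0r.
  have h3 := is_derive1_comp h1 h2.
  have h4 := is_deriveZ (- 4) h3.
  apply: is_derive_eq (h4) _.
  rewrite /f /GRing.scale /= (_ : - (1 / 4) - 1 = - (5 / 4)); last by lra.
  by set y := powR _ _; lra.
rewrite -set_itvcy.
have -> : (\int[leb]_(x in `[0%R, +oo[) (line_decay x)%:E =
           \int[leb]_(x in `[0%R, +oo[) (f x)%:E)%E.
  apply: eq_integral.
  by move=> x; rewrite inE /= in_itv/= andbT => x0; rewrite /line_decay /f ger0_norm.
rewrite (@ge0_continuous_FTC2y _ f F 0 0).
- by rewrite /F addr0 powR1 mulr1 sub0e -EFinN opprK -EFinM; congr (_%:E); lra.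
- by move=> x _; exact: powR_ge0.
- apply/continuous_within_itvcyP.
  have cf x : 0 <= x -> {for x, continuous f}.
    move=> x0; have p : 0 < 1 + x by rewrite ltr_pwDl.
    apply: (@continuous_comp _ _ _ (fun x : R => 1 + x) (fun y => y `^ (- (5 / 4)))).
      by apply: continuousD; [exact: cst_continuous|].
    apply/differentiable_continuous/derivable1_diffP.
    by apply: derivable_powR; rewrite in_itv/= andbT.
  split; first by move=> x; rewrite in_itv/= andbT => /ltW; exact: cf.
  by apply: cvg_at_right_filter; exact: cf.
- rewrite /F -[X in _ --> X](mulr0 (- 4)); apply: cvgMr.
  apply/cvgrPdist_lt => e e0; near=> x.
  have x0 : 0 <= x by near: x; exact: nbhs_pinfty_ge.
  (* Since the fourth root of [e ^ (-4)] is [1 / e], beyond this threshold [(1 + x) ^ (-1/4)] is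
     less than [e]. *)
  have xe : e `^ (- 4) <= x by near: x; apply: nbhs_pinfty_ge; exact: num_real.
  have e1 : e^-1 < (1 + x) `^ (1 / 4).
    have -> : e^-1 = (e `^ (- 4)) `^ (1 / 4).
      by rewrite -powRrM (_ : - 4 * (1 / 4) = - 1) ?powR_inv1 ?ltW//; lra.
    apply: gt0_ltr_powR; rewrite ?nnegrE ?in_itv/= ?andbT ?powR_ge0 ?addr_ge0//.
    by apply: (le_lt_trans xe); rewrite ltrDr.
  rewrite sub0r normrN ger0_norm ?powR_ge0// powRN -[ltRHS]invrK.
  by rewrite ltf_pV2// ?posrE ?invr_gt0// powR_gt0// ltr_pwDl.
- by move=> x /ltW /dF [].
- apply: cvg_at_right_filter.
  by apply/differentiable_continuous/derivable1_diffP; have [] := dF 0 (lexx _).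
- by move=> x; rewrite in_itv/= andbT => /ltW /dF []; rewrite derive1E.
Unshelve. all: by end_near.
Qed.

Lemma integral_line_decay_shift (m : R) :
  (\int[leb]_x (line_decay (x - m))%:E)%E = 8%:E.
Proof.
rewrite -integral_line_decay.
have d1 (x : R) : is_derive x 1 (fun x : R => x - m) 1.
  by have := is_deriveB (is_derive_id x 1) (is_derive_cst m x 1); rewrite subr0.
have e1 : derive1 (fun x : R => x - m) = (fun=> 1).
  by apply/funext => x; rewrite derive1E; have [_] := d1 x.
rewrite (@increasing_ge0_integration_by_substitutionT _ (fun x => x - m) line_decay).
- by apply: eq_integral => x _ /=; rewrite e1 /= mulr1.
- by move=> x y; rewrite ltrD2r.
- by rewrite e1; exact: cst_continuous.
- by rewrite e1; exact: is_cvg_cst.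
- by rewrite e1; exact: is_cvg_cst.
- by move=> x; have [] := d1 x.
- exact: cvg_addrr_Ny.
- exact: cvg_addrr.
- exact: continuous_line_decay.
- exact: line_decay_ge0.
Qed.

End LineIntegral.

(** * Euclidean norm, bracket and polynomial weight on the plane *)

Section PlaneGeometry.
Context {R : realType}.
Implicit Types x y z : R * R.

Lemma enorm_ge0 x : 0 <= enorm x.
Proof. exact: sqrtr_ge0. Qed.

Lemma sqr_enorm x : enorm x ^+ 2 = x.1 ^+ 2 + x.2 ^+ 2.
Proof. by rewrite sqr_sqrtr// addr_ge0// sqr_ge0. Qed.

Lemma enorm0 : enorm (0 : R * R) = 0.
Proof. by rewrite /enorm !expr0n addr0 sqrtr0. Qed.

Lemma enormN x : enorm (- x) = enorm x.
Proof. by rewrite /enorm /= !sqrrN. Qed.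

Lemma enorm_dist x y : enorm (x - y) = enorm (y - x).
Proof. by rewrite -enormN opprB. Qed.

Lemma enormD_le x y : enorm (x + y) <= enorm x + enorm y.
Proof. exact: (normcD_le (x.1 +i* x.2) (y.1 +i* y.2)). Qed.

Lemma enorm_triangle z x y : enorm (x - y) <= enorm (x - z) + enorm (z - y).
Proof. by rewrite (le_trans _ (enormD_le _ _))// subrKA. Qed.

Lemma jbracket_ge0 x : 0 <= jbracket x.
Proof. exact: sqrtr_ge0. Qed.

Lemma sqr_jbracket x : jbracket x ^+ 2 = 1 + enorm x ^+ 2.
Proof. by rewrite sqr_sqrtr// addr_ge0// sqr_ge0. Qed.

Lemma jbracket_ge1 x : 1 <= jbracket x.
Proof.
rewrite -(ler_pXn2r (n := 2))// ?nnegrE ?jbracket_ge0// expr1n sqr_jbracket.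
by rewrite lerDl sqr_ge0.
Qed.

Lemma jbracket_gt0 x : 0 < jbracket x.
Proof. exact: lt_le_trans ltr01 (jbracket_ge1 x). Qed.

Lemma enorm_le_jbracket x : enorm x <= jbracket x.
Proof.
rewrite -(ler_pXn2r (n := 2))// ?nnegrE ?jbracket_ge0 ?enorm_ge0//.
by rewrite sqr_jbracket lerDr.
Qed.

Lemma jbracket_le x : jbracket x <= 1 + enorm x.
Proof.
have e0 := enorm_ge0 x.
rewrite -(ler_pXn2r (n := 2))// ?nnegrE ?jbracket_ge0 ?addr_ge0//.
by rewrite sqr_jbracket; nra.
Qed.

Lemma jbracket_dist x y : jbracket (x - y) = jbracket (y - x).
Proof. by rewrite /jbracket enorm_dist. Qed.

(** After squaring and the triangle inequality this is [1 + (b + c)^2 <= 4 (1 + b^2) (1 + c^2)]. *)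
Lemma jbracket_peetre z x y :
  jbracket (x - y) <= 2 * (jbracket (x - z) * jbracket (z - y)).
Proof.
have h := enorm_triangle z x y.
have j1 := jbracket_ge0 (x - z); have j2 := jbracket_ge0 (z - y).
rewrite -(ler_pXn2r (n := 2))// ?nnegrE ?jbracket_ge0 ?mulr_ge0//.
rewrite !exprMn !sqr_jbracket.
have := enorm_ge0 (x - z); have := enorm_ge0 (z - y); have := enorm_ge0 (x - y).
move: h; set a := enorm _; set b := enorm _; set c := enorm _ => h a0 c0 b0.
have h2 : a ^+ 2 <= (b + c) ^+ 2 by rewrite ler_pXn2r// nnegrE ?addr_ge0.
have := sqr_ge0 (b - c); have := mulr_ge0 (sqr_ge0 b) (sqr_ge0 c).
by have := sqr_ge0 b; have := sqr_ge0 c; nra.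
Qed.

Definition weight x : R := jbracket x `^ (5 / 2).

Lemma weight_gt0 x : 0 < weight x.
Proof. by rewrite powR_gt0// jbracket_gt0. Qed.

Lemma weight_ge0 x : 0 <= weight x.
Proof. exact/ltW/weight_gt0. Qed.

Lemma weight_ge1 x : 1 <= weight x.
Proof.
rewrite -[leLHS](congr1 (@^~ (5 / 2)) (powR1 R)); apply: ge0_ler_powR => //.
- by rewrite nnegrE.
- by rewrite nnegrE jbracket_ge0.
- exact: jbracket_ge1.
Qed.

Lemma sqr_weight x : weight x ^+ 2 = jbracket x `^ 5.
Proof.
rewrite -powR_mulrn ?weight_ge0// /weight -powRrM.
by congr (_ `^ _); lra.
Qed.

Lemma weight_le x (L : R) : jbracket x <= L -> weight x <= L `^ (5 / 2).
Proof.
move=> xL; apply: ge0_ler_powR; rewrite ?nnegrE ?jbracket_ge0//.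
exact: le_trans (jbracket_ge0 x) xL.
Qed.

Lemma weight_dist x y : weight (x - y) = weight (y - x).
Proof. by rewrite /weight jbracket_dist. Qed.

Definition cpeetre : R := 2 `^ (5 / 2).

Lemma cpeetre_gt0 : 0 < cpeetre.
Proof. exact: powR_gt0. Qed.

Lemma weight_peetre z x y :
  weight (x - y) <= cpeetre * (weight (x - z) * weight (z - y)).
Proof.
rewrite /weight /cpeetre -!powRM ?mulr_ge0 ?jbracket_ge0//.
apply: ge0_ler_powR; rewrite ?nnegrE ?mulr_ge0 ?jbracket_ge0//.
exact: jbracket_peetre.
Qed.

(** This is the 5/4-th power of [(1 + a) (1 + b) <= 2 (1 + a^2 + b^2)], with [a] and [b] the
    absolute values of the coordinates. *)
Lemma weight_inv_line x :
  (weight x)^-1 <= 2 `^ (5 / 4) * (line_decay x.1 * line_decay x.2).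
Proof.
rewrite /line_decay !powRN -invfM.
rewrite ler_pdivlMr ?mulr_gt0 ?powR_gt0 ?ltr_pwDl//.
rewrite mulrC ler_pdivrMr ?weight_gt0//.
rewrite /weight (_ : 5 / 2 = 2%:R * (5 / 4)); last by lra.
rewrite (powRrM (jbracket x)) (powR_mulrn 2 (jbracket_ge0 x)).
rewrite -!powRM ?addr_ge0 ?sqr_ge0 ?jbracket_ge0//.
apply: ge0_ler_powR; rewrite ?nnegrE ?mulr_ge0 ?addr_ge0 ?sqr_ge0 ?jbracket_ge0//.
rewrite sqr_jbracket sqr_enorm.
rewrite -(real_normK (num_real x.1)) -(real_normK (num_real x.2)).
move: (normr_ge0 x.1) (normr_ge0 x.2).
set a := `|x.1|; set b := `|x.2| => a0 b0.
have := sqr_ge0 (a - 1); have := sqr_ge0 (b - 1); have := sqr_ge0 (a - b).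
by nra.
Qed.

(** The squared weight is [<x>^5 <= (1 + |x|)^6], and the sixth power of [k (1 + |x|) <= 1 + (eta /
    6) |x| <= e^(eta |x| / 6)] absorbs it. Two powers of the weight are needed because the kernel
    estimate spends one in Peetre's inequality and integrates the inverse of the other. *)
Lemma exp_weight_bound (eta : R) : 0 < eta ->
  exists2 C : R, 0 < C & forall x, expR (- eta * enorm x) * weight x ^+ 2 <= C.
Proof.
move=> eta0; pose k := Num.min 1 (eta / 6).
have k0 : 0 < k by rewrite /k lt_min ltr01 divr_gt0.
exists (k ^- 6) => [|x]; first by rewrite invr_gt0 exprn_gt0.
have w6 : weight x ^+ 2 <= (1 + enorm x) ^+ 6.
  apply: (@le_trans _ _ (jbracket x ^+ 6)).
    rewrite /weight -powR_mulrn ?powR_ge0// -powRrM.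
    rewrite -[leRHS]powR_mulrn ?jbracket_ge0//.
    apply: ler_powR; first exact: jbracket_ge1.
    by lra.
  by rewrite lerXn2r ?nnegrE ?jbracket_ge0 ?addr_ge0 ?enorm_ge0// jbracket_le.
have e6 : k ^+ 6 * (1 + enorm x) ^+ 6 <= expR (eta * enorm x).
  rewrite -exprMn (_ : eta * enorm x = eta / 6 * enorm x * 6%:R); last by field.
  have ke : k <= eta / 6 by rewrite /k ge_min lexx orbT.
  have k1 : k <= 1 by rewrite /k ge_min lexx.
  have h : k * (1 + enorm x) <= expR (eta / 6 * enorm x).
    apply: le_trans (expR_ge1Dx _).
    by rewrite mulrDr mulr1 lerD// ler_wpM2r// enorm_ge0.
  rewrite expRM_natr lerXn2r ?nnegrE ?expR_ge0// mulr_ge0 ?addr_ge0 ?enorm_ge0//.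
  exact: ltW.
rewrite mulNr expRN mulrC ler_pdivrMr ?expR_gt0// mulrC ler_pdivlMr ?exprn_gt0//.
rewrite mulrC; apply: le_trans e6; rewrite ler_wpM2l// exprn_ge0//.
exact: ltW.
Qed.

Section Measurability.
Context {d : measure_display} {T : measurableType d}.
Implicit Types f g : T -> R * R.

(** Measurability is recorded by coordinates, the form in which [enorm] consumes it. *)
Definition pmeasurable f :=
  measurable_fun setT (fun t => (f t).1) /\ measurable_fun setT (fun t => (f t).2).

Lemma pmeasurableB f g : pmeasurable f -> pmeasurable g ->
  pmeasurable (fun t => f t - g t).
Proof.
by move=> [f1 f2] [g1 g2]; split; apply: measurable_funB.
Qed.

Lemma pmeasurable_cst m : pmeasurable (fun=> m).
Proof. by split; exact: measurable_cst. Qed.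

Lemma measurable_enorm f : pmeasurable f -> measurable_fun setT (fun t => enorm (f t)).
Proof.
move=> [f1 f2]; apply: (measurableT_comp measurable_sqrt).
by apply: measurable_funD; exact: measurable_funX.
Qed.

Lemma measurable_jbracket f : pmeasurable f ->
  measurable_fun setT (fun t => jbracket (f t)).
Proof.
move=> mf; apply: (measurableT_comp measurable_sqrt).
apply: measurable_funD; first exact: measurable_cst.
by apply: measurable_funX; exact: measurable_enorm.
Qed.

Lemma measurable_weight f : pmeasurable f ->
  measurable_fun setT (fun t => weight (f t)).
Proof.
by move=> mf; apply: (measurableT_comp (measurable_powR _)); exact: measurable_jbracket.
Qed.

Lemma measurable_weight_inv f : pmeasurable f ->
  measurable_fun setT (fun t => (weight (f t))^-1).
Proof.
move=> mf; rewrite (_ : (fun t => _) = (fun t => jbracket (f t) `^ (- (5 / 2)))).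
  by apply: (measurableT_comp (measurable_powR _)); exact: measurable_jbracket.
by apply/funext => t; rewrite powRN.
Qed.

Lemma measurable_exp_enorm (c : R) f : pmeasurable f ->
  measurable_fun setT (fun t => expR (c * enorm (f t))).
Proof.
move=> mf; apply: (@measurableT_comp _ _ _ _ _ _ expR); first exact: measurable_expR.
by apply: measurable_funM => //; exact: measurable_enorm.
Qed.

End Measurability.

End PlaneGeometry.

Section PlaneIntegral.
Context {R : realType}.
Local Notation plane := (measurableTypeR R * measurableTypeR R)%type.
Local Notation leb2 := (@lebesgue2 R).

Lemma pmeasurable_id : pmeasurable (fun x : plane => (x : R * R)).
Proof. by split; [exact: measurable_fst|exact: measurable_snd]. Qed.

Lemma pmeasurable_sub (m : R * R) : pmeasurable (fun x : plane => (x : R * R) - m).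
Proof. by apply: pmeasurableB; [exact: pmeasurable_id|exact: pmeasurable_cst]. Qed.

Lemma pmeasurable_diff : pmeasurable (fun z : plane * plane => (z.1 : R * R) - z.2).
Proof.
apply: pmeasurableB; split.
- exact: (measurableT_comp measurable_fst measurable_fst).
- exact: (measurableT_comp measurable_snd measurable_fst).
- exact: (measurableT_comp measurable_fst measurable_snd).
- exact: (measurableT_comp measurable_snd measurable_snd).
Qed.

Definition kappa : R := 2 `^ (5 / 4) * 64.

Lemma kappa_gt0 : 0 < kappa.
Proof. by rewrite mulr_gt0// powR_gt0. Qed.

Lemma integral_weight_inv (m : R * R) :
  (\int[leb2]_x ((weight (x - m))^-1)%:E <= kappa%:E)%E.
Proof.
have mld (c : R) : measurable_fun setT (fun t : R => line_decay (t - c)).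
  apply: continuous_measurable_fun => t.
  apply: (@continuous_comp _ _ _ (fun t : R => t - c) line_decay).
    by apply: continuousB; [exact: cvg_id|exact: cst_continuous].
  exact: continuous_line_decay.
pose h (x : plane) : \bar R :=
  (2 `^ (5 / 4) * (line_decay (x.1 - m.1) * line_decay (x.2 - m.2)))%:E.
have mh : measurable_fun setT h.
  apply/measurable_EFinP; apply: measurable_funM => //.
  apply: measurable_funM.
    exact: (measurableT_comp (mld _) measurable_fst).
  exact: (measurableT_comp (mld _) measurable_snd).
have h0 x : (0 <= h x)%E.
  by rewrite lee_fin !mulr_ge0 ?powR_ge0// line_decay_ge0.
apply: (@le_trans _ _ (\int[leb2]_x h x)%E).
  apply: ge0_le_integral => //.
  - by move=> x _; rewrite lee_fin invr_ge0 weight_ge0.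
  - by apply/measurable_EFinP/measurable_weight_inv; exact: pmeasurable_sub.
  - by move=> x _; rewrite lee_fin; exact: weight_inv_line.
rewrite (fubini_tonelli1 h mh h0) /fubini_F /h /=.
have mE (c : R) : measurable_fun setT (fun t : R => (line_decay (t - c))%:E).
  exact/measurable_EFinP.
have inner_int (a : R) : (\int[@lebesgue_measure R]_y
    (2 `^ (5 / 4) * (line_decay (a - m.1) * line_decay (y - m.2)))%:E =
    (2 `^ (5 / 4) * 8)%:E * (line_decay (a - m.1))%:E)%E.
  under eq_integral do rewrite mulrA EFinM.
  rewrite ge0_integralZl_EFin//; last 3 first.
  - by move=> y _; rewrite lee_fin line_decay_ge0.
  - exact: mE.
  - by rewrite mulr_ge0 ?powR_ge0// line_decay_ge0.
  by rewrite integral_line_decay_shift -!EFinM mulrAC.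
under eq_integral do rewrite inner_int.
rewrite ge0_integralZl_EFin//; last 2 first.
- by move=> y _; rewrite lee_fin line_decay_ge0.
- exact: mE.
by rewrite integral_line_decay_shift -EFinM lee_fin /kappa -mulrA -natrM.
Qed.

End PlaneIntegral.

(** * Operators with an exponentially localized kernel *)

(** Tonelli: the measures of the sections of a null set integrate to zero, hence almost all of them
    vanish. *)
Lemma ae_section d1 d2 (T1 : measurableType d1) (T2 : measurableType d2)
    (R : realType) (m1 : {sigma_finite_measure set T1 -> \bar R})
    (m2 : {sigma_finite_measure set T2 -> \bar R}) (Q : T1 * T2 -> Prop) :
  {ae (m1 \x m2)%E, forall z, Q z} ->
  {ae m1, forall x, {ae m2, forall y, Q (x, y)}}.
Proof.
move=> [N [mN N0 QN]].
have mx := measurable_fun_xsection m2 mN.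
have /(ae_eq_integral_abs m1 measurableT mx) :
    (\int[m1]_x `|(m2 \o xsection N) x|)%E = 0%E.
  by rewrite -[RHS]N0; apply: eq_integral => x _; rewrite gee0_abs.
apply: filterS => x /(_ Logic.I) /= h.
exists (xsection N x); split => //; first exact: measurable_xsection.
by move=> y /= nQ; rewrite /xsection /= inE; exact: QN.
Qed.

Lemma ae_all_seq d (T : measurableType d) (R : realType)
    (mu : {measure set T -> \bar R}) (I : eqType) (U : seq I) (Q : I -> T -> Prop) :
  (forall a, {ae mu, forall x, Q a x}) ->
  {ae mu, forall x, forall a, a \in U -> Q a x}.
Proof.
move=> hQ; elim: U => [|a U ih]; first exact: aeW.
apply: filterS2 (hQ a) ih => x h1 h2 b.
by rewrite inE => /predU1P[->//|]; exact: h2.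
Qed.

(* Stated for a bundled measure: the filter instance of [lebesgue2] is not found
   by [filterS]. *)
Lemma ae_imp d (T : measurableType d) (R : realType)
    (mu : {measure set T -> \bar R}) (A Q : T -> Prop) :
  (forall x, A x -> Q x) -> {ae mu, forall x, A x} -> {ae mu, forall x, Q x}.
Proof. by move=> AQ; apply: filterS. Qed.

Lemma ae_imp2 d (T : measurableType d) (R : realType)
    (mu : {measure set T -> \bar R}) (A B Q : T -> Prop) :
  (forall x, A x -> B x -> Q x) ->
  {ae mu, forall x, A x} -> {ae mu, forall x, B x} -> {ae mu, forall x, Q x}.
Proof. by move=> AB hA hB; move: hA hB; apply: filterS2. Qed.

Section ExpKernel.
Context {R : realType}.
Local Notation plane := (measurableTypeR R * measurableTypeR R)%type.
Local Notation leb2 := (@lebesgue2 R).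
Variables (P : (R * R -> R[i]) -> (R * R -> R[i])) (K : (R * R) * (R * R) -> R[i]).
Variables (C g : R).
Hypothesis C0 : 0 < C.
Hypothesis g0 : 0 < g.
Hypothesis KP : integral_kernel leb2 P K.
Hypothesis Kdec : {ae (leb2 \x leb2)%E, forall z,
  normc (K z) <= C * expR (- g * enorm (z.1 - z.2))}.

Local Notation edec x y := (C * expR (- g * enorm (x - y))).

Lemma measurable_edec : measurable_fun setT
  (fun z : plane * plane => edec (z.1 : R * R) (z.2 : R * R)).
Proof.
by apply: measurable_funM => //; apply: measurable_exp_enorm; exact: pmeasurable_diff.
Qed.

Lemma cmeasurable_section (x : plane) :
  cmeasurable_fun (fun y : plane => K (x, y)).
Proof.
have [[K1 K2] _] := KP; split.
  exact: (measurableT_comp K1 (pair1_measurable x)).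
exact: (measurableT_comp K2 (pair1_measurable x)).
Qed.

Lemma ae_kernel_bound f : L2 leb2 f ->
  {ae leb2, forall x, ((normc (P f x))%:E <=
    2%:E * \int[leb2]_y (edec x y * normc (f y))%:E)%E}.
Proof.
move=> Lf; have [_ /(_ f Lf)] := KP; have := ae_section Kdec.
apply: filterS2 => x hx [ix ->].
have mf := L2_measurable Lf.
have mdx : measurable_fun setT (fun y : plane => edec x (y : R * R)).
  exact: (measurableT_comp measurable_edec (pair1_measurable (x : plane))).
have m2 : measurable_fun setT (fun y : plane => (edec x (y : R * R) * normc (f y))%:E).
  by apply/measurable_EFinP; apply: measurable_funM => //; exact: measurable_normc.
have p y : 0 <= edec x y * normc (f y).
  by rewrite !mulr_ge0 ?normc_ge0 ?expR_ge0// ltW.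
have mk : cmeasurable_fun (fun y : plane => K (x, y) * f y).
  by apply: cmeasurableM => //; exact: cmeasurable_section.
have le1 : (\int[leb2]_y (normc (K (x, y) * f y))%:E <=
    \int[leb2]_y (edec x y * normc (f y))%:E)%E.
  apply: ae_ge0_le_integral => //.
  - by move=> y _; rewrite lee_fin normc_ge0.
  - by apply/measurable_EFinP; exact: measurable_normc.
  - by move=> y _; rewrite lee_fin.
  - move: hx; apply: filterS => y hy _; rewrite lee_fin Normc.normcM.
    by rewrite ler_wpM2r ?normc_ge0.
set J := (\int[leb2]_y (edec x y * _)%:E)%E in le1 *.
have J0 : (0 <= J)%E by apply: integral_ge0 => y _; rewrite lee_fin.
(* When the dominating integral is infinite the bound is trivial, so its finiteness need not be
   established. *)
case: J J0 le1 => [j| |] //= J0 le1.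
  by rewrite -EFinM lee_fin; exact: normc_cintegral_le.
by rewrite mulry gtr0_sg// mul1e leey.
Qed.

(** The squared exponential is at most a multiple of the inverse weight centered at [x], whose
    integral is bounded independently of [x]. The conjugate appears because [P f x] is the inner
    product of [f] with it. *)
Lemma kernel_section_L2 : exists2 B : R, 0 < B &
  {ae leb2, forall x, L2 leb2 (fun y => conjc (K (x, y))) /\
    (nsq leb2 (fun y => conjc (K (x, y))) <= B%:E)%E}.
Proof.
have [M M0 hM] := @exp_weight_bound R (2 * g) (mulr_gt0 (ltr0n R 2) g0).
exists (C ^+ 2 * M * kappa); first by rewrite !mulr_gt0 ?exprn_gt0// kappa_gt0.
have := ae_section Kdec; apply: filterS => x hx.
have mk := cmeasurable_conj (cmeasurable_section x).
suff h : (nsq leb2 (fun y => conjc (K (x, y))) <= (C ^+ 2 * M * kappa)%:E)%E.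
  by split => //; apply/L2P; split => //; exact: le_lt_trans h (ltry _).
have mw : measurable_fun setT (fun y : plane => ((weight ((y : R * R) - x))^-1)%:E).
  by apply/measurable_EFinP/measurable_weight_inv; exact: pmeasurable_sub.
have CM : 0 <= C ^+ 2 * M by rewrite mulr_ge0 ?exprn_ge0// ltW.
apply: (@le_trans _ _ (\int[leb2]_y ((C ^+ 2 * M)%:E * ((weight (y - x))^-1)%:E))%E).
  apply: ae_ge0_le_integral => //.
  - by move=> y _; rewrite lee_fin sqr_ge0.
  - exact: measurable_normc_sqr.
  - by move=> y _; rewrite -EFinM lee_fin mulr_ge0// invr_ge0 weight_ge0.
  - exact: measurable_funeM.
  - move: hx; apply: filterS => y hy _; rewrite -EFinM lee_fin normc_conj -mulrA.
    apply: (@le_trans _ _ (edec x y ^+ 2)).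
      by rewrite lerXn2r ?nnegrE ?normc_ge0// mulr_ge0 ?expR_ge0// ltW.
    rewrite exprMn ler_pM2l ?exprn_gt0//= -expRM_natr.
    rewrite weight_dist ler_pdivlMr ?weight_gt0//.
    apply: le_trans (hM (x - y)).
    rewrite (_ : - g * enorm (x - y) * 2%:R = - (2 * g) * enorm (x - y)); last by ring.
    rewrite ler_wpM2l ?expR_ge0// expr2.
    by rewrite ler_peMr ?weight_ge0 ?weight_ge1.
rewrite ge0_integralZl_EFin//; last by move=> y _; rewrite lee_fin invr_ge0 weight_ge0.
rewrite [leRHS]EFinM; apply: lee_pmul => //.
  by apply: integral_ge0 => y _; rewrite lee_fin invr_ge0 weight_ge0.
exact: integral_weight_inv.
Qed.

(* [psi a x] is the inner product of [psi a] with the conjugate of [K (x, _)], so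
   the bound is Bessel's inequality. *)
Lemma local_density (I : eqType) (psi : I -> R * R -> R[i]) :
  orthonormal_family leb2 psi ->
  (forall a, ae_eq leb2 setT (P (psi a)) (psi a)) ->
  exists2 B : R, 0 < B & forall U : seq I, uniq U ->
    {ae leb2, forall x, \sum_(a <- U) normc (psi a x) ^+ 2 <= B}.
Proof.
move=> opsi Ppsi; have [Lpsi _] := opsi.
have [B B0 hB] := kernel_section_L2; exists B => // U uU.
have [_ hK] := KP.
have h1 : {ae leb2, forall x, forall a, a \in U ->
    psi a x = cintegral leb2 (fun y => K (x, y) * psi a y)}.
  apply: ae_all_seq => a; have := hK _ (Lpsi a); have := Ppsi a.
  by apply: filterS2 => x /(_ Logic.I) -> [_ ->].
move: hB h1; apply: ae_imp2 => x [Lk kB] hx.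
rewrite (L2_nsq Lk) lee_fin in kB; apply: le_trans kB.
apply: le_trans (bessel opsi uU Lk).
rewrite le_eqVlt; apply/orP; left; apply/eqP; apply: eq_big_seq => a aU.
rewrite hx// -normc_conj (inner_conj (Lpsi a) Lk) normc_conj normc_conj.
by congr (normc (cintegral _ _) ^+ 2); apply/funext => y; rewrite conjcK mulrC.
Qed.

End ExpKernel.

Lemma mul_ge0_integral d (T : measurableType d) (R : realType)
    (mu : {measure set T -> \bar R}) (k : R) (f : T -> R) :
  measurable_fun setT f -> (forall x, 0 <= f x) -> 0 <= k ->
  (k%:E * \int[mu]_x (f x)%:E = \int[mu]_x (k * f x)%:E)%E.
Proof.
move=> mf f0 k0; rewrite -ge0_integralZl_EFin//.
- by move=> x _; rewrite lee_fin.
- exact/measurable_EFinP.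
Qed.

Lemma weight_ratio (R : realType) (c C u v w n : R) :
  0 < u -> 0 < v -> 0 < w -> 0 <= C -> 0 <= n -> v <= c * (u * w) ->
  w^-1 * C * (u^-1 * n) <= c * C * (v^-1 * n).
Proof.
move=> u0 v0 w0 C0 n0 h; rewrite [leLHS]mulrA [leRHS]mulrA ler_wpM2r//.
rewrite (_ : w^-1 * C * u^-1 = C * (u * w)^-1); last by field; rewrite !gt_eqF.
rewrite (mulrC c) -mulrA ler_wpM2l//.
by rewrite ler_pdivlMr// mulrC ler_pdivrMr// mulr_gt0.
Qed.

Opaque weight kappa cpeetre.

(** * Weighted moments and the density of the centers *)

Section WeightedBounds.
Context {R : realType}.
Local Notation plane := (measurableTypeR R * measurableTypeR R)%type.
Local Notation leb2 := (@lebesgue2 R).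

Definition wmom (m : R * R) (f : R * R -> R[i]) : \bar R :=
  (\int[leb2]_x ((weight (x - m) * normc (f x)) ^+ 2)%:E)%E.

Lemma measurable_wnormc (m : R * R) (f : plane -> R[i]) : cmeasurable_fun f ->
  measurable_fun setT (fun x : plane => weight ((x : R * R) - m) * normc (f x)).
Proof.
move=> mf; apply: measurable_funM; last exact: measurable_normc.
by apply: measurable_weight; exact: pmeasurable_sub.
Qed.

(* By AM-GM [2 <= weight / C + C / weight], so the moment bound forces
   [\int |psi b|^2 / weight (x - m b) >= 1 / C]; Peetre's inequality then compares
   [1 / weight (a - m b)] with [\int |psi b|^2 / weight (x - a)]. *)
Lemma sum_weight_inv_le (I : eqType) (psi : I -> R * R -> R[i]) (m : I -> R * R)
    (U : seq I) (B C : R) (a : R * R) : 0 < B -> 0 < C ->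
  (forall b, L2 leb2 (psi b)) -> (forall b, nsq leb2 (psi b) = 1%:E) ->
  (forall b, (wmom (m b) (psi b) <= C%:E)%E) ->
  {ae leb2, forall x, \sum_(b <- U) normc (psi b x) ^+ 2 <= B} ->
  \sum_(b <- U) (weight (a - m b))^-1 <= cpeetre * C * B * kappa.
Proof.
move=> B0 C0 Lpsi n1 hC hB.
pose G b (x : plane) := (weight ((x : R * R) - a))^-1 * normc (psi b x) ^+ 2.
have mpsi b := measurable_normc (L2_measurable (Lpsi b)).
have mG b : measurable_fun setT (G b).
  apply: measurable_funM; last exact: measurable_funX.
  by apply: measurable_weight_inv; exact: pmeasurable_sub.
have G0 b x : 0 <= G b x by rewrite mulr_ge0 ?invr_ge0 ?weight_ge0 ?sqr_ge0.
have key b : ((weight (a - m b))^-1%:E <=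
    (cpeetre * C)%:E * \int[leb2]_x (G b x)%:E)%E.
  pose H (x : plane) := (weight ((x : R * R) - m b))^-1 * normc (psi b x) ^+ 2.
  have mH : measurable_fun setT H.
    apply: measurable_funM; last exact: measurable_funX.
    by apply: measurable_weight_inv; exact: pmeasurable_sub.
  have H0 x : 0 <= H x by rewrite mulr_ge0 ?invr_ge0 ?weight_ge0 ?sqr_ge0.
  have mW := measurable_wnormc (m b) (L2_measurable (Lpsi b)).
  have h1 : (2%:E <= C^-1%:E * wmom (m b) (psi b) + C%:E * \int[leb2]_x (H x)%:E)%E.
    rewrite /wmom -!ge0_integralZl_EFin//; last 6 first.
    - by move=> x _; rewrite lee_fin.
    - exact/measurable_EFinP.
    - exact: ltW.
    - by move=> x _; rewrite lee_fin sqr_ge0.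
    - by apply/measurable_EFinP/measurable_funX.
    - by rewrite invr_ge0 ltW.
    rewrite -ge0_integralD//; last 4 first.
    - by move=> x _; rewrite -EFinM lee_fin mulr_ge0 ?sqr_ge0// invr_ge0 ltW.
    - by apply/measurable_funeM/measurable_EFinP/measurable_funX.
    - by move=> x _; rewrite -EFinM lee_fin mulr_ge0// ltW.
    - exact/measurable_funeM/measurable_EFinP.
    have -> : 2%:E = (2%:E * nsq leb2 (psi b))%E by rewrite n1 mule1.
    rewrite /nsq -ge0_integralZl_EFin//; last 2 first.
    - by move=> x _; rewrite lee_fin sqr_ge0.
    - exact: measurable_normc_sqr (L2_measurable (Lpsi b)).
    apply: ge0_le_integral => //.
    - by move=> x _; rewrite -EFinM lee_fin mulr_ge0// sqr_ge0.
    - by apply/measurable_funeM/measurable_normc_sqr; exact: L2_measurable.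
    - apply: emeasurable_funD; apply/measurable_funeM/measurable_EFinP => //.
      exact: measurable_funX.
    - move=> x _; rewrite -!EFinM -EFinD lee_fin /H.
      have w0 := weight_gt0 (x - m b); have w1 := weight_ge1 (x - m b).
      set w := weight _ in w0 w1 *; set n := normc _.
      (* The moment carries [w ^+ 2], so AM-GM for [w / C + C / w] is combined with [w <= w ^+ 2];
         the difference of the two sides is a sum of two non-negative terms. *)
      have e : C^-1 * (w * n) ^+ 2 + C * (w^-1 * n ^+ 2) - 2 * n ^+ 2 =
          C^-1 * n ^+ 2 * (w ^+ 2 - w) + n ^+ 2 * (w^-1 * C^-1) * (w - C) ^+ 2.
        by field; rewrite !gt_eqF.
      have ww : 0 <= w ^+ 2 - w.
        by rewrite subr_ge0 expr2 ler_peMr// ltW.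
      have n0 : 0 <= n ^+ 2 by exact: sqr_ge0.
      have Ci : 0 <= C^-1 by rewrite invr_ge0 ltW.
      have wi : 0 <= w^-1 by rewrite invr_ge0 ltW.
      rewrite -subr_ge0 e addr_ge0//.
        by apply: mulr_ge0 => //; exact: mulr_ge0.
      by apply: mulr_ge0; [apply: mulr_ge0 => //; exact: mulr_ge0|exact: sqr_ge0].
  have h2 : (1 <= C%:E * \int[leb2]_x (H x)%:E)%E.
    have : (C^-1%:E * wmom (m b) (psi b) <= 1)%E.
      rewrite -[leRHS](_ : (C^-1%:E * C%:E)%E = 1%E); last first.
        by rewrite -EFinM mulVf ?gt_eqF.
      by apply: lee_pmul => //; rewrite ?lee_fin ?invr_ge0 ?(ltW C0)//;
        apply: integral_ge0 => x _; rewrite lee_fin sqr_ge0.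
    move=> h3; have := le_trans h1 (leeD2r _ h3).
    have -> : 2%:E = (1 + 1)%E :> \bar R by rewrite -EFinD.
    by rewrite leeD2lE.
  have w0 := weight_gt0 (a - m b).
  apply: (@le_trans _ _ ((weight (a - m b))^-1%:E * (C%:E * \int[leb2]_x (H x)%:E))%E).
    by rewrite -[leLHS]mule1 lee_wpmul2l// lee_fin invr_ge0 ltW.
  have wi : 0 <= (weight (a - m b))^-1 by rewrite invr_ge0 ltW.
  have cC : 0 <= cpeetre * C by rewrite mulr_ge0 ?(ltW C0)// ltW// cpeetre_gt0.
  have wC : 0 <= (weight (a - m b))^-1 * C by rewrite mulr_ge0 ?(ltW C0).
  rewrite muleA.
  rewrite -(EFinM (weight (a - m b))^-1 C).
  rewrite (mul_ge0_integral leb2 mH H0 wC).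
  rewrite (mul_ge0_integral leb2 (mG b) (G0 b) cC).
  apply: ge0_le_integral; first exact: measurableT.
  - by move=> x _; rewrite lee_fin mulr_ge0.
  - by apply/measurable_EFinP; apply: measurable_funM mH; exact: measurable_cst.
  - by apply/measurable_EFinP; apply: measurable_funM (mG b); exact: measurable_cst.
  - move=> x _; rewrite lee_fin; apply: weight_ratio.
    + exact: weight_gt0.
    + exact: weight_gt0.
    + exact: weight_gt0.
    + exact: ltW.
    + exact: sqr_ge0.
    + by rewrite (weight_dist a); exact: weight_peetre.
have S0 : (\sum_(b <- U) (weight (a - m b))^-1%:E <=
    (cpeetre * C)%:E * \int[leb2]_x (\sum_(b <- U) (G b x)%:E))%E.
  rewrite ge0_integral_sum//; last 2 first.
  - by move=> b; exact/measurable_EFinP.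
  - by move=> b x _; rewrite lee_fin.
  rewrite ge0_sume_distrr; last by move=> b _; apply: integral_ge0 => x _; rewrite lee_fin.
  exact: lee_sum.
rewrite -lee_fin -sumEFin; apply: le_trans S0 _.
rewrite -(mulrA (cpeetre * C)) (EFinM (cpeetre * C)); apply: lee_pmul.
- by rewrite lee_fin mulr_ge0 ?(ltW C0)// ltW// cpeetre_gt0.
- by apply: integral_ge0 => x _; apply: sume_ge0 => b _; rewrite lee_fin.
- exact: lexx.
(* The sum over [b] is replaced by the local density [B] under the integral, which makes the bound
   independent of [U]. *)
apply: (@le_trans _ _ (\int[leb2]_x (B%:E * ((weight (x - a))^-1)%:E))%E); last first.
  rewrite ge0_integralZl_EFin//; last 3 first.
  - by move=> x _; rewrite lee_fin invr_ge0 weight_ge0.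
  - by apply/measurable_EFinP/measurable_weight_inv; exact: pmeasurable_sub.
  - exact: ltW.
  rewrite EFinM; apply: lee_pmul => //; first by rewrite lee_fin ltW.
    by apply: integral_ge0 => x _; rewrite lee_fin invr_ge0 weight_ge0.
  exact: integral_weight_inv.
apply: ae_ge0_le_integral => //.
- by move=> x _; apply: sume_ge0 => b _; rewrite lee_fin.
- by apply: emeasurable_sum => b; exact/measurable_EFinP.
- by move=> x _; rewrite -EFinM lee_fin mulr_ge0 ?(ltW B0) ?invr_ge0 ?weight_ge0.
- apply/measurable_funeM/measurable_EFinP/measurable_weight_inv.
  exact: pmeasurable_sub.
- move: hB; apply: ae_imp => x hx _; rewrite sumEFin -EFinM lee_fin /G -mulr_sumr.
  by rewrite mulrC ler_wpM2r// invr_ge0 weight_ge0.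
Qed.

End WeightedBounds.

(** * Weighted bilinear estimate for the kernel *)

Section ConvolutionBounds.
Context {R : realType}.
Local Notation plane := (measurableTypeR R * measurableTypeR R)%type.
Local Notation leb2 := (@lebesgue2 R).

Lemma measurable_weight_inv_diff : measurable_fun setT
  (fun z : plane * plane => (weight ((z.1 : R * R) - z.2))^-1).
Proof. by apply: measurable_weight_inv; exact: pmeasurable_diff. Qed.

Lemma measurable_weight_mul1 (k : plane -> R) : measurable_fun setT k ->
  measurable_fun setT (fun z : plane * plane => ((weight ((z.1 : R * R) - z.2))^-1 * k z.1)%:E).
Proof.
move=> mk; apply/measurable_EFinP; apply: measurable_funM.
  exact: measurable_weight_inv_diff.
exact: (measurableT_comp mk measurable_fst).
Qed.

Lemma measurable_weight_mul2 (k : plane -> R) : measurable_fun setT k ->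
  measurable_fun setT (fun z : plane * plane => ((weight ((z.1 : R * R) - z.2))^-1 * k z.2)%:E).
Proof.
move=> mk; apply/measurable_EFinP; apply: measurable_funM.
  exact: measurable_weight_inv_diff.
exact: (measurableT_comp mk measurable_snd).
Qed.

Lemma weight_inv_ge0 (x : R * R) : 0 <= (weight x)^-1.
Proof. by rewrite invr_ge0 weight_ge0. Qed.

(** This and [integral_conv2] bound convolution with the inverse weight on integrable functions.
    Both variants occur because AM-GM leaves one term that depends on the outer variable and one on
    the inner variable. *)
Lemma integral_conv1 (k : plane -> R) : measurable_fun setT k -> (forall x, 0 <= k x) ->
  (\int[leb2]_x \int[leb2]_y ((weight (x - y))^-1 * k x)%:E
    <= kappa%:E * \int[leb2]_x (k x)%:E)%E.
Proof.
move=> mk k0; rewrite mul_ge0_integral//; last exact/ltW/kappa_gt0.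
have mf := measurable_weight_mul1 mk.
apply: ge0_le_integral; first exact: measurableT.
- move=> x _; apply: integral_ge0 => y _.
  by rewrite lee_fin mulr_ge0// weight_inv_ge0.
- apply: (@measurable_fun_fubini_tonelli_F _ _ _ _ _ leb2 _ mf).
  by move=> z; rewrite lee_fin mulr_ge0// weight_inv_ge0.
- by apply/measurable_EFinP; apply: measurable_funM mk; exact: measurable_cst.
- move=> x _; under eq_integral do rewrite mulrC weight_dist.
  rewrite -mul_ge0_integral//; last first.
  + by move=> y; exact: weight_inv_ge0.
  + by apply: measurable_weight_inv; exact: pmeasurable_sub.
  rewrite mulrC EFinM; apply: lee_pmul; rewrite ?lee_fin//.
    by apply: integral_ge0 => y _; rewrite lee_fin weight_inv_ge0.
  exact: integral_weight_inv.
Qed.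

Lemma integral_conv2 (k : plane -> R) : measurable_fun setT k -> (forall x, 0 <= k x) ->
  (\int[leb2]_x \int[leb2]_y ((weight (x - y))^-1 * k y)%:E
    <= kappa%:E * \int[leb2]_x (k x)%:E)%E.
Proof.
move=> mk k0; have mf := measurable_weight_mul2 mk.
have f0 (z : plane * plane) :
    (0 <= ((weight ((z.1 : R * R) - z.2))^-1 * k z.2)%:E)%E.
  by rewrite lee_fin mulr_ge0// weight_inv_ge0.
rewrite (@fubini_tonelli _ _ _ _ _ leb2 leb2 _ mf f0) /=.
apply: le_trans (integral_conv1 mk k0).
rewrite le_eqVlt; apply/orP; left; apply/eqP.
by apply: eq_integral => y _; apply: eq_integral => x _; rewrite weight_dist.
Qed.

End ConvolutionBounds.

(* Here [wab] is [weight (a - b)], [wya] is [weight (y - a)], ..., [F] is [|f y|],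
   [H] is [|h x|] and [e] is the exponential in the kernel bound at [(x, y)]:
   one passes from [a] to [b] through [y] and [x]. *)
Lemma kernel_pointwise_le (R : realType) (C M e c wab wya wxy wxb wyb F H lam : R) :
  0 < C -> 0 < M -> 0 < lam -> 0 < c -> 0 <= e -> 0 < wab -> 0 < wya -> 0 < wxy ->
  0 < wxb -> 0 <= F -> 0 <= H ->
  e * wxy ^+ 2 <= M -> wab <= c * (wya * wyb) -> wyb <= c * (wxy * wxb) ->
  C * e * F * H <= C * M * c ^+ 2 * wab^-1 *
    (wxy^-1 * (lam * (wya * F) ^+ 2) + wxy^-1 * (lam^-1 * (wxb * H) ^+ 2)).
Proof.
move=> C0 M0 l0 c0 e0 ab0 ya0 xy0 xb0 F0 H0 eM h1 h2.
have hab : wab <= c ^+ 2 * (wya * wxy * wxb).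
  apply: (le_trans h1); rewrite expr2 -mulrA ler_wpM2l ?(ltW c0)//.
  rewrite (_ : c * (wya * wxy * wxb) = wya * (c * (wxy * wxb))); last by ring.
  by rewrite ler_wpM2l// ltW.
set u := wya * F; set v := wxb * H.
have u0 : 0 <= u by rewrite mulr_ge0 ?(ltW ya0).
have v0 : 0 <= v by rewrite mulr_ge0 ?(ltW xb0).
(* A weighted AM-GM takes the place of Cauchy-Schwarz; [lam] remains free, so that moments of
   different sizes can be balanced. *)
have amgm : u * v <= lam * u ^+ 2 + lam^-1 * v ^+ 2.
  have := sqr_ge0 (lam * u - v).
  have li : 0 < lam^-1 by rewrite invr_gt0.
  have -> : lam^-1 * v ^+ 2 = lam * (lam^-1 * v) ^+ 2 by field; rewrite gt_eqF.
  set w := lam^-1 * v => _.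
  have -> : v = lam * w by rewrite /w; field; rewrite gt_eqF.
  have : 0 <= lam * ((u - w) ^+ 2 + u ^+ 2 + w ^+ 2).
    by rewrite mulr_ge0 ?(ltW l0)// !addr_ge0 ?sqr_ge0.
  by lra.
have eb : e <= M * wxy^-1 ^+ 2 by rewrite exprVn ler_pdivlMr ?exprn_gt0.
have one : 1 <= c ^+ 2 * wab^-1 * (wya * wxy * wxb).
  by rewrite mulrAC ler_pdivlMr// mul1r.
rewrite -mulrDr.
have FH : 0 <= F * H by exact: mulr_ge0.
(* The exponential is traded for two inverse powers of [wxy]: one cancels the [wxy] produced by
   Peetre's inequality, the other is left to make the integral converge. *)
apply: (@le_trans _ _ (C * M * wxy^-1 ^+ 2 * (F * H))).
  rewrite -[leLHS]mulrA ler_wpM2r// -[leRHS]mulrA ler_wpM2l// ltW//.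
apply: (@le_trans _ _ (C * M * wxy^-1 ^+ 2 * (F * H) *
    (c ^+ 2 * wab^-1 * (wya * wxy * wxb)))).
  rewrite ler_peMr// !mulr_ge0 ?exprn_ge0 ?invr_ge0 ?(ltW C0) ?(ltW M0) ?(ltW xy0)//.
have -> : C * M * wxy^-1 ^+ 2 * (F * H) * (c ^+ 2 * wab^-1 * (wya * wxy * wxb)) =
    C * M * c ^+ 2 * wab^-1 * (wxy^-1 * (u * v)).
  by rewrite /u /v; field; rewrite !gt_eqF.
apply: ler_wpM2l.
  by rewrite !mulr_ge0 ?exprn_ge0 ?invr_ge0 ?(ltW C0) ?(ltW M0) ?(ltW c0) ?(ltW ab0).
by rewrite ler_wpM2l// invr_ge0 ltW.
Qed.

Section KernelInner.
Context {R : realType}.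
Local Notation plane := (measurableTypeR R * measurableTypeR R)%type.
Local Notation leb2 := (@lebesgue2 R).
Variables (P : (R * R -> R[i]) -> (R * R -> R[i])) (K : (R * R) * (R * R) -> R[i]).
Variables (C g : R).
Hypothesis C0 : 0 < C.
Hypothesis g0 : 0 < g.
Hypothesis KP : integral_kernel leb2 P K.
Hypothesis Kdec : {ae (leb2 \x leb2)%E, forall z,
  normc (K z) <= C * expR (- g * enorm (z.1 - z.2))}.
Hypothesis L2P : forall f, L2 leb2 f -> L2 leb2 (P f).

Local Notation edec x y := (C * expR (- g * enorm (x - y))).

Lemma edec_ge0 (x y : R * R) : 0 <= edec x y.
Proof. by rewrite mulr_ge0 ?expR_ge0// ltW. Qed.

Lemma measurable_edec_sec (x : plane) :
  measurable_fun setT (fun y : plane => edec (x : R * R) (y : R * R)).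
Proof. exact: (measurableT_comp (measurable_edec C g) (pair1_measurable x)). Qed.

(** The pointwise estimate integrated over the plane. Optimizing [lam] would give the geometric mean
    of [U] and [V], so a small moment on one side alone already makes the pairing small. *)
Lemma kernel_inner_le : exists2 D : R, 0 < D &
  forall (a b : R * R) f h (U V lam : R), L2 leb2 f -> L2 leb2 h -> 0 < lam ->
    (wmom a f <= U%:E)%E -> (wmom b h <= V%:E)%E ->
    normc (inner leb2 (P f) h) <= D * (weight (a - b))^-1 * (lam * U + lam^-1 * V).
Proof.
have [M M0 hM] := exp_weight_bound g0.
have c0 : 0 < @cpeetre R := cpeetre_gt0.
(* The 4 is the product of the factor 2 in the pointwise bound on [P f] and the factor 2 in the
   bound on a complex integral. *)
exists (4 * C * M * cpeetre ^+ 2 * kappa).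
  by rewrite !mulr_gt0 ?exprn_gt0// kappa_gt0.
move=> a b f h U V lam Lf Lh l0 fU hV.
have mf := L2_measurable Lf; have mh := L2_measurable Lh.
pose u (y : plane) := (weight ((y : R * R) - a) * normc (f y)) ^+ 2.
pose v (x : plane) := (weight ((x : R * R) - b) * normc (h x)) ^+ 2.
have mu : measurable_fun setT u by apply: measurable_funX; exact: measurable_wnormc.
have mv : measurable_fun setT v by apply: measurable_funX; exact: measurable_wnormc.
have u0 x : 0 <= u x by exact: sqr_ge0.
have v0 x : 0 <= v x by exact: sqr_ge0.
pose E0 := C * M * cpeetre ^+ 2 * (weight (a - b))^-1.
have E00 : 0 <= E0.
  by rewrite /E0 !mulr_ge0 ?exprn_ge0 ?weight_inv_ge0 ?ltW.
have l1 : 0 <= lam by exact: ltW.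
have l2 : 0 <= lam^-1 by rewrite invr_ge0.
pose q1 (x y : plane) := (weight ((x : R * R) - y))^-1 * (lam * u y).
pose q2 (x y : plane) := (weight ((x : R * R) - y))^-1 * (lam^-1 * v x).
have q10 x y : 0 <= q1 x y by rewrite /q1 mulr_ge0 ?weight_inv_ge0// mulr_ge0.
have q20 x y : 0 <= q2 x y by rewrite /q2 mulr_ge0 ?weight_inv_ge0// mulr_ge0.
have mlu : measurable_fun setT (fun y => lam * u y) by exact: measurable_funM.
have mlv : measurable_fun setT (fun y => lam^-1 * v y) by exact: measurable_funM.
have lu0 y : 0 <= lam * u y by exact: mulr_ge0.
have lv0 y : 0 <= lam^-1 * v y by exact: mulr_ge0.
have mq1 := measurable_weight_mul2 mlu.
have mq2 := measurable_weight_mul1 mlv.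
have mq1x (x : plane) : measurable_fun setT (fun y => (q1 x y)%:E).
  exact: (measurableT_comp mq1 (pair1_measurable x)).
have mq2x (x : plane) : measurable_fun setT (fun y => (q2 x y)%:E).
  exact: (measurableT_comp mq2 (pair1_measurable x)).
pose Q (x : plane) := (\int[leb2]_y (q1 x y)%:E + \int[leb2]_y (q2 x y)%:E)%E.
have mF1 : measurable_fun setT (fun x : plane => \int[leb2]_y (q1 x y)%:E)%E.
  by apply: (@measurable_fun_fubini_tonelli_F _ _ _ _ _ leb2 _ mq1) => z; rewrite lee_fin; exact: q10.
have mF2 : measurable_fun setT (fun x : plane => \int[leb2]_y (q2 x y)%:E)%E.
  by apply: (@measurable_fun_fubini_tonelli_F _ _ _ _ _ leb2 _ mq2) => z; rewrite lee_fin; exact: q20.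
have F10 (x : plane) : (0 <= \int[leb2]_y (q1 x y)%:E)%E.
  by apply: integral_ge0 => y _; rewrite lee_fin.
have F20 (x : plane) : (0 <= \int[leb2]_y (q2 x y)%:E)%E.
  by apply: integral_ge0 => y _; rewrite lee_fin.
have Q0 x : (0 <= Q x)%E by exact: adde_ge0.
have mQ : measurable_fun setT Q by exact: emeasurable_funD.
have pt (x y : plane) : edec (x : R * R) (y : R * R) * normc (f y) * normc (h x) <=
    E0 * (q1 x y + q2 x y).
  apply: (@kernel_pointwise_le _ C M _ cpeetre _ _ _ _ (weight ((y : R * R) - b))) => //.
  - exact: weight_gt0.
  - exact: weight_gt0.
  - exact: weight_gt0.
  - exact: weight_gt0.
  - exact: normc_ge0.
  - exact: normc_ge0.
  - by rewrite (weight_dist y a); exact: weight_peetre.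
  - by rewrite (weight_dist x y); exact: weight_peetre.
have QI : (\int[leb2]_x Q x <= (kappa * (lam * U + lam^-1 * V))%:E)%E.
  rewrite ge0_integralD//.
  rewrite mulrDr EFinD; apply: leeD.
    apply: (le_trans (integral_conv2 mlu lu0)); rewrite (EFinM kappa).
    apply: lee_pmul; rewrite ?lee_fin ?(ltW kappa_gt0)//.
      by apply: integral_ge0 => y _; rewrite lee_fin.
    by rewrite -mul_ge0_integral// EFinM lee_wpmul2l// lee_fin.
  apply: (le_trans (integral_conv1 mlv lv0)); rewrite (EFinM kappa).
  apply: lee_pmul; rewrite ?lee_fin ?(ltW kappa_gt0)//.
    by apply: integral_ge0 => y _; rewrite lee_fin.
  by rewrite -mul_ge0_integral// EFinM lee_wpmul2l// lee_fin.
have -> : 4 * C * M * cpeetre ^+ 2 * kappa * (weight (a - b))^-1 *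
    (lam * U + lam^-1 * V) = 2 * (2 * E0 * (kappa * (lam * U + lam^-1 * V))).
  by rewrite /E0; ring.
have Lpf := L2P Lf; have mpf := L2_measurable Lpf.
apply: normc_cintegral_le.
  by apply: cmeasurableM => //; exact: cmeasurable_conj.
apply: (@le_trans _ _ (\int[leb2]_x ((2 * E0)%:E * Q x))%E); last first.
  rewrite ge0_integralZl_EFin//; last by rewrite mulr_ge0.
  rewrite (EFinM (2 * E0)); apply: lee_pmul => //; first by rewrite lee_fin mulr_ge0.
  by apply: integral_ge0.
apply: ae_ge0_le_integral; first exact: measurableT.
- by move=> x _; rewrite lee_fin normc_ge0.
- apply/measurable_EFinP; apply: measurable_normc.
  by apply: cmeasurableM => //; exact: cmeasurable_conj.
- by move=> x _; rewrite mule_ge0// lee_fin mulr_ge0.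
- exact: measurable_funeM.
- have := ae_kernel_bound C0 KP Kdec Lf; apply: ae_imp => x hx _.
  have mfx : measurable_fun setT (fun y : plane => edec (x : R * R) (y : R * R) * normc (f y)).
    by apply: measurable_funM; [exact: measurable_edec_sec|exact: measurable_normc].
  have fx0 (y : plane) : 0 <= edec (x : R * R) (y : R * R) * normc (f y).
    by rewrite mulr_ge0 ?edec_ge0 ?normc_ge0.
  rewrite Normc.normcM normc_conj mulrC EFinM.
  apply: (@le_trans _ _ ((normc (h x))%:E * (2%:E * \int[leb2]_y (edec x y * normc (f y))%:E))%E).
    by apply: lee_wpmul2l; [rewrite lee_fin normc_ge0|exact: hx].
  rewrite muleCA (mul_ge0_integral leb2 mfx fx0 (normc_ge0 (h x))).
  rewrite (EFinM 2) -muleA lee_wpmul2l//.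
  rewrite /Q -ge0_integralD//; last 2 first.
  + by move=> y _; rewrite lee_fin.
  + by move=> y _; rewrite lee_fin.
  have -> : (\int[leb2]_y ((q1 x y)%:E + (q2 x y)%:E) = \int[leb2]_y (q1 x y + q2 x y)%:E)%E.
    by apply: eq_integral.
  have mq12 : measurable_fun setT (fun y : plane => q1 x y + q2 x y).
    by apply: measurable_funD; apply/measurable_EFinP; [exact: mq1x|exact: mq2x].
  rewrite mul_ge0_integral//; last by move=> y; exact: addr_ge0.
  apply: ge0_le_integral; first exact: measurableT.
  + by move=> y _; rewrite lee_fin mulr_ge0// normc_ge0.
  + by apply/measurable_EFinP; apply: measurable_funM mfx; exact: measurable_cst.
  + by apply/measurable_EFinP; apply: measurable_funM mq12; exact: measurable_cst.
  + by move=> y _; rewrite lee_fin mulrC; exact: pt.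
Qed.

End KernelInner.

(** * Pointwise exponential bounds *)

Section ExponentialBounds.
Context {R : realType}.
Local Notation plane := (measurableTypeR R * measurableTypeR R)%type.
Local Notation leb2 := (@lebesgue2 R).

Lemma measurable_exp_dist (eta : R) (m : R * R) : measurable_fun setT
  (fun x : plane => expR (- eta * enorm ((x : R * R) - m))).
Proof. by apply: measurable_exp_enorm; exact: pmeasurable_sub. Qed.

Lemma integral_exp_le (eta : R) : 0 < eta -> exists2 B : R, 0 < B &
  forall m : R * R, (\int[leb2]_x (expR (- eta * enorm (x - m)))%:E <= B%:E)%E.
Proof.
move=> eta0; have [M M0 hM] := exp_weight_bound eta0.
exists (M * kappa); first by rewrite mulr_gt0// kappa_gt0.
move=> m; have mw : measurable_fun setT (fun x : plane => (weight ((x : R * R) - m))^-1).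
  by apply: measurable_weight_inv; exact: pmeasurable_sub.
apply: (@le_trans _ _ (\int[leb2]_x (M * (weight (x - m))^-1)%:E)%E).
  apply: ge0_le_integral; first exact: measurableT.
  - by move=> x _; rewrite lee_fin expR_ge0.
  - by apply/measurable_EFinP; exact: measurable_exp_dist.
  - by apply/measurable_EFinP; apply: measurable_funM mw; exact: measurable_cst.
  - move=> x _; rewrite lee_fin ler_pdivlMr ?weight_gt0//.
    apply: le_trans (hM (x - m)); rewrite ler_wpM2l ?expR_ge0// expr2.
    by rewrite ler_peMr ?weight_ge0 ?weight_ge1.
rewrite -mul_ge0_integral ?(ltW M0)//; last by move=> x; exact: weight_inv_ge0.
rewrite (EFinM M); apply: lee_pmul; rewrite ?lee_fin ?(ltW M0)//.
  by apply: integral_ge0 => x _; rewrite lee_fin weight_inv_ge0.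
exact: integral_weight_inv.
Qed.

(** The bound holds at every point, not almost everywhere, so that finite combinations and pointwise
    limits inherit it without null sets. *)
Definition exp_bounded (A eta : R) (m : R * R) (f : R * R -> R[i]) :=
  forall x, normc (f x) <= A * expR (- eta * enorm (x - m)).

Lemma exp_bounded_ge0 A eta m f : exp_bounded A eta m f -> 0 <= A.
Proof.
move=> /(_ m); rewrite subrr => h.
rewrite -(pmulr_lge0 _ (expR_gt0 (- eta * enorm (0 : R * R)))).
exact: le_trans (normc_ge0 _) h.
Qed.

Lemma exp_bounded_nsq (eta : R) : 0 < eta -> exists2 B : R, 0 < B &
  forall (A : R) (m : R * R) (f : plane -> R[i]), cmeasurable_fun f -> exp_bounded A eta m f ->
    L2 leb2 f /\ (nsq leb2 f <= (A ^+ 2 * B)%:E)%E.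
Proof.
move=> eta0; have [B B0 hB] := @integral_exp_le (2 * eta) (mulr_gt0 (ltr0n R 2) eta0).
exists B => // A m f mf fA; have A0 := exp_bounded_ge0 fA.
suff h : (nsq leb2 f <= (A ^+ 2 * B)%:E)%E.
  by split => //; apply/L2P; split => //; exact: le_lt_trans h (ltry _).
have me := measurable_exp_dist (2 * eta) m.
apply: (@le_trans _ _ (\int[leb2]_x (A ^+ 2 * expR (- (2 * eta) * enorm (x - m)))%:E)%E).
  apply: ge0_le_integral; first exact: measurableT.
  - by move=> x _; rewrite lee_fin sqr_ge0.
  - exact: measurable_normc_sqr.
  - by apply/measurable_EFinP; apply: measurable_funM me; exact: measurable_cst.
  - move=> x _; rewrite lee_fin.
    rewrite (_ : - (2 * eta) * enorm (x - m) = - eta * enorm (x - m) * 2%:R); last by ring.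
    rewrite expRM_natr -exprMn lerXn2r ?nnegrE ?normc_ge0//.
    by rewrite mulr_ge0 ?expR_ge0.
rewrite -mul_ge0_integral ?exprn_ge0//.
rewrite (EFinM (A ^+ 2)); apply: lee_pmul; rewrite ?lee_fin ?exprn_ge0//.
by apply: integral_ge0 => x _; rewrite lee_fin expR_ge0.
Qed.

(** Half of the rate pays, through the triangle inequality, for the separation of [a] and [b]; the
    remaining half of the decay around [a] is integrated. *)
Lemma exp_bounded_inner (eta : R) : 0 < eta -> exists2 B : R, 0 < B &
  forall (A A' : R) (a b : R * R) (f h : plane -> R[i]), cmeasurable_fun f -> cmeasurable_fun h ->
    exp_bounded A eta a f -> exp_bounded A' eta b h ->
    normc (inner leb2 f h) <= A * A' * B * expR (- (eta / 2) * enorm (a - b)).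
Proof.
move=> eta0; have eta2 : 0 < eta / 2 by rewrite divr_gt0.
have [B B0 hB] := integral_exp_le eta2.
exists (2 * B); first by rewrite mulr_gt0.
move=> A A' a b f h mf mh fA hA'.
have A0 := exp_bounded_ge0 fA; have A'0 := exp_bounded_ge0 hA'.
pose k := A * A' * expR (- (eta / 2) * enorm (a - b)).
have k0 : 0 <= k by rewrite /k mulr_ge0 ?expR_ge0// mulr_ge0.
rewrite (_ : A * A' * (2 * B) * _ = 2 * (k * B)); last by rewrite /k; ring.
apply: normc_cintegral_le.
  by apply: cmeasurableM => //; exact: cmeasurable_conj.
have me := measurable_exp_dist (eta / 2) a.
apply: (@le_trans _ _ (\int[leb2]_x (k * expR (- (eta / 2) * enorm (x - a)))%:E)%E).
  apply: ge0_le_integral; first exact: measurableT.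
  - by move=> x _; rewrite lee_fin normc_ge0.
  - apply/measurable_EFinP/measurable_normc.
    by apply: cmeasurableM => //; exact: cmeasurable_conj.
  - by apply/measurable_EFinP; apply: measurable_funM me; exact: measurable_cst.
  - move=> x _; rewrite lee_fin Normc.normcM normc_conj.
    apply: (@le_trans _ _ (A * expR (- eta * enorm (x - a)) *
        (A' * expR (- eta * enorm (x - b))))).
      by apply: ler_pM; rewrite ?normc_ge0.
    rewrite /k mulrACA -expRD -[leRHS]mulrA -expRD ler_wpM2l ?mulr_ge0// ler_expR.
    have := enorm_triangle x a b; rewrite (enorm_dist a x).
    set p := enorm (a - b); set q := enorm (x - a); set r := enorm (x - b) => h1.
    have r0 : 0 <= r by exact: enorm_ge0.
    have := ler_wpM2l (ltW eta0) h1; have := mulr_ge0 (ltW eta0) r0.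
    by clearbody p q r; lra.
rewrite -mul_ge0_integral//.
rewrite (EFinM k); apply: lee_pmul; rewrite ?lee_fin//.
by apply: integral_ge0 => x _; rewrite lee_fin expR_ge0.
Qed.

Variables (P : (R * R -> R[i]) -> (R * R -> R[i])) (K : (R * R) * (R * R) -> R[i]).
Variables (C g : R).
Hypothesis C0 : 0 < C.
Hypothesis g0 : 0 < g.
Hypothesis KP : integral_kernel leb2 P K.
Hypothesis Kdec : {ae (leb2 \x leb2)%E, forall z,
  normc (K z) <= C * expR (- g * enorm (z.1 - z.2))}.

Local Notation edec x y := (C * expR (- g * enorm (x - y))).

(** On the support of [f] the center [m] may replace [y] in the exponential at the cost of
    [e^(g L)]. There also [L ^ (5 / 2) / weight >= 1], so [|f| <= 1 + |f|^2] bounds the integral of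
    [|f|] by that of the inverse weight plus [nsq f], uniformly in [m]. *)
Lemma kernel_exp_bounded (L N : R) : 0 <= L -> 0 <= N -> exists2 A : R, 0 < A &
  forall (m : R * R) f, L2 leb2 f -> (nsq leb2 f <= N%:E)%E ->
    (forall x, L < jbracket (x - m) -> f x = 0) ->
    {ae leb2, forall x, normc (P f x) <= A * expR (- g * enorm (x - m))}.
Proof.
move=> L0 N0; have L0' : 0 <= L `^ (5 / 2) by exact: powR_ge0.
pose D : R := L `^ (5 / 2) * kappa + N.
have D0 : 0 <= D by rewrite addr_ge0// mulr_ge0// ltW// kappa_gt0.
exists (2 * C * expR (g * L) * (D + 1)).
  by rewrite !mulr_gt0 ?expR_gt0// ltr_wpDl.
move=> m f Lf fN fL; have mf := L2_measurable Lf.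
have := ae_kernel_bound C0 KP Kdec Lf; apply: ae_imp => x hx.
rewrite -lee_fin; apply: (le_trans hx).
pose k := C * expR (g * L) * expR (- g * enorm (x - m)).
have k0 : 0 <= k by rewrite /k !mulr_ge0 ?expR_ge0 ?(ltW C0).
rewrite (_ : 2 * C * _ * _ * _ = 2 * (k * (D + 1))); last by rewrite /k; ring.
rewrite (EFinM 2) lee_wpmul2l//.
have mw : measurable_fun setT (fun x : plane => (weight ((x : R * R) - m))^-1).
  by apply: measurable_weight_inv; exact: pmeasurable_sub.
have mw' : measurable_fun setT (fun y : plane => L `^ (5 / 2) * (weight ((y : R * R) - m))^-1).
  by apply: measurable_funM mw; exact: measurable_cst.
have mn : measurable_fun setT (fun y : plane => normc (f y) ^+ 2).
  by apply: measurable_funX; exact: measurable_normc.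
have w0 (y : plane) : 0 <= L `^ (5 / 2) * (weight ((y : R * R) - m))^-1.
  by rewrite mulr_ge0// weight_inv_ge0.
have mwn : measurable_fun setT (fun y : plane =>
    L `^ (5 / 2) * (weight ((y : R * R) - m))^-1 + normc (f y) ^+ 2).
  exact: measurable_funD.
have wn0 (y : plane) : 0 <= L `^ (5 / 2) * (weight ((y : R * R) - m))^-1 + normc (f y) ^+ 2.
  by rewrite addr_ge0// sqr_ge0.
apply: (@le_trans _ _ (\int[leb2]_y (k *
    (L `^ (5 / 2) * (weight (y - m))^-1 + normc (f y) ^+ 2))%:E)%E).
  apply: ge0_le_integral; first exact: measurableT.
  - by move=> y _; rewrite lee_fin !mulr_ge0 ?expR_ge0 ?normc_ge0 ?(ltW C0).
  - apply/measurable_EFinP; apply: measurable_funM; last exact: measurable_normc.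
    exact: measurable_edec_sec.
  - by apply/measurable_EFinP; apply: measurable_funM mwn; exact: measurable_cst.
  - move=> y _; rewrite lee_fin; have [yL|yL] := ltP L (jbracket (y - m)).
      by rewrite fL// Normc.normc0 mulr0 mulr_ge0// addr_ge0.
    apply: ler_pM; rewrite ?normc_ge0 ?mulr_ge0 ?expR_ge0 ?(ltW C0)//.
      rewrite /k -mulrA ler_wpM2l ?(ltW C0)// -expRD ler_expR.
      have h1 := enorm_triangle y x m.
      have h2 := le_trans (enorm_le_jbracket (y - m)) yL.
      have := ler_wpM2l (ltW g0) (le_trans h1 (lerD (lexx _) h2)).
      by rewrite mulrDr !mulNr; lra.
    have : 1 <= L `^ (5 / 2) * (weight (y - m))^-1.
      rewrite ler_pdivlMr ?weight_gt0// mul1r.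
      exact: weight_le.
    have := sqr_ge0 (normc (f y) - 1); have := normc_ge0 (f y).
    by set w := _ * _^-1; set n := normc _; clearbody w n; nra.
rewrite -mul_ge0_integral// (EFinM k) lee_wpmul2l// EFinD.
have -> : (\int[leb2]_y (L `^ (5 / 2) * (weight (y - m))^-1 + normc (f y) ^+ 2)%:E =
    \int[leb2]_y (L `^ (5 / 2) * (weight (y - m))^-1)%:E + nsq leb2 f)%E.
  rewrite /nsq -ge0_integralD//.
  - by move=> y _; rewrite lee_fin.
  - exact/measurable_EFinP.
  - by move=> y _; rewrite lee_fin sqr_ge0.
  - exact/measurable_EFinP.
apply: (@le_trans _ _ D%:E); last by rewrite leeDl.
rewrite /D EFinD; apply: leeD => //.
rewrite -mul_ge0_integral//; last by move=> y; exact: weight_inv_ge0.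
rewrite (EFinM (L `^ (5 / 2))) lee_wpmul2l//.
exact: integral_weight_inv.
Qed.

End ExponentialBounds.

(** * Orthonormalization by a truncated Newton iteration *)

Lemma ler_sum_subset (R : realType) (I : eqType) (F U : seq I) (f : I -> R) :
  uniq F -> uniq U -> {subset F <= U} -> (forall a, 0 <= f a) ->
  \sum_(a <- F) f a <= \sum_(a <- U) f a.
Proof.
move=> uF uU FU f0; rewrite [leRHS](bigID (mem F)) /=.
have -> : \sum_(a <- U | a \in F) f a = \sum_(a <- F) f a.
  rewrite -big_filter; apply: perm_big; apply: uniq_perm => //.
    exact: filter_uniq.
  move=> a; rewrite mem_filter; case: (boolP (a \in F)) => //= aF.
  exact: FU.
by rewrite lerDl sumr_ge0.
Qed.

(** A duplicate-free list of maximal length inside [Q] exhausts [Q], since a missing element could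
    be prepended. *)
Lemma bounded_size_listing (I : eqType) (Q : pred I) (k : nat) :
  (forall U : seq I, uniq U -> all Q U -> (size U <= k)%N) ->
  exists2 U : seq I, uniq U & forall a, (a \in U) = Q a.
Proof.
move=> hk.
have ex : exists n, `[< exists U : seq I, [/\ uniq U, all Q U & size U = n] >].
  by exists 0%N; apply/asboolP; exists [::].
have ub n : `[< exists U : seq I, [/\ uniq U, all Q U & size U = n] >] -> (n <= k)%N.
  by move=> /asboolP[U [uU QU <-]]; exact: hk.
have [n /asboolP[U [uU QU nU]] nmax] := ex_maxnP ex ub.
exists U => // a; apply/idP/idP => [aU|Qa]; first exact: (allP QU).
apply/negPn/negP => aU; have := nmax n.+1.
rewrite ltnn => /(_ _)/negP; apply => //.
by apply/asboolP; exists (a :: U); split; rewrite /= ?aU ?Qa ?nU.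
Qed.

(** * Weighted row-sum norms and the matrix algebra of the iteration *)

Section RowNorms.
Context {R : realType} {I : eqType}.
Variable W : I -> I -> R.
Hypothesis W0 : forall a b, 0 <= W a b.
Hypothesis W_sub : forall c a b, W a b <= W a c * W c b.
Implicit Types (A B : I -> I -> R[i]) (U : seq I).

(** A weighted maximal row sum, submultiplicative because [W] is. Only the columns are restricted to
    [U]; the row index is free, as the second factor of a product needs. *)
Definition row_le U A (alpha : R) :=
  forall a, \sum_(b <- U) normc (A a b) * W a b <= alpha.

Definition mul_on U A B a b := \sum_(c <- U) A a c * B c b.

Lemma row_le_mul U A B (alpha beta : R) : 0 <= beta ->
  row_le U A alpha -> row_le U B beta -> row_le U (mul_on U A B) (alpha * beta).
Proof.
move=> beta0 hA hB a.
apply: (@le_trans _ _ (\sum_(b <- U) \sum_(c <- U)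
    (normc (A a c) * W a c) * (normc (B c b) * W c b))).
  apply: ler_sum => b _; apply: (@le_trans _ _ (\sum_(c <- U) normc (A a c * B c b) * W a b)).
    by rewrite -mulr_suml ler_wpM2r// normc_sum.
  apply: ler_sum => c _; rewrite Normc.normcM mulrACA ler_wpM2l//.
  by rewrite mulr_ge0// normc_ge0.
rewrite exchange_big /=.
under eq_bigr do rewrite -mulr_sumr.
apply: (@le_trans _ _ (\sum_(c <- U) normc (A a c) * W a c * beta)).
  by apply: ler_sum => c _; rewrite ler_wpM2l ?mulr_ge0 ?normc_ge0.
by rewrite -mulr_suml ler_wpM2r.
Qed.

Lemma sum_delta_l U (f : I -> R[i]) a : uniq U -> a \in U ->
  \sum_(c <- U) (a == c)%:R * f c = f a.
Proof.
move=> uU aU; rewrite (bigD1_seq a)//= eqxx mul1r big1 ?addr0//.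
by move=> c; rewrite eq_sym => /negbTE ->; rewrite mul0r.
Qed.

Lemma sum_delta_r U (f : I -> R[i]) a : uniq U -> a \in U ->
  \sum_(c <- U) f c * (c == a)%:R = f a.
Proof.
move=> uU aU; rewrite (bigD1_seq a)//= eqxx mulr1 big1 ?addr0//.
by move=> c /negbTE ->; rewrite mulr0.
Qed.

(** The product [(1 - M/2) (1 + E) (1 - M/2)] multiplied out; for Hermitian [M] it is the Gram
    matrix of the corrected family. The indices [a] and [b] must lie in [U] for the identity matrix
    to act on them. *)
Lemma mul_on_newton U (E M : I -> I -> R[i]) a b : uniq U -> a \in U -> b \in U ->
  \sum_(c <- U) \sum_(e <- U)
    ((a == c)%:R - 2^-1 * M a c) * ((e == b)%:R - 2^-1 * M e b) * ((c == e)%:R + E c e)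
  = (a == b)%:R + (E a b - M a b) - 2^-1 * mul_on U E M a b - 2^-1 * mul_on U M E a b
    + 4^-1 * mul_on U M M a b + 4^-1 * mul_on U M (mul_on U E M) a b.
Proof.
move=> uU aU bU.
pose Y c := (c == b)%:R + E c b - 2^-1 * (M c b + mul_on U E M c b).
have hY c : c \in U -> \sum_(e <- U) ((e == b)%:R - 2^-1 * M e b) * ((c == e)%:R + E c e) = Y c.
  move=> cU.
  transitivity (\sum_(e <- U) ((c == e)%:R + E c e) * (e == b)%:R -
      2^-1 * (\sum_(e <- U) (c == e)%:R * M e b + mul_on U E M c b)).
    rewrite /mul_on -big_split /= mulr_sumr -sumrB; apply: eq_bigr => e _; ring.
  by rewrite sum_delta_r// sum_delta_l.
transitivity (\sum_(c <- U) ((a == c)%:R - 2^-1 * M a c) * Y c).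
  apply: eq_big_seq => c cU; rewrite -hY// mulr_sumr; apply: eq_bigr => e _.
  by rewrite mulrA.
transitivity (\sum_(c <- U) (a == c)%:R * Y c - 2^-1 * (\sum_(c <- U) M a c * (c == b)%:R
   + mul_on U M E a b - 2^-1 * (mul_on U M M a b + mul_on U M (mul_on U E M) a b))).
  have -> : mul_on U M E a b = \sum_(c <- U) M a c * E c b by [].
  have -> : mul_on U M M a b = \sum_(c <- U) M a c * M c b by [].
  have -> : mul_on U M (mul_on U E M) a b =
    \sum_(c <- U) M a c * mul_on U E M c b by [].
  rewrite -!big_split /= mulr_sumr -sumrB mulr_sumr -sumrB.
  by apply: eq_bigr => c _; rewrite /Y; ring.
rewrite sum_delta_l// sum_delta_r// /Y.
set p := mul_on U E M a b; set q := mul_on U M E a b; set r := mul_on U M M a b.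
set t := mul_on U M _ a b; by field; rewrite ?pnatr_eq0.
Qed.

(** The product [M (1 + E) M]; for Hermitian [M], a quarter of it is the Gram matrix of the
    correction [- (M / 2) F]. *)
Lemma mul_on_gram U (E M : I -> I -> R[i]) a b : uniq U ->
  \sum_(c <- U) \sum_(e <- U) M a c * M e b * ((c == e)%:R + E c e)
  = mul_on U M M a b + mul_on U M (mul_on U E M) a b.
Proof.
move=> uU; rewrite /mul_on -big_split /=; apply: eq_big_seq => c cU.
rewrite -mulrDr -[M c b](sum_delta_l (fun e => M e b) uU cU) -big_split /= mulr_sumr.
by apply: eq_bigr => e _; ring.
Qed.

End RowNorms.

Section Halves.
Context {R : realType}.
Implicit Types z : R[i].

Lemma normc_nat n : normc (n%:R : R[i]) = n%:R.
Proof. by rewrite normcMn Normc.normc1. Qed.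

Lemma normc_half z : normc (2^-1 * z) = 2^-1 * normc z.
Proof. by rewrite Normc.normcM Normc.normcV normc_nat. Qed.

Lemma normc_quarter z : normc (4^-1 * z) = 4^-1 * normc z.
Proof. by rewrite Normc.normcM Normc.normcV normc_nat. Qed.

Lemma normc_Nhalf_le z : normc (- 2^-1 * z) <= normc z.
Proof.
by rewrite mulNr normcN_eq normc_half; have := normc_ge0 z; lra.
Qed.

End Halves.

(** * One step of the truncated Newton iteration *)

Section NewtonStep.
Context {R : realType} {I : eqType}.
Local Notation plane := (measurableTypeR R * measurableTypeR R)%type.
Local Notation leb2 := (@lebesgue2 R).
Variables (P : (R * R -> R[i]) -> (R * R -> R[i])) (m : I -> R * R).
Variables (S eta th : R).
Hypothesis Pbl : bounded_linear_operator leb2 P.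
Hypothesis S0 : 0 <= S.
Hypothesis eta0 : 0 < eta.
Hypothesis th0 : 0 < th.
Hypothesis th_eta : 4 * th <= eta.
Hypothesis hS : forall a (U : seq I), uniq U ->
  \sum_(b <- U) (weight (m a - m b))^-1 <= S.
Implicit Types (F : I -> plane -> R[i]) (E : I -> I -> R[i]) (U : seq I).

Local Notation dist a b := (enorm (m a - m b)).

Definition expw a b := expR (th * dist a b).

Lemma expw_ge0 a b : 0 <= expw a b.
Proof. exact: expR_ge0. Qed.

Lemma expw_ge1 a b : 1 <= expw a b.
Proof. by rewrite -expR0 ler_expR mulr_ge0 ?enorm_ge0// ltW. Qed.

Lemma expw_sub c a b : expw a b <= expw a c * expw c b.
Proof.
by rewrite /expw -expRD ler_expR -mulrDr ler_wpM2l ?(ltW th0)// enorm_triangle.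
Qed.

Definition gram_err F a b := inner leb2 (F a) (F b) - (a == b)%:R.

(** Two rates are carried along. At the fast rate [eta] the constant may grow from step to step; it
    only guarantees that a truncation radius exists. At the slow rate [th] the constant [A] is
    tracked, since this bound must survive in the limit. *)
Definition newton_state F (A eps : R) :=
  [/\ forall a, L2range leb2 P (F a),
      exists C, forall a, exp_bounded C eta (m a) (F a),
      forall a, exp_bounded A th (m a) (F a) &
      forall U, uniq U -> row_le expw U (gram_err F) eps].

(** The entries decay at rate [eta / 2] and the weight grows at rate at most [eta / 4]. Of the
    surplus [eta / 4], one half gives smallness beyond [D] and the other half dominates the inverse
    weight, whose row sums are at most [S]. *)
Lemma exp_decay_tail E (C1 delta : R) : 0 <= C1 -> 0 < delta ->
  (forall a b, normc (E a b) <= C1 * expR (- (eta / 2) * dist a b)) ->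
  exists2 D : R, 0 <= D & forall U, uniq U ->
    row_le expw U (fun a b => if dist a b <= D then 0 else E a b) delta.
Proof.
move=> C10 d0 hE.
have e8 : 0 < eta / 8 by rewrite divr_gt0.
have [M M0 hM] := exp_weight_bound e8.
(* With this [y], the inequality [y e^(-y) <= 1] says [C1 M S e^(-y) <= delta]; beyond
   [D = y / (eta / 8)] the first half of the surplus supplies [e^(-y)]. *)
pose y := C1 * M * S / delta.
have y0 : 0 <= y by rewrite divr_ge0 ?(ltW d0)// !mulr_ge0 ?(ltW M0).
exists (y / (eta / 8)); first by rewrite divr_ge0// ltW.
move=> U uU a.
have ey : C1 * M * expR (- y) * S <= delta.
  have -> : C1 * M * expR (- y) * S = delta * (y * expR (- y)).
    by rewrite /y; field; rewrite gt_eqF.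
  rewrite -[leRHS]mulr1 ler_wpM2l ?(ltW d0)// expRN ler_pdivrMr ?expR_gt0// mul1r.
  by apply: le_trans (expR_ge1Dx y); rewrite lerDr.
have Cy : 0 <= C1 * M * expR (- y) by rewrite !mulr_ge0 ?expR_ge0 ?(ltW M0).
apply: le_trans ey; apply: le_trans (ler_wpM2l Cy (hS a uU)).
rewrite mulr_sumr; apply: ler_sum => b _; case: ifPn => h.
  by rewrite Normc.normc0 mul0r mulr_ge0// invr_ge0 weight_ge0.
rewrite -ltNge ltr_pdivrMr// in h.
apply: (le_trans (ler_wpM2r (expw_ge0 a b) (hE a b))).
have hw : expR (- (eta / 8) * dist a b) <= M * (weight (m a - m b))^-1.
  rewrite ler_pdivlMr ?weight_gt0//; apply: le_trans (hM (m a - m b)).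
  by rewrite ler_wpM2l ?expR_ge0// expr2 ler_peMr ?weight_ge0 ?weight_ge1.
apply: (@le_trans _ _ (C1 * (expR (- y) * (M * (weight (m a - m b))^-1)))); last first.
  by rewrite le_eqVlt; apply/orP; left; apply/eqP; ring.
rewrite -mulrA ler_wpM2l//.
apply: (@le_trans _ _ (expR (- y) * expR (- (eta / 8) * dist a b))); last first.
  by rewrite ler_wpM2l ?expR_ge0.
rewrite /expw -!expRD ler_expR.
have := enorm_ge0 (m a - m b); move: h; set d := enorm _ => h dd0.
have := ler_wpM2r dd0 th_eta; clearbody d; lra.
Qed.

(** Each center within distance [D] contributes at least [(1 + D) ^ (-5/2)] to a sum bounded by [S],
    which bounds their number. *)
Lemma finite_neighbours (D : R) : 0 <= D ->
  exists N : I -> seq I, forall a, uniq (N a) /\ forall b, (b \in N a) = (dist a b <= D).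
Proof.
move=> D0; suff h a : exists U : seq I, uniq U /\ forall b, (b \in U) = (dist a b <= D).
  exists (fun a => sval (cid (h a))) => a; exact: (svalP (cid (h a))).
have w0 : 0 < (1 + D) `^ (5 / 2) by rewrite powR_gt0// ltr_pwDl.
have [|U uU hU] := @bounded_size_listing I (fun b => dist a b <= D)
  (Num.bound (S * (1 + D) `^ (5 / 2))); last by exists U.
move=> U uU /allP hU; rewrite ltnW// -(ltr_nat R).
apply: (@le_lt_trans _ _ (S * (1 + D) `^ (5 / 2))); last first.
  by apply: archi_boundP; rewrite mulr_ge0// ltW.
rewrite -ler_pdivrMr//; apply: le_trans (hS a uU).
rewrite (_ : (size U)%:R = \sum_(b <- U) 1); last first.
  by rewrite big_const_seq count_predT iter_addr_0.
rewrite mulr_suml; rewrite big_seq [leRHS]big_seq; apply: ler_sum => b bU.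
rewrite mul1r lef_pV2 ?posrE ?weight_gt0//; apply: weight_le.
by apply: (le_trans (jbracket_le _)); rewrite lerD2l hU.
Qed.

Lemma gram_err_conj F a b : (forall a, L2 leb2 (F a)) ->
  conjc (gram_err F b a) = gram_err F a b.
Proof.
move=> LF; by rewrite /gram_err conjcD conjcN -inner_conj// conjc_nat eq_sym.
Qed.

Lemma newton_state_decay F A eps : newton_state F A eps ->
  exists2 C1, 0 <= C1 & forall a b, normc (gram_err F a b) <= C1 * expR (- (eta / 2) * dist a b).
Proof.
move=> [RF [C hC] _ _]; have [B B0 hB] := exp_bounded_inner eta0.
exists (C * C * B + 1); first by rewrite addr_ge0// mulr_ge0 ?(ltW B0)// -expr2 sqr_ge0.
move=> a b; have [[mFa _] _] := RF a; have [[mFb _] _] := RF b.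
rewrite /gram_err (le_trans (normcD_le _ _))// normcN_eq mulrDl lerD//.
  exact: hB.
have [->|ab] := eqVneq a b; last by rewrite Normc.normc0 mul1r expR_ge0.
rewrite subrr enorm0 mulr0 expR0 mulr1.
by rewrite Normc.normc1.
Qed.

(* With [E] the Gram error of [F] and [M] its restriction to pairs of centers at
   distance at most [D], the new family is [(1 - M / 2) F], whose Gram error is
   [(E - M) - (E M + M E) / 2 + M M / 4 + M E M / 4]. *)
Lemma newton_step F (A eps : R) : 0 < eps -> 4 * eps <= 1 -> newton_state F A eps ->
  exists F', [/\ newton_state F' (A * (1 + eps)) (eps / 2),
    forall a, exp_bounded (A * eps) th (m a) (fun x => F' a x - F a x) &
    forall U (c : I -> R[i]), uniq U ->
      (nsq leb2 (fun x => \sum_(a <- U) c a * (F' a x - F a x))%R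
        <= (eps ^+ 2 * \sum_(a <- U) normc (c a) ^+ 2)%:E)%E].
Proof.
move=> eps0 eps4 st; have [RF [C hC] hA hE] := st.
have LF a : L2 leb2 (F a) by case: (RF a).
pose E := gram_err F.
have EC a b : conjc (E b a) = E a b by exact: gram_err_conj.
have [C1 C10 hC1] := newton_state_decay st.
(* Error budget: tail [eps / 8], the two mixed products [eps^2 <= eps / 4] together, then
   [eps^2 / 4 <= eps / 16] and [eps^3 / 4 <= eps / 64]; the total is below [eps / 2]. *)
have [D D0 hT] := exp_decay_tail C10 (divr_gt0 eps0 (ltr0n R 8)) hC1.
have [N hN] := finite_neighbours D0.
pose M a b : R[i] := if dist a b <= D then E a b else 0.
pose X a b : R[i] := (a == b)%:R - 2^-1 * M a b.
have MC a b : conjc (M b a) = M a b.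
  by rewrite /M enorm_dist; case: ifP => // _; exact: conjc0.
have XC a b : conjc (X b a) = X a b.
  by rewrite /X conjcD conjcN conjcM MC conjc_inv !conjc_nat eq_sym.
have self a : a \in N a.
  by have [_ ->] := hN a; rewrite subrr enorm0.
have M0 a b : b \notin N a -> M a b = 0.
  by have [_ ->] := hN a; rewrite /M => /negbTE ->.
have X0 a b : b \notin N a -> X a b = 0.
  move=> bN; rewrite /X M0// mulr0 subr0; case: eqP => // ab.
  by rewrite -ab self in bN.
pose F' a x := \sum_(b <- N a) X a b * F b x.
(* Since the coefficients vanish off [N a], each row can be summed over any larger list; this brings
   different rows to a common finite index set. *)
have widen (Z : I -> I -> R[i]) a U x : (forall b, b \notin N a -> Z a b = 0) ->
    uniq U -> {subset N a <= U} ->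
    \sum_(b <- N a) Z a b * F b x = \sum_(b <- U) Z a b * F b x.
  move=> Z0 uU NU; rewrite [RHS](bigID (mem (N a))) /=.
  rewrite [X in _ + X]big1 ?addr0; last by move=> b /Z0 ->; rewrite mul0r.
  rewrite -[RHS]big_filter; apply: perm_big; apply: uniq_perm.
  - by have [] := hN a.
  - exact: filter_uniq.
  - by move=> b; rewrite mem_filter; case: (boolP (b \in N a)) => // /NU ->.
have F'E a U x : uniq U -> {subset N a <= U} -> F' a x = \sum_(b <- U) X a b * F b x.
  exact: widen (X0 a).
have DE a U x : uniq U -> {subset N a <= U} ->
    F' a x - F a x = \sum_(b <- U) (- 2^-1 * M a b) * F b x.
  move=> uU NU; rewrite (F'E a U x uU NU).
  rewrite -[F a x](sum_delta_l (fun b => F b x) uU (NU _ (self a))) -sumrB.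
  by apply: eq_bigr => b _; rewrite /X; ring.
have Mrow U : uniq U -> row_le expw U M eps.
  move=> uU a; apply: le_trans (hE U uU a); apply: ler_sum => b _.
  rewrite ler_wpM2r ?expw_ge0// /M; case: ifP => // _.
  by rewrite Normc.normc0 normc_ge0.
(* A list closed enough for the matrix identities: it contains the row index's neighbours, the
   columns [V] and the neighbours of every column. *)
have ambient a (V : seq I) : exists2 U, uniq U &
    [/\ {subset N a <= U}, {subset V <= U} & forall b, b \in V -> {subset N b <= U}].
  exists (undup (N a ++ V ++ flatten [seq N b | b <- V])); first exact: undup_uniq.
  split=> [b|b|b bV c cN]; rewrite mem_undup !mem_cat; first by move=> ->.
    by move=> ->; rewrite orbT.
  apply/orP; right; apply/orP; right; apply/flattenP; exists (N b) => //.
  exact: map_f.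
have LF' a : L2 leb2 (F' a) by exact: L2_lincomb.
have gramX (Z : I -> I -> R[i]) a b U : inner leb2
    (fun x => \sum_(c <- U) Z a c * F c x) (fun x => \sum_(e <- U) Z b e * F e x) =
    \sum_(c <- U) \sum_(e <- U) Z a c * conjc (Z b e) * ((c == e)%:R + E c e).
  rewrite inner_lincombl//; last exact: L2_lincomb.
  apply: eq_bigr => c _; rewrite inner_lincombr// mulr_sumr; apply: eq_bigr => e _.
  by rewrite mulrA /E /gram_err; congr (_ * _); ring.
have eps1 : 0 <= eps by exact: ltW.
have hw := @row_le_mul _ _ expw expw_ge0 expw_sub.
(* Moving the center of the exponential from [m b] to [m a] costs exactly [expw a b], so the
   weighted row sum of [M] appears as the factor [eps]. *)
have Dth a : exp_bounded (A * eps) th (m a) (fun x => F' a x - F a x).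
  move=> x; have A0 : 0 <= A := exp_bounded_ge0 (hA a).
  rewrite (DE a (N a)) //; last by case: (hN a).
  apply: (le_trans (normc_sum _ _)).
  apply: (@le_trans _ _ (\sum_(b <- N a) (normc (M a b) * expw a b) *
      (A * expR (- th * enorm (x - m a))))).
    apply: ler_sum => b _; rewrite Normc.normcM -mulrA.
    apply: ler_pM; rewrite ?normc_ge0//.
      exact: normc_Nhalf_le.
    apply: (le_trans (hA b x)); rewrite mulrCA ler_wpM2l //.
    rewrite /expw -expRD ler_expR.
    have := ler_wpM2l (ltW th0) (enorm_triangle (m b) x (m a)).
    rewrite (enorm_dist (m b)) mulrDr.
    by set u := enorm _; set v := enorm _; set w := enorm _; clearbody u v w; lra.
  rewrite -mulr_suml.
  rewrite [leRHS](_ : _ = eps * (A * expR (- th * enorm (x - m a)))); last by ring.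
  rewrite ler_wpM2r ?mulr_ge0 ?expR_ge0 //.
  by apply: Mrow; case: (hN a).
(* At the rate [eta] a change of center is not covered by the weight; it costs [e^(eta D)], finite
   because only neighbours within [D] enter. *)
have Cex : exists C', forall a, exp_bounded C' eta (m a) (F' a).
  exists (C + C * expR (eta * D) * eps) => a x.
  have C0 : 0 <= C := exp_bounded_ge0 (hC a).
  have -> : F' a x = F a x + (F' a x - F a x) by ring.
  rewrite (le_trans (normcD_le _ _))// mulrDl; apply: lerD; first exact: hC.
  rewrite (DE a (N a)) //; last by case: (hN a).
  apply: (le_trans (normc_sum _ _)).
  apply: (@le_trans _ _ (\sum_(b <- N a) (normc (M a b) * expw a b) *
      (C * expR (eta * D) * expR (- eta * enorm (x - m a))))).
    rewrite big_seq [leRHS]big_seq; apply: ler_sum => b.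
    have [_ ->] := hN a => dD.
    rewrite Normc.normcM; apply: ler_pM; rewrite ?normc_ge0//.
      apply: (le_trans (normc_Nhalf_le _)).
      by rewrite ler_peMr ?normc_ge0 ?expw_ge1.
    apply: (le_trans (hC b x)); rewrite -mulrA ler_wpM2l // -expRD ler_expR.
    have := ler_wpM2l (ltW eta0) (enorm_triangle (m b) x (m a)).
    have := ler_wpM2l (ltW eta0) dD.
    rewrite (enorm_dist (m b)) mulrDr.
    by set u := enorm _; set v := enorm _; set w := enorm _; clearbody u v w; lra.
  rewrite -mulr_suml.
  rewrite [leRHS](_ : _ = eps * (C * expR (eta * D) * expR (- eta * enorm (x - m a)))); last by ring.
  rewrite ler_wpM2r ?mulr_ge0 ?expR_ge0 //.
  by apply: Mrow; case: (hN a).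
exists F'; split.
- split.
  + by move=> a; exact: L2range_lincomb.
  + exact: Cex.
  + move=> a x; have -> : F' a x = F a x + (F' a x - F a x) by ring.
    rewrite (le_trans (normcD_le _ _))// mulrDr mulr1 mulrDl.
    by apply: lerD; [exact: hA|exact: Dth].
  + move=> V uV a; have [U uU [NaU VU NU]] := ambient a (a :: V).
    have aU : a \in U by apply: VU; rewrite mem_head.
    have VU' : {subset V <= U} by move=> b bV; apply: VU; rewrite inE bV orbT.
    pose T a b : R[i] := if dist a b <= D then 0 else E a b.
    pose R1 := mul_on U E M; pose R2 := mul_on U M E; pose R3 := mul_on U M M.
    pose R4 := mul_on U M (mul_on U E M).
    have eE b : b \in V -> gram_err F' a b = T a b - 2^-1 * R1 a b - 2^-1 * R2 a b
        + 4^-1 * R3 a b + 4^-1 * R4 a b.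
      move=> bV; have bU := VU' b bV.
      rewrite /gram_err (_ : F' a = fun x => \sum_(c <- U) X a c * F c x); last first.
        by apply/funext => x; exact: F'E.
      rewrite (_ : F' b = fun x => \sum_(c <- U) X b c * F c x); last first.
        by apply/funext => x; apply: F'E => //; apply: NU; rewrite inE bV orbT.
      rewrite gramX.
      under eq_bigr do under eq_bigr do rewrite XC.
      rewrite /X mul_on_newton// -/R1 -/R2 -/R3 -/R4.
      have -> : E a b - M a b = T a b by rewrite /T /M; case: ifP => _; rewrite ?subrr ?subr0.
      ring.
    apply: (@le_trans _ _ (\sum_(b <- V) (normc (T a b) * expw a b +
        2^-1 * (normc (R1 a b) * expw a b) + 2^-1 * (normc (R2 a b) * expw a b) +
        4^-1 * (normc (R3 a b) * expw a b) + 4^-1 * (normc (R4 a b) * expw a b)))).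
      rewrite big_seq [leRHS]big_seq; apply: ler_sum => b bV; rewrite eE//.
      rewrite !mulrA -!mulrDl ler_wpM2r ?expw_ge0//.
      rewrite (le_trans (normcD_le _ _))// normc_quarter lerD2r.
      rewrite (le_trans (normcD_le _ _))// normc_quarter lerD2r.
      rewrite (le_trans (normcD_le _ _))// normcN_eq normc_half lerD2r.
      by rewrite (le_trans (normcD_le _ _))// normcN_eq normc_half.
    have nn (Z : I -> I -> R[i]) b : 0 <= normc (Z a b) * expw a b.
      by rewrite mulr_ge0 ?normc_ge0 ?expw_ge0.
    have hT' := hT U uU a; have hE' := hE U uU; have hM' := Mrow U uU.
    have r1 := hw _ _ _ _ _ eps1 hE' hM'.
    have r2 := hw _ _ _ _ _ eps1 hM' hE' a.
    have r3 := hw _ _ _ _ _ eps1 hM' hM' a.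
    have r4 := hw _ _ _ _ _ (mulr_ge0 eps1 eps1) hM' r1 a.
    apply: (@le_trans _ _ (\sum_(b <- U) (normc (T a b) * expw a b +
        2^-1 * (normc (R1 a b) * expw a b) + 2^-1 * (normc (R2 a b) * expw a b) +
        4^-1 * (normc (R3 a b) * expw a b) + 4^-1 * (normc (R4 a b) * expw a b)))).
      by apply: ler_sum_subset => // b; rewrite !addr_ge0 ?mulr_ge0 ?normc_ge0 ?expw_ge0.
    rewrite !big_split /= -!mulr_sumr.
    have r1a := r1 a; move: hT' r1a r2 r3 r4.
    rewrite -/T -/R1 -/R2 -/R3 -/R4.
    move: (\sum_(b <- U) normc (T a b) * _) (\sum_(b <- U) normc (R1 a b) * _)
      (\sum_(b <- U) normc (R2 a b) * _) (\sum_(b <- U) normc (R3 a b) * _)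
      (\sum_(b <- U) normc (R4 a b) * _) => t1 t2 t3 t4 t5 h1 h2 h3 h4 h5.
    have e2 : eps * eps <= eps / 4 by rewrite ler_wpM2l//; lra.
    have e3 : eps * (eps * eps) <= eps / 16.
      apply: (le_trans (ler_wpM2l eps1 e2)); rewrite mulrA ler_pdivrMr//.
      by rewrite (_ : eps / 16 * 4 = eps / 4) //; lra.
    by lra.
- exact: Dth.
(* The Gram matrix of the corrections is [M (1 + E) M / 4], with row sums at most
   [(eps^2 + eps^3) / 4]. *)
- move=> V c uV; apply: nsq_lincomb_le => [a|a]; first exact: L2B.
  have [U uU [NaU VU NU]] := ambient a (a :: V).
  have aU : a \in U by apply: VU; rewrite mem_head.
  have VU' : {subset V <= U} by move=> b bV; apply: VU; rewrite inE bV orbT.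
  pose R3 := mul_on U M M; pose R4 := mul_on U M (mul_on U E M).
  pose h a b : R[i] := - 2^-1 * M a b.
  have eD b : b \in V -> inner leb2 (fun x => F' a x - F a x) (fun x => F' b x - F b x) =
      4^-1 * (R3 a b + R4 a b).
    move=> bV; have bU := VU' b bV.
    rewrite (_ : (fun x => F' a x - F a x) = fun x => \sum_(c <- U) h a c * F c x); last first.
      by apply/funext => x; exact: DE.
    rewrite (_ : (fun x => F' b x - F b x) = fun x => \sum_(c <- U) h b c * F c x); last first.
      by apply/funext => x; apply: DE => //; apply: NU; rewrite inE bV orbT.
    rewrite gramX -(mul_on_gram E M a b uU) mulr_sumr; apply: eq_bigr => e _.
    rewrite mulr_sumr; apply: eq_bigr => e' _.
    rewrite /h conjcM MC conjcN conjc_inv conjc_nat; field; by rewrite ?pnatr_eq0.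
  apply: (@le_trans _ _ (\sum_(b <- V)
      (4^-1 * (normc (R3 a b) * expw a b) + 4^-1 * (normc (R4 a b) * expw a b)))).
    rewrite big_seq [leRHS]big_seq; apply: ler_sum => b bV; rewrite eD//.
    rewrite normc_quarter -mulrDr ler_wpM2l// (le_trans (normcD_le _ _))// lerD//;
      by rewrite ler_peMr ?normc_ge0 ?expw_ge1.
  have hE' := hE U uU; have hM' := Mrow U uU.
  have r3 := hw _ _ _ _ _ eps1 hM' hM' a.
  have r4 := hw _ _ _ _ _ (mulr_ge0 eps1 eps1) hM' (hw _ _ _ _ _ eps1 hE' hM') a.
  apply: (@le_trans _ _ (\sum_(b <- U)
      (4^-1 * (normc (R3 a b) * expw a b) + 4^-1 * (normc (R4 a b) * expw a b)))).
    by apply: ler_sum_subset => // b; rewrite !addr_ge0 ?mulr_ge0 ?normc_ge0 ?expw_ge0.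
  rewrite !big_split /= -!mulr_sumr; move: r3 r4; rewrite -/R3 -/R4.
  move: (\sum_(b <- U) normc (R3 a b) * _) (\sum_(b <- U) normc (R4 a b) * _) => t4 t5 h4 h5.
  have e3 : eps * (eps * eps) <= eps * eps.
    by rewrite ler_wpM2l// ler_piMr//; lra.
  by rewrite expr2; have := mulr_ge0 eps1 eps1; lra.
Qed.

End NewtonStep.

(** * Geometric limits and convergence of the iteration *)

Lemma asbool_eqE (I : eqType) (a b : I) : `[< a = b >] = (a == b).
Proof. by apply/asboolP/eqP. Qed.

Lemma dependent_choice_nat (X : Type) (G : nat -> X -> Prop) (Q : nat -> X -> X -> Prop) :
  (exists x, G 0%N x) -> (forall n x, G n x -> exists2 y, G n.+1 y & Q n x y) ->
  exists f : nat -> X, forall n, G n (f n) /\ Q n (f n) (f n.+1).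
Proof.
move=> h0 hS; have [x0 G0] := cid h0.
have st n (s : {x | G n x}) : {y : {y | G n.+1 y} | Q n (sval s) (sval y)}.
  case: s => x Gx; have [y Gy Qy] := cid2 (hS n x Gx).
  by exists (exist _ y Gy).
pose fix f n : {x | G n x} :=
  if n is k.+1 then sval (st k (f k)) else exist _ x0 G0.
exists (fun n => sval (f n)) => n; split; first exact: svalP (f n).
exact: svalP (st n (f n)).
Qed.

(** Nested intervals: [2 * k * 2^-1 ^+ n] is the sum of all later increments, so the lower ends
    [w n] increase, the upper ends [v n] decrease, and the supremum of the [w n] lies in all of
    them. *)
Lemma real_geometric_limit (R : realType) (u : nat -> R) (k : R) :
  (forall n, `|u n.+1 - u n| <= k * 2^-1 ^+ n) ->
  exists l, forall n, `|l - u n| <= 2 * k * 2^-1 ^+ n.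
Proof.
move=> hu; pose w n := u n - 2 * k * 2^-1 ^+ n; pose v n := u n + 2 * k * 2^-1 ^+ n.
have k0 : 0 <= k by have := le_trans (normr_ge0 _) (hu 0%N); rewrite expr0 mulr1.
have p n : 0 <= k * 2^-1 ^+ n by rewrite mulr_ge0// exprn_ge0// invr_ge0.
have wS n : w n <= w n.+1.
  have := hu n; rewrite ler_norml => /andP[h _]; rewrite /w exprS.
  by move: h; set t := _ ^+ n; lra.
have vS n : v n.+1 <= v n.
  have := hu n; rewrite ler_norml => /andP[_ h]; rewrite /v exprS.
  by move: h; set t := _ ^+ n; lra.
have wm a b : (a <= b)%N -> w a <= w b.
  by move=> /subnK <-; elim: (b - a)%N => // n; move/le_trans; apply; exact: wS.
have vm a b : (a <= b)%N -> v b <= v a.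
  by move=> /subnK <-; elim: (b - a)%N => // n; apply: le_trans; exact: vS.
have wv n : w n <= v n by rewrite /w /v; have := p n; set t := _ ^+ n; lra.
have wvab a b : w a <= v b.
  apply: (le_trans (wm a (maxn a b) (leq_maxl _ _))).
  by apply: (le_trans (wv _)); apply: vm; exact: leq_maxr.
exists (sup (range w)) => n.
have hs : has_sup (range w).
  split; first by exists (w 0%N); exists 0%N.
  by exists (v 0%N) => _ [a _ <-]; exact: wvab.
have h1 : w n <= sup (range w) by apply: ub_le_sup; [case: hs|exists n].
have h2 : sup (range w) <= v n.
  by apply: ge_sup; [case: hs|move=> _ [a _ <-]; exact: wvab].
by rewrite ler_norml; move: h1 h2; rewrite /w /v; set t := _ ^+ n; lra.
Qed.

Lemma complex_geometric_limit (R : realType) (z : nat -> R[i]) (k : R) :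
  (forall n, normc (z n.+1 - z n) <= k * 2^-1 ^+ n) ->
  exists l, forall n, normc (l - z n) <= 4 * k * 2^-1 ^+ n.
Proof.
move=> hz.
have [|a ha] := @real_geometric_limit R (fun n => complex.Re (z n)) k.
  by move=> n; rewrite -ReN -ReD (le_trans (normr_Re_le _)).
have [|b hb] := @real_geometric_limit R (fun n => complex.Im (z n)) k.
  by move=> n; rewrite -ImN -ImD (le_trans (normr_Im_le _)).
exists (Complex a b) => n; apply: (le_trans (normc_le_ReIm _)).
rewrite ReD ReN ImD ImN /=; have := ha n; have := hb n.
by set t := _ ^+ n; lra.
Qed.

Lemma measurable_geometric_limit d (T : measurableType d) (R : realType)
    (u : nat -> T -> R) (l k : T -> R) : (forall n, measurable_fun setT (u n)) ->
  (forall n x, `|l x - u n x| <= k x * 2^-1 ^+ n) -> measurable_fun setT l.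
Proof.
move=> mu hu; apply: (measurable_fun_cvg (f := l) mu) => x _.
apply/cvgrPdist_le => e e0; have [N hN] := geometric_small (k x) e0.
exists N => // n /= Nn; apply: (le_trans (hu n x)).
have k0 : 0 <= k x by have := le_trans (normr_ge0 _) (hu 0%N x); rewrite expr0 mulr1.
apply: le_trans (ltW hN); rewrite mulrC ler_wpM2r//.
by apply: ler_wiXn2l; rewrite ?invr_ge0 ?invf_le1// ler1n.
Qed.

Section NewtonLimit.
Context {R : realType} {I : eqType}.
Local Notation plane := (measurableTypeR R * measurableTypeR R)%type.
Local Notation leb2 := (@lebesgue2 R).
Variables (P : (R * R -> R[i]) -> (R * R -> R[i])) (m : I -> R * R).
Variables (S eta th : R).
Hypothesis hP : orthogonal_projector leb2 P.
Hypothesis S0 : 0 <= S.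
Hypothesis eta0 : 0 < eta.
Hypothesis th0 : 0 < th.
Hypothesis th_eta : 4 * th <= eta.
Hypothesis hS : forall a (U : seq I), uniq U ->
  \sum_(b <- U) (weight (m a - m b))^-1 <= S.
Implicit Types (U : seq I).

Let Pbl : bounded_linear_operator leb2 P. Proof. by case: hP. Qed.

Lemma bounded_nsq : exists2 M : R, 0 <= M &
  forall f, L2 leb2 f -> (nsq leb2 (P f) <= M%:E * nsq leb2 f)%E.
Proof.
have [_ _ _ [M hM]] := Pbl; exists (M ^+ 2) => [|f Lf]; first exact: sqr_ge0.
have Lpf : L2 leb2 (P f) by have [h _ _ _] := Pbl; exact: h.
have Nf := L2_nsq Lf; set N := fine _ in Nf.
have N0 : 0 <= N by rewrite fine_ge0// nsq_ge0.
have nf : L2norm leb2 f = (Num.sqrt N)%:E.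
  by rewrite L2norm_nsq Nf poweR_EFin powR12_sqrt.
have := hM f Lf; rewrite nf -EFinM => h.
have h2 : (L2norm leb2 (P f) <= (`|M| * Num.sqrt N)%:E)%E.
  by apply: (le_trans h); rewrite lee_fin ler_wpM2r ?sqrtr_ge0 ?ler_norm.
move/L2norm_le: h2 => /(_ (mulr_ge0 (normr_ge0 _) (sqrtr_ge0 _))).
by rewrite exprMn real_normK ?num_real// sqr_sqrtr// Nf -EFinM.
Qed.

Lemma range_fixed f : L2range leb2 P f -> ae_eq leb2 setT (P f) f.
Proof.
move=> [Lf [f0 Lf0 ff0]]; have [[Pin Pae _ _] Pid _] := hP.
have h1 := Pae _ _ Lf (Pin _ Lf0) ff0; have h2 := Pid _ Lf0.
have h3 : ae_eq leb2 setT (P (P f0)) f := ae_eq_trans h2 (ae_eq_sym ff0).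
exact: ae_eq_trans h1 h3.
Qed.

(** As [P] fixes [h], the defect [P f - f] equals [P (f - h) - (f - h)] almost everywhere, which
    boundedness of [P] makes arbitrarily small. *)
Lemma range_closed f (B : R) : L2 leb2 f ->
  (forall n, exists2 h, L2range leb2 P h &
    (nsq leb2 (fun x => f x - h x)%R <= (2^-1 ^+ n * B)%:E)%E) ->
  L2range leb2 P f.
Proof.
move=> Lf hf; split => //; exists f => //; apply: ae_eq_sym.
have [Pin _ Plin _] := Pbl; have [M M0 hM] := bounded_nsq.
have Lpf := Pin _ Lf; have Ld := L2B Lpf Lf.
suff n0 : nsq leb2 (fun x => P f x - f x) = 0%E.
  have := nsq_eq0 (L2_measurable Ld) n0; apply: ae_imp => x h xT.
  by apply/eqP; rewrite -subr_eq0 h.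
rewrite (L2_nsq Ld); congr (_%:E); apply/eqP; rewrite eq_le fine_ge0 ?nsq_ge0// andbT.
apply: (@ler_geometric _ _ _ ((2 * M + 2) * B)) => n; rewrite add0r.
have [h Rh fh] := hf n; have [Lh _] := Rh.
have Lfh := L2B Lf Lh; have LP := Pin _ Lfh; have LN := L2N Lfh.
have e1 : nsq leb2 (fun x => P f x - f x) =
    nsq leb2 (fun x => P (fun x => f x - h x) x + - (f x - h x)).
  apply: nsq_ae_eq; [exact: (L2_measurable Ld)|exact: (L2_measurable (L2D LP LN))|].
  have := Plin (-1) h f Lh Lf; have := range_fixed Rh.
  have -> : (fun x => -1 * h x + f x) = (fun x => f x - h x).
    by apply/funext => x; rewrite mulN1r addrC.
  by apply: ae_imp2 => x h1 h2 xT; rewrite h2// h1//; ring.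
have := nsqD_le leb2 (L2_measurable LP) (L2_measurable LN); rewrite -e1.
have -> : nsq leb2 (fun x => - (f x - h x)) = nsq leb2 (fun x => f x - h x).
  by apply: eq_integral => x _; rewrite normcN_eq.
move: (hM _ Lfh) fh; rewrite (L2_nsq Ld) (L2_nsq LP) (L2_nsq Lfh) -!EFinM -EFinD !lee_fin.
set p := fine _; set q := fine _; set r := fine _ => h1 h2 h3.
apply: (le_trans h3); have := ler_wpM2l M0 h2.
by move: h1 h2; set t := _ ^+ n; lra.
Qed.

Lemma newton_limit (F : I -> plane -> R[i]) (A eps : R) :
  0 < eps -> 4 * eps <= 1 -> newton_state P m eta th F A eps ->
  exists chi : I -> plane -> R[i],
    [/\ orthonormal_family leb2 chi, forall a, L2range leb2 P (chi a),
        exists C, forall a, exp_bounded C th (m a) (chi a) &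
        forall U (c : I -> R[i]), uniq U ->
          (nsq leb2 (fun x => \sum_(a <- U) c a * (F a x - chi a x))%R
            <= ((2 * eps) ^+ 2 * \sum_(a <- U) normc (c a) ^+ 2)%:E)%E].
Proof.
move=> eps0 eps4 st0.
(* The amplitudes [An n] start at [A] and stay below [2 * A]; [An n * (1 + e n) <= An n.+1] follows
   from [4 * eps <= 1]. *)
pose e n := eps * 2^-1 ^+ n; pose An n := A * (2 - 2^-1 ^+ n).
have half_gt0 n : 0 < 2^-1 ^+ n :> R by rewrite exprn_gt0.
have half_le1 n : 2^-1 ^+ n <= 1 :> R by apply: exprn_ile1; rewrite ?invr_ge0 ?invf_le1 ?ler1n.
have e0 n : 0 < e n by rewrite mulr_gt0.
have e4 n : 4 * e n <= 1.
  by apply: le_trans eps4; rewrite mulrA ler_piMr// mulr_ge0// ltW.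
have [|n f Gf|Fn hFn] := @dependent_choice_nat (I -> plane -> R[i])
  (* The clause for [n = 0] ties the chosen sequence to the given family [F]. *)
  (fun n f => (n = 0%N -> f = F) /\ newton_state P m eta th f (An n) (e n))
  (fun n f f' => (forall a, exp_bounded (2 * A * e n) th (m a) (fun x => f' a x - f a x)) /\
    forall U (c : I -> R[i]), uniq U ->
      (nsq leb2 (fun x => \sum_(a <- U) c a * (f' a x - f a x))%R
        <= ((e n) ^+ 2 * \sum_(a <- U) normc (c a) ^+ 2)%:E)%E).
- exists F; split=> //; rewrite /An /e expr0 mulr1 (_ : A * (2 - 1) = A)//.
  by rewrite (_ : 2 - 1 = 1) ?mulr1//; ring.
- have [_ stf] := Gf.
  have [f' [[h1 h2 h3 h4] h5 h6]] := newton_step Pbl S0 eta0 th0 th_eta hS (e0 n) (e4 n) stf.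
  exists f'; split=> //.
  + split=> //.
      move=> a x; apply: (le_trans (h3 a x)); rewrite ler_wpM2r ?expR_ge0//.
      have A0 : 0 <= A by have [_ _ hA _] := st0; exact: exp_bounded_ge0 (hA a).
      rewrite /An -mulrA ler_wpM2l // /e exprS.
      have := half_le1 n; have := ltW (half_gt0 n); set t := _ ^+ n => t0 t1.
      have := mulr_ge0 (mulr_ge0 (ltW eps0) t0) t0.
      have : eps * t <= 4^-1 * t by rewrite ler_wpM2r//; lra.
      by lra.
    by move=> U uU a; rewrite /e exprS mulrCA mulrC; exact: h4.
  + move=> a x; apply: (le_trans (h5 a x)); rewrite ler_wpM2r ?expR_ge0//.
    have A0 : 0 <= A by have [_ _ hA _] := st0; exact: exp_bounded_ge0 (hA a).
    rewrite ler_wpM2r ?(ltW (e0 n))// /An mulrC ler_wpM2r //.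
    by have := ltW (half_gt0 n); lra.
have RFn n a : L2range leb2 P (Fn n a) by have [[_ [h _ _ _]] _] := hFn n.
have LFn n a : L2 leb2 (Fn n a) by case: (RFn n a).
have F0E : Fn 0%N = F by have [[h _] _] := hFn 0%N; exact: h.
pose k a x := 2 * A * eps * expR (- th * enorm (x - m a)).
have hstep n a x : normc (Fn n.+1 a x - Fn n a x) <= k a x * 2^-1 ^+ n.
  have [_ [h _]] := hFn n; apply: (le_trans (h a x)); rewrite /k /e.
  by rewrite le_eqVlt; apply/orP; left; apply/eqP; ring.
(* The increments are bounded at every point, so the limit is taken pointwise and completeness of
   the function space is not invoked. *)
have lim a x : exists l, forall n, normc (l - Fn n a x) <= 4 * k a x * 2^-1 ^+ n.
  exact: complex_geometric_limit (hstep ^~ a ^~ x).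
pose chi a x := sval (cid (lim a x)).
have hchi n a x : normc (chi a x - Fn n a x) <= 4 * k a x * 2^-1 ^+ n.
  exact: (svalP (cid (lim a x)) n).
have mchi a : cmeasurable_fun (chi a : plane -> R[i]).
  split.
    apply: (@measurable_geometric_limit _ _ _ (fun n x => complex.Re (Fn n a x)) _
      (fun x => 4 * k a x)) => [n|n x]; first by case: (L2_measurable (LFn n a)).
    by rewrite -ReN -ReD (le_trans (normr_Re_le _)).
  apply: (@measurable_geometric_limit _ _ _ (fun n x => complex.Im (Fn n a x)) _
    (fun x => 4 * k a x)) => [n|n x]; first by case: (L2_measurable (LFn n a)).
  by rewrite -ImN -ImD (le_trans (normr_Im_le _)).
pose K := 8 * A * eps.
have bchi n a : exp_bounded (K * 2^-1 ^+ n) th (m a) (fun x => chi a x - Fn n a x).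
  move=> x; apply: (le_trans (hchi n a x)); rewrite /k /K.
  by rewrite le_eqVlt; apply/orP; left; apply/eqP; ring.
have bF n a : exp_bounded (2 * A) th (m a) (Fn n a).
  have [[_ [_ _ h _]] _] := hFn n; move=> x; apply: (le_trans (h a x)).
  have A0 : 0 <= A by have [_ _ hA _] := st0; exact: exp_bounded_ge0 (hA a).
  rewrite ler_wpM2r ?expR_ge0// /An mulrC ler_wpM2r//.
  by have := ltW (half_gt0 n); lra.
have cC a : exp_bounded (K + 2 * A) th (m a) (chi a).
  move=> x; have -> : chi a x = (chi a x - Fn 0%N a x) + Fn 0%N a x by ring.
  rewrite (le_trans (normcD_le _ _))// mulrDl; apply: lerD; last exact: bF.
  by have := bchi 0%N a x; rewrite expr0 mulr1.
have [B B0 hB] := exp_bounded_nsq th0; have [B' B'0 hB'] := exp_bounded_inner th0.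
have Lchi a : L2 leb2 (chi a) by case: (hB _ _ _ (mchi a) (cC a)).
have Ld n a : L2 leb2 (fun x => chi a x - Fn n a x) by exact: L2B.
exists chi; split.
- split=> // a b; apply/eqP; rewrite -subr_eq0; apply/eqP/Normc.eq0_normc.
  apply/eqP; rewrite eq_le normc_ge0 andbT.
  pose H := K * (K + 2 * A) * B' + 2 * A * K * B' + eps.
  apply: (@ler_geometric _ _ _ H) => n; rewrite add0r.
  have -> : inner leb2 (chi a) (chi b) - `[< a = b >]%:R =
      inner leb2 (fun x => chi a x - Fn n a x) (chi b) +
      inner leb2 (Fn n a) (fun x => chi b x - Fn n b x) + gram_err (Fn n) a b.
    by rewrite innerBl// innerBr// /gram_err asbool_eqE; ring.
  have md a' := L2_measurable (Ld n a').
  have ex1 : expR (- (th / 2) * enorm (m a - m b)) <= 1.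
    rewrite -expR0 ler_expR mulNr oppr_le0 mulr_ge0 ?enorm_ge0// divr_ge0// ltW//.
  have K0 : 0 <= K.
    have A0 : 0 <= A by have [_ _ hA _] := st0; exact: exp_bounded_ge0 (hA a).
    by rewrite /K !mulr_ge0// ltW.
  have A0 : 0 <= 2 * A by exact: exp_bounded_ge0 (bF n a).
  have h1 := hB' _ _ _ _ _ _ (md a) (mchi b) (bchi n a) (cC b).
  have h2 := hB' _ _ _ _ _ _ (L2_measurable (LFn n a)) (md b) (bF n a) (bchi n b).
  have h3 : normc (gram_err (Fn n) a b) <= e n.
    have [[_ [_ _ _ h]] _] := hFn n; have := h [:: b] isT a.
    rewrite big_seq1; apply: le_trans.
    by rewrite ler_peMr ?normc_ge0// expw_ge1.
  rewrite (le_trans (normcD_le _ _))//.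
  have -> : 2^-1 ^+ n * H = 2^-1 ^+ n * K * (K + 2 * A) * B' +
      2 * A * (2^-1 ^+ n * K) * B' + e n by rewrite /H /e; ring.
  apply: lerD => //; rewrite (le_trans (normcD_le _ _))//; apply: lerD.
    apply: (le_trans h1); rewrite (mulrC K) ler_piMr//.
    apply: mulr_ge0; last exact: ltW.
    apply: mulr_ge0; last exact: addr_ge0.
    by apply: mulr_ge0 => //; exact: ltW.
  apply: (le_trans h2); rewrite (mulrC K) ler_piMr//.
  apply: mulr_ge0; last exact: ltW.
  apply: mulr_ge0 => //.
  by apply: mulr_ge0 => //; exact: ltW.
- move=> a; apply: (@range_closed _ (K ^+ 2 * B)) => // n.
  exists (Fn n a) => //; have [_ h] := hB _ _ _ (L2_measurable (Ld n a)) (bchi n a).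
  apply: (le_trans h); rewrite lee_fin; have := half_le1 n; have := ltW (half_gt0 n).
  set t := _ ^+ n => t0 t1.
  rewrite (_ : (K * t) ^+ 2 * B = t * (t * (K ^+ 2 * B))); last by ring.
  by rewrite ler_wpM2l// ler_piMl// mulr_ge0 ?sqr_ge0 ?(ltW B0).
- by exists (K + 2 * A).
- move=> U c uU; set N := \sum_(a <- U) _.
  have N0 : 0 <= N by apply: sumr_ge0 => a _; exact: sqr_ge0.
  pose s := Num.sqrt N; have s0 : 0 <= s by exact: sqrtr_ge0.
  have s2 : s ^+ 2 = N by rewrite sqr_sqrtr.
  (* [G n] telescopes from [F]; its norm is at most the sum of the steps [e k * s] for [k < n],
     which is [eps * s * (2 - 2 * 2^-1 ^+ n)]. *)
  pose G n x := \sum_(a <- U) c a * (Fn n a x - F a x).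
  have LG n : L2 leb2 (G n) by apply: L2_lincomb => a; apply: L2B => //; rewrite -F0E.
  have hG n : (L2norm leb2 (G n) <= (eps * s * (2 - 2 * 2^-1 ^+ n))%:E)%E.
    elim: n => [|n ih].
      have -> : G 0%N = (fun=> 0).
        by apply/funext => x; rewrite /G F0E big1// => a _; rewrite subrr mulr0.
      apply/L2norm_le; first by rewrite expr0 mulr1 subrr mulr0.
      rewrite /nsq (eq_integral (fun=> 0%E)) ?integral0 ?lee_fin ?sqr_ge0//.
      by move=> x _; rewrite Normc.normc0 expr0n.
    have LD : L2 leb2 (fun x => \sum_(a <- U) c a * (Fn n.+1 a x - Fn n a x)).
      by apply: L2_lincomb => a; exact: L2B.
    have -> : G n.+1 = (fun x => G n x + \sum_(a <- U) c a * (Fn n.+1 a x - Fn n a x)).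
      apply/funext => x; rewrite /G -big_split /=; apply: eq_bigr => a _; ring.
    apply: (le_trans (L2norm_triangle _ (L2_measurable (LG n)) (L2_measurable LD))).
    have -> : eps * s * (2 - 2 * 2^-1 ^+ n.+1) = eps * s * (2 - 2 * 2^-1 ^+ n) + e n * s.
      by rewrite /e exprS; set t := _ ^+ n; field.
    rewrite EFinD; apply: leeD => //; apply/L2norm_le; first by rewrite mulr_ge0// ltW.
    rewrite exprMn s2; have [_ [_ h]] := hFn n; exact: h.
  pose D n x := \sum_(a <- U) c a * (chi a x - Fn n a x).
  have LD n : L2 leb2 (D n) by exact: L2_lincomb.
  (* This crude constant depends on the length of [U]; that is harmless, since [n] tends to infinity
     with [U] fixed. *)
  pose Z := Num.sqrt ((size U)%:R * (K ^+ 2 * B') * N).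
  have hD n : (L2norm leb2 (D n) <= (2^-1 ^+ n * Z)%:E)%E.
    apply/L2norm_le; first by rewrite mulr_ge0 ?sqrtr_ge0// ltW.
    have Zr : 0 <= (size U)%:R * (K ^+ 2 * B') * N.
      apply: mulr_ge0 => //; apply: mulr_ge0 => //.
      by apply: mulr_ge0; [exact: sqr_ge0|exact: ltW].
    rewrite exprMn sqr_sqrtr// [X in (_ <= X%:E)%E]mulrA.
    apply: nsq_lincomb_le => [a|a]; first exact: Ld.
    rewrite (_ : (2^-1 ^+ n) ^+ 2 * _ = \sum_(b <- U) ((K * 2^-1 ^+ n) ^+ 2 * B')); last first.
      by rewrite big_const_seq count_predT iter_addr_0 -mulr_natr; ring.
    apply: ler_sum => b _.
    have := hB' _ _ _ _ _ _ (L2_measurable (Ld n a)) (L2_measurable (Ld n b)) (bchi n a) (bchi n b).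
    move/le_trans; apply; rewrite -expr2 ler_piMr//.
      by rewrite mulr_ge0 ?sqr_ge0// ltW.
    by rewrite -expR0 ler_expR mulNr oppr_le0 mulr_ge0 ?enorm_ge0// divr_ge0// ltW.
  pose X x := \sum_(a <- U) c a * (F a x - chi a x).
  have LX : L2 leb2 X by apply: L2_lincomb => a; apply: L2B => //; rewrite -F0E.
  rewrite -s2 -exprMn; apply/L2norm_le; first by rewrite !mulr_ge0// ltW.
  have Xfin : L2norm leb2 X \is a fin_num.
    by rewrite ge0_fin_numE ?L2norm_ge0//; apply/L2norm_lty; case/L2P: LX.
  rewrite -(fineK Xfin) lee_fin; apply: (@ler_geometric _ _ _ Z) => n.
  rewrite -lee_fin (fineK Xfin).
  have -> : L2norm leb2 X = L2norm leb2 (fun x => G n x + D n x).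
    rewrite !L2norm_nsq; congr (_ `^ _)%E; apply: eq_integral => x _.
    rewrite -normcN_eq; congr (normc _ ^+ 2)%:E.
    rewrite /X /G /D -big_split -sumrN /=; apply: eq_bigr => a _; ring.
  apply: (le_trans (L2norm_triangle _ (L2_measurable (LG n)) (L2_measurable (LD n)))).
  rewrite EFinD; apply: leeD => //; apply: (le_trans (hG n)); rewrite lee_fin.
  have := mulr_ge0 (ltW eps0) s0; have := ltW (half_gt0 n).
  set t := _ ^+ n => t0 es0; have := mulr_ge0 es0 t0; lra.
Qed.

End NewtonLimit.

(** * Projecting truncated basis functions *)

Section InitialFamily.
Context {R : realType} {I : eqType}.
Local Notation plane := (measurableTypeR R * measurableTypeR R)%type.
Local Notation leb2 := (@lebesgue2 R).
Variables (P : (R * R -> R[i]) -> (R * R -> R[i])) (K : (R * R) * (R * R) -> R[i]).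
Variables (C g : R).
Hypothesis C0 : 0 < C.
Hypothesis g0 : 0 < g.
Hypothesis KP : integral_kernel leb2 P K.
Hypothesis Kdec : {ae (leb2 \x leb2)%E, forall z,
  normc (K z) <= C * expR (- g * enorm (z.1 - z.2))}.
Hypothesis hP : orthogonal_projector leb2 P.
Variables (psi : I -> plane -> R[i]) (m : I -> R * R) (s C2 : R).
Hypothesis s52 : 5 / 2 < s.
Hypothesis C20 : 0 < C2.
Hypothesis bpsi : orthonormal_basis_of_range leb2 P psi.
Hypothesis mpsi : forall a, (\int[leb2]_x
  (jbracket (x - m a) `^ (2 * s) * normc (psi a x) ^+ 2)%:E <= C2%:E)%E.

Let Pbl : bounded_linear_operator leb2 P. Proof. by case: hP. Qed.
Let L2P f : L2 leb2 f -> L2 leb2 (P f). Proof. by case: Pbl => h _ _ _; exact: h. Qed.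
Let opsi : orthonormal_family leb2 psi. Proof. by case: bpsi. Qed.
Let Rpsi a : L2range leb2 P (psi a). Proof. by case: bpsi. Qed.
Let Lpsi a : L2 leb2 (psi a). Proof. by case: opsi. Qed.
Let Ppsi a : ae_eq leb2 setT (P (psi a)) (psi a). Proof. exact: range_fixed. Qed.

Let nsq_psi a : nsq leb2 (psi a) = 1%E.
Proof.
have [_ o] := opsi; rewrite (L2_nsq (Lpsi a)); congr (_%:E).
apply: (@complexI R); rewrite -inner_self// o asboolT//.
Qed.

Lemma sqr_weight_le (x : R * R) : weight x ^+ 2 <= jbracket x `^ (2 * s).
Proof.
rewrite sqr_weight; apply: ler_powR; first exact: jbracket_ge1.
by have := s52; rewrite ltr_pdivrMr// => /ltW; rewrite mulrC.
Qed.

(** Write [<x>^5 = <x>^(5 - 2 s) <x>^(2 s)]; the first exponent is negative, so it is largest at the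
    cutoff [L]. *)
Lemma sqr_weight_far (L : R) (x : R * R) : 0 < L -> L < jbracket x ->
  weight x ^+ 2 <= (L `^ (5 / 2 - s)) ^+ 2 * jbracket x `^ (2 * s).
Proof.
move=> L0 Lx; have j0 := jbracket_gt0 x.
rewrite sqr_weight -powR_mulrn ?powR_ge0// -powRrM.
rewrite [in leLHS](_ : 5 = (5 / 2 - s) * 2 + 2 * s :> R); last by lra.
rewrite powRD; last by rewrite (gt_eqF j0) implybT.
rewrite ler_wpM2r ?powR_ge0//.
rewrite (_ : (5 / 2 - s) * 2 = - (2 * s - 5)); last by lra.
rewrite !powRN lef_pV2 ?posrE ?powR_gt0//.
have s5 : 0 <= 2 * s - 5 by have := s52; lra.
apply: (ge0_ler_powR s5); [|by rewrite nnegrE ltW|exact: ltW].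
by rewrite nnegrE ltW.
Qed.

Definition near_part (L : R) a (x : plane) : R[i] :=
  if jbracket ((x : R * R) - m a) <= L then psi a x else 0.

Definition far_part (L : R) a (x : plane) : R[i] := psi a x - near_part L a x.

Lemma cmeasurable_if (b : plane -> bool) (f : plane -> R[i]) :
  measurable_fun setT b -> cmeasurable_fun f ->
  cmeasurable_fun (fun x => if b x then f x else 0).
Proof.
move=> mb [f1 f2]; split.
  rewrite (_ : (fun x => _) = (fun x => if b x then complex.Re (f x) else 0)).
    by apply: measurable_fun_ifT => //; exact: measurable_cst.
  by apply/funext => x; case: (b x).
rewrite (_ : (fun x => _) = (fun x => if b x then complex.Im (f x) else 0)).
  by apply: measurable_fun_ifT => //; exact: measurable_cst.
by apply/funext => x; case: (b x).
Qed.

Lemma L2_near L a : L2 leb2 (near_part L a).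
Proof.
apply: (le_L2 _ _ (Lpsi a)).
  apply: cmeasurable_if; last exact: L2_measurable.
  by apply: measurable_fun_ler => //; apply: measurable_jbracket; exact: pmeasurable_sub.
by apply: aeW => x; rewrite /near_part; case: ifP => // _; rewrite Normc.normc0 normc_ge0.
Qed.

Lemma L2_far L a : L2 leb2 (far_part L a).
Proof. by apply: L2B => //; exact: L2_near. Qed.

Lemma nsq_near L a : (nsq leb2 (near_part L a) <= 1)%E.
Proof.
rewrite -(nsq_psi a); apply: nsq_le; [exact: (L2_measurable (L2_near L a))|exact: L2_measurable|].
by move=> x; rewrite /near_part; case: ifP => // _; rewrite Normc.normc0 normc_ge0.
Qed.

Lemma wmom_dominated a (f : plane -> R[i]) (k : R) : 0 <= k -> cmeasurable_fun f ->
  (forall x, (weight (x - m a) * normc (f x)) ^+ 2 <=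
    k * (jbracket (x - m a) `^ (2 * s) * normc (psi a x) ^+ 2)) ->
  (wmom (m a) f <= (k * C2)%:E)%E.
Proof.
move=> k0 mf h.
have mj : measurable_fun setT (fun x : plane =>
    jbracket ((x : R * R) - m a) `^ (2 * s) * normc (psi a x) ^+ 2).
  apply: measurable_funM.
    apply: (measurableT_comp (measurable_powR _)).
    by apply: measurable_jbracket; exact: pmeasurable_sub.
  by apply: measurable_funX; apply: measurable_normc; exact: L2_measurable.
have j0 (x : plane) : 0 <= jbracket ((x : R * R) - m a) `^ (2 * s) * normc (psi a x) ^+ 2.
  by rewrite mulr_ge0 ?powR_ge0 ?sqr_ge0.
apply: (@le_trans _ _ (\int[leb2]_x
    (k * (jbracket (x - m a) `^ (2 * s) * normc (psi a x) ^+ 2))%:E)%E).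
  apply: ge0_le_integral; first exact: measurableT.
  - by move=> x _; rewrite lee_fin sqr_ge0.
  - by apply/measurable_EFinP/measurable_funX; exact: measurable_wnormc.
  - by apply/measurable_EFinP; apply: measurable_funM mj; exact: measurable_cst.
  - by move=> x _; rewrite lee_fin.
by rewrite -mul_ge0_integral// (EFinM k) lee_wpmul2l.
Qed.

Lemma wmom_psi a : (wmom (m a) (psi a) <= C2%:E)%E.
Proof.
rewrite -[C2]mul1r; apply: wmom_dominated => //; first exact: L2_measurable.
by move=> x; rewrite mul1r exprMn ler_wpM2r ?sqr_ge0// sqr_weight_le.
Qed.

Lemma wmom_near L a : (wmom (m a) (near_part L a) <= C2%:E)%E.
Proof.
rewrite -[C2]mul1r; apply: wmom_dominated => //; first exact: (L2_measurable (L2_near L a)).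
move=> x; rewrite mul1r exprMn; apply: ler_pM; rewrite ?sqr_ge0 ?sqr_weight_le//.
rewrite /near_part; case: ifP => // _; by rewrite Normc.normc0 expr0n sqr_ge0.
Qed.

Lemma wmom_far L a : 0 < L ->
  (wmom (m a) (far_part L a) <= ((L `^ (5 / 2 - s)) ^+ 2 * C2)%:E)%E.
Proof.
move=> L0; apply: wmom_dominated; first exact: sqr_ge0.
  exact: (L2_measurable (L2_far L a)).
move=> x; rewrite /far_part /near_part; case: ifPn => h.
  rewrite subrr Normc.normc0 mulr0 expr0n /=.
  by apply: mulr_ge0; [exact: sqr_ge0|apply: mulr_ge0; [exact: powR_ge0|exact: sqr_ge0]].
rewrite subr0 exprMn mulrA ler_wpM2r ?sqr_ge0//.
by apply: sqr_weight_far => //; rewrite ltNge.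
Qed.

Lemma sum_weight_centers : exists2 S : R, 0 < S & forall a (U : seq I), uniq U ->
  \sum_(b <- U) (weight (m a - m b))^-1 <= S.
Proof.
have [B B0 hB] := local_density C0 g0 KP Kdec opsi Ppsi.
exists (cpeetre * C2 * B * kappa).
  by rewrite !mulr_gt0 ?cpeetre_gt0 ?kappa_gt0.
move=> a U uU; apply: (@sum_weight_inv_le _ _ psi) => //.
- exact: wmom_psi.
- exact: hB.
Qed.

(* The kernel bounds [P (near_part L a)] only almost everywhere; [phi a] is a
   representative for which the bound holds everywhere. *)
Lemma near_projection_decay L : 0 < L -> exists2 A : R, 0 < A &
  exists phi : I -> plane -> R[i],
    (forall a, L2 leb2 (phi a) /\ ae_eq leb2 setT (P (near_part L a)) (phi a)) /\
    forall a, exp_bounded A g (m a) (phi a).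
Proof.
move=> L0; have [A A0 hA] := kernel_exp_bounded C0 g0 KP Kdec (ltW L0) (@ler01 R).
exists A => //.
pose b a (x : plane) := normc (P (near_part L a) x) <= A * expR (- g * enorm ((x : R * R) - m a)).
exists (fun a x => if b a x then P (near_part L a) x else 0); split=> a; last first.
  move=> x; rewrite /b; case: ifP => // _.
  by rewrite Normc.normc0 mulr_ge0 ?expR_ge0// ltW.
have Lp := L2P (L2_near L a).
have e : ae_eq leb2 setT (P (near_part L a))
    (fun x => if b a x then P (near_part L a) x else 0).
  have := hA (m a) _ (L2_near L a) (nsq_near L a); move=> /(_ _); move=> h.
  have : forall x, L < jbracket (x - m a) -> near_part L a x = 0.
    by move=> x; rewrite /near_part ltNge => /negbTE ->.
  by move=> /h; apply: ae_imp => x bx _; rewrite /b bx.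
split=> //; apply: (L2_ae_eq _ e Lp); apply: cmeasurable_if; last exact: (L2_measurable Lp).
apply: measurable_fun_ler; first exact: (measurable_normc (L2_measurable Lp)).
by apply: measurable_funM; [exact: measurable_cst|exact: measurable_exp_dist].
Qed.

(** Each pairing contains a far part, whose moment carries [rho ^+ 2]. Taking [lam] to be [rho^-1]
    or [rho], according to the slot of the small moment, makes both AM-GM terms equal to
    [rho * C2]. *)
Lemma far_inner_le : exists2 Q : R, 0 < Q & forall L a b, 0 < L ->
  let rho := L `^ (5 / 2 - s) in rho <= 1 ->
  [/\ normc (inner leb2 (P (far_part L a)) (psi b)) <= Q * rho * (weight (m a - m b))^-1,
      normc (inner leb2 (P (near_part L a)) (far_part L b)) <=
        Q * rho * (weight (m a - m b))^-1 &
      normc (inner leb2 (P (far_part L a)) (far_part L b)) <=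
        Q * rho * (weight (m a - m b))^-1].
Proof.
have [D D0 hD] := kernel_inner_le C0 g0 KP Kdec L2P.
exists (D * (2 * C2)); first by rewrite !mulr_gt0.
move=> L a b L0 rho rho1; have rho0 : 0 < rho by rewrite powR_gt0.
have w0 : 0 <= (weight (m a - m b))^-1 by exact: weight_inv_ge0.
have fin (z : R) : z <= D * (weight (m a - m b))^-1 * (2 * C2 * rho) ->
    z <= D * (2 * C2) * rho * (weight (m a - m b))^-1.
  by move=> h; rewrite (_ : D * _ * _ * _ = D * (weight (m a - m b))^-1 * (2 * C2 * rho))//; ring.
have far2 c : (wmom (m c) (far_part L c) <= (rho ^+ 2 * C2)%:E)%E by exact: wmom_far.
have far1 c : (wmom (m c) (far_part L c) <= C2%:E)%E.
  apply: (le_trans (far2 c)); rewrite lee_fin ler_piMl ?(ltW C20)//.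
  by rewrite exprn_ile1// ltW.
have c1 : rho^-1 * (rho ^+ 2 * C2) + rho^-1^-1 * C2 = 2 * C2 * rho.
  by rewrite invrK; field; rewrite gt_eqF.
have c2 : rho * C2 + rho^-1 * (rho ^+ 2 * C2) = 2 * C2 * rho by field; rewrite gt_eqF.
have ri0 : 0 < rho^-1 by rewrite invr_gt0.
split; apply: fin; rewrite -?[in leRHS]c1.
- exact: hD (L2_far L a) (Lpsi b) ri0 (far2 a) (wmom_psi b).
- rewrite c1 -c2; exact: hD (L2_near L a) (L2_far L b) rho0 (wmom_near L a) (far2 b).
- exact: hD (L2_far L a) (L2_far L b) ri0 (far2 a) (far1 b).
Qed.

Lemma inner_projected f h : L2 leb2 f -> L2 leb2 h ->
  inner leb2 (P f) (P h) = inner leb2 (P f) h.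
Proof.
move=> Lf Lh; have [_ Pid Psa] := hP.
rewrite -Psa//; last exact: L2P.
by apply: inner_ae_eq => //; [exact/L2P/L2P|exact: L2P|exact: Pid|exact: ae_eq_refl].
Qed.

Lemma projected_near L a :
  ae_eq leb2 setT (P (near_part L a)) (fun x => psi a x - P (far_part L a) x).
Proof.
have [_ _ Plin _] := Pbl; have := Plin (-1) _ _ (L2_far L a) (Lpsi a).
have -> : (fun x => -1 * far_part L a x + psi a x) = near_part L a.
  by apply/funext => x; rewrite /far_part; ring.
by have := Ppsi a; apply: ae_imp2 => x h1 h2 xT; rewrite h2// h1//; ring.
Qed.

Lemma exp_bounded_wannier_basis : exists (chi : I -> plane -> R[i]) (A th : R),
  [/\ 0 < th, orthonormal_basis_of_range leb2 P chi &
      forall a, exp_bounded A th (m a) (chi a)].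
Proof.
have [S S0 hS] := sum_weight_centers; have [Q Q0 hQ] := far_inner_le.
(* With [Q * rho * S <= 1 / 256], the Gram error of [phi] has row sums at most [1 / 128], and
   [psi - phi] satisfies the closeness bound with constant [1 / 256]. *)
pose rho := Num.min 1 (256 * (Q * S))^-1.
have QS : 0 < Q * S by exact: mulr_gt0.
have rho0 : 0 < rho.
  by rewrite lt_min ltr01 invr_gt0; apply: mulr_gt0 QS; rewrite ltr0n.
have rho1 : rho <= 1 by rewrite ge_min lexx.
have QSrho : Q * rho * S <= 256^-1.
  rewrite mulrAC; apply: (@le_trans _ _ (Q * S * (256 * (Q * S))^-1)).
    by rewrite ler_wpM2l ?(ltW QS)// ge_min lexx orbT.
  by rewrite invfM mulrCA mulfV ?gt_eqF// mulr1.
have s0 : 0 < s - 5 / 2 by rewrite subr_gt0.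
(* The cutoff solves [L ^ (5 / 2 - s) = rho], which is where the strict inequality [5 / 2 < s] is
   used. *)
pose L := rho `^ (- (s - 5 / 2)^-1).
have L0 : 0 < L by rewrite powR_gt0.
have Lrho : L `^ (5 / 2 - s) = rho.
  rewrite -powRrM (_ : _ * _ = 1) ?powRr1 ?(ltW rho0)//.
  by rewrite -[5 / 2 - s]opprB mulrNN mulVf// gt_eqF.
have hq a b : [/\ normc (inner leb2 (P (far_part L a)) (psi b)) <= Q * rho * (weight (m a - m b))^-1,
      normc (inner leb2 (P (near_part L a)) (far_part L b)) <= Q * rho * (weight (m a - m b))^-1 &
      normc (inner leb2 (P (far_part L a)) (far_part L b)) <= Q * rho * (weight (m a - m b))^-1].
  by have := hQ L a b L0; rewrite /= Lrho => /(_ rho1).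
have [A A0 [phi [hphi Aphi]]] := near_projection_decay L0.
have Lphi a : L2 leb2 (phi a) by case: (hphi a).
have Ephi a : ae_eq leb2 setT (P (near_part L a)) (phi a) by case: (hphi a).
have LPn a : L2 leb2 (P (near_part L a)) by apply/L2P/L2_near.
have LPf a : L2 leb2 (P (far_part L a)) by apply/L2P/L2_far.
have Qrho : 0 <= Q * rho by rewrite mulr_ge0 ?ltW.
have hE a b : normc (gram_err phi a b) <= 2 * (Q * rho) * (weight (m a - m b))^-1.
  (* Projecting only one slot and writing [near = psi - far] in each slot in turn leaves the
     orthonormal term, which cancels, and two pairings that contain a far part. *)
  have -> : gram_err phi a b = - inner leb2 (P (far_part L a)) (psi b) -
      inner leb2 (P (near_part L a)) (far_part L b).
    rewrite /gram_err -asbool_eqE; have [_ <-] := opsi.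
    rewrite -(inner_ae_eq (LPn a) (Lphi a) (LPn b) (Lphi b) (Ephi a) (Ephi b)).
    rewrite inner_projected; [|exact: L2_near|exact: L2_near].
    rewrite (_ : inner leb2 _ (near_part L b) = inner leb2 (P (near_part L a)) (psi b) -
      inner leb2 (P (near_part L a)) (far_part L b)); last first.
      rewrite -innerBr//; last exact: L2_far.
      by congr inner; apply/funext => x; rewrite /far_part; ring.
    rewrite (inner_ae_eq (LPn a) (L2B (Lpsi a) (LPf a)) (Lpsi b) (Lpsi b)
      (projected_near L a) (ae_eq_refl _ _ _)) innerBl//.
    by ring.
  have [h1 h2 _] := hq a b.
  rewrite (le_trans (normcD_le _ _))// !normcN_eq -mulrA mulr2n mulrDl mul1r.
  exact: lerD.
have rhoS a (U : seq I) : uniq U ->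
    \sum_(b <- U) normc (gram_err phi a b) <= 128^-1.
  move=> uU; apply: (@le_trans _ _ (2 * (Q * rho) * S)).
    apply: le_trans (ler_wpM2l _ (hS a U uU)); last by rewrite mulr_ge0.
    by rewrite mulr_sumr; apply: ler_sum => b _; exact: hE.
  by rewrite -mulrA; lra.
have Rphi a : L2range leb2 P (phi a).
  split=> //; exists (near_part L a); first exact: L2_near.
  exact: ae_eq_sym.
pose th1 := g / 4.
have th10 : 0 < th1 by rewrite divr_gt0.
have th1g : 4 * th1 <= g by rewrite /th1 mulrCA mulfV ?mulr1.
have st1 : exists2 C1, 0 <= C1 & forall a b,
    normc (gram_err phi a b) <= C1 * expR (- (g / 2) * enorm (m a - m b)).
  have [B B0 hB] := exp_bounded_inner g0.
  exists (A * A * B + 1); first by rewrite addr_ge0// !mulr_ge0 ?ltW.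
  move=> a b; rewrite /gram_err (le_trans (normcD_le _ _))// normcN_eq mulrDl.
  apply: lerD.
    exact: hB (L2_measurable (Lphi a)) (L2_measurable (Lphi b)) (Aphi a) (Aphi b).
  rewrite normc_nat mul1r; have [->|ab] := eqVneq a b; last exact: expR_ge0.
  by rewrite subrr enorm0 mulr0 expR0.
have [C1 C10 hC1] := st1.
(* The rate [th] is chosen after the radius [D]: at distance at most [D] the
   exponential weight is at most 2, and beyond [D] the tail is already small for
   the larger rate [th1]. *)
have e64 : 0 < 64^-1 :> R by rewrite invr_gt0.
have [D D0 hD] := exp_decay_tail (ltW S0) g0 th1g hS C10 e64 hC1.
have ln20 : 0 < ln 2 :> R by rewrite ln_gt0// ltr1n.
pose th := Num.min th1 (ln 2 / (D + 1)).
have D1 : 0 < D + 1 by rewrite ltr_wpDl.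
have th0 : 0 < th by rewrite lt_min th10 divr_gt0.
have thth1 : th <= th1 by rewrite ge_min lexx.
have thg : 4 * th <= g by apply: le_trans th1g; rewrite ler_wpM2l.
have thD : th * D <= ln 2.
  have : th * (D + 1) <= ln 2 by rewrite -ler_pdivlMr// ge_min lexx orbT.
  by apply: le_trans; rewrite ler_wpM2l ?(ltW th0)// lerDl.
have e16 : 0 < 16^-1 :> R by rewrite invr_gt0.
(* The weighted row sums are at most [2 / 128 + 1 / 64 = 1 / 32], within the claimed [1 / 16]. *)
have st : newton_state P m g th phi A 16^-1.
  split=> //; first by exists A.
    move=> a x; apply: (le_trans (Aphi a x)); rewrite ler_wpM2l ?(ltW A0)// ler_expR.
    rewrite !mulNr lerN2 ler_wpM2r ?enorm_ge0//.
    by apply: le_trans thg; rewrite ler_peMl ?(ltW th0)// ler1n.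
  move=> U uU a.
  apply: (@le_trans _ _ (\sum_(b <- U) (2 * normc (gram_err phi a b) +
    normc (if enorm (m a - m b) <= D then 0 else gram_err phi a b) * expw m th1 a b))).
    apply: ler_sum => b _; have n0 := normc_ge0 (gram_err phi a b).
    case: ifPn => h; last first.
      rewrite ler_wpDl ?mulr_ge0// ler_wpM2l// /expw ler_expR ler_wpM2r ?enorm_ge0//.
    rewrite Normc.normc0 mul0r addr0 mulrC ler_wpM2r//.
    rewrite /expw -[leRHS](@lnK R) ?posrE// ler_expR.
    by apply: le_trans thD; rewrite ler_wpM2l ?(ltW th0).
  rewrite big_split /= -mulr_sumr.
  have := rhoS a U uU; have := hD U uU a; set t1 := \sum_(b <- U) _; set t2 := \sum_(b <- U) _.
  by lra.
have e4 : 4 * 16^-1 <= 1 :> R by lra.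
have [chi [ochi Rchi [C' hC'] hchi]] := newton_limit hP (ltW S0) g0 th0 thg hS e16 e4 st.
exists chi, C', th; split=> //.
(* The two closeness constants, [1 / 256] for [psi - phi] and [(2 / 16)^2 = 1 / 64] for [phi - chi],
   combine to [2 / 256 + 2 / 64 <= 1 / 16]. *)
apply: (near_basis_complete (q := 16^-1) Pbl bpsi ochi Rchi).
- by rewrite ltW.
- by rewrite mulfV.
move=> U c uU; set N := \sum_(a <- U) _.
have N0 : 0 <= N by apply: sumr_ge0 => a _; exact: sqr_ge0.
have Lchi a : L2 leb2 (chi a) by case: (Rchi a).
have Ld a : L2 leb2 (fun x => psi a x - phi a x) by exact: L2B.
have Ld2 a : L2 leb2 (fun x => phi a x - chi a x) by exact: L2B.
have h1 : (nsq leb2 (fun x => \sum_(a <- U) c a * (psi a x - phi a x))%R <= (256^-1 * N)%:E)%E.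
  apply: nsq_lincomb_le => // a; apply: (@le_trans _ _ (Q * rho * S)) => //.
  apply: le_trans (ler_wpM2l Qrho (hS a U uU)); rewrite mulr_sumr.
  apply: ler_sum => b _; have [_ _ h3] := hq a b; apply: le_trans h3.
  have dE e : ae_eq leb2 setT (fun x => psi e x - phi e x) (P (far_part L e)).
    have := projected_near L e; have := Ephi e.
    by apply: ae_imp2 => x h1 h2 xT; rewrite -h1// h2//; ring.
  rewrite (inner_ae_eq (Ld a) (LPf a) (Ld b) (LPf b) (dE a) (dE b)).
  by rewrite inner_projected//; exact: L2_far.
have h2 := hchi U c uU; rewrite -/N in h2.
pose f1 x := \sum_(a <- U) c a * (psi a x - phi a x).
pose f2 x := \sum_(a <- U) c a * (phi a x - chi a x).
have L1 : L2 leb2 f1 by exact: L2_lincomb.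
have L2' : L2 leb2 f2 by exact: L2_lincomb.
have -> : (fun x => \sum_(a <- U) c a * (psi a x - chi a x)) = (fun x => f1 x + f2 x).
  by apply/funext => x; rewrite /f1 /f2 -big_split /=; apply: eq_bigr => a _; ring.
apply: (le_trans (nsqD_le leb2 (L2_measurable L1) (L2_measurable L2'))).
move: h1 h2; rewrite -/f1 -/f2 (L2_nsq L1) (L2_nsq L2') -!EFinM -EFinD !lee_fin.
by rewrite expr2; lra.
Qed.

End InitialFamily.

(** * Comparison of pointwise bounds, exponential moments and polynomial moments *)

Section Moments.
Context {R : realType}.
Local Notation plane := (measurableTypeR R * measurableTypeR R)%type.
Local Notation leb2 := (@lebesgue2 R).

(** The square of [f] decays at rate [2 * th] and the moment weight grows at rate [th], up to [e^th]
    from [<x> <= 1 + |x|]; a decay of rate [th] is left to integrate. The added 1 in the constant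
    ensures positivity. *)
Lemma exp_bounded_moment (A th : R) : 0 < th -> exists2 B : R, 0 < B &
  forall (m : R * R) (f : plane -> R[i]), cmeasurable_fun f -> exp_bounded A th m f ->
    (\int[leb2]_x (expR (2 * (th / 2) * jbracket (x - m)) * normc (f x) ^+ 2)%:E <= B%:E)%E.
Proof.
move=> th0; have [B B0 hB] := integral_exp_le th0.
exists (A ^+ 2 * expR th * B + 1).
  by rewrite ltr_wpDl// mulr_ge0 ?(ltW B0)// mulr_ge0 ?sqr_ge0 ?expR_ge0.
move=> m f mf fA; have A0 := exp_bounded_ge0 fA.
have k0 : 0 <= A ^+ 2 * expR th by rewrite mulr_ge0 ?sqr_ge0 ?expR_ge0.
have me := measurable_exp_dist th m.
apply: (@le_trans _ _ (\int[leb2]_x (A ^+ 2 * expR th * expR (- th * enorm (x - m)))%:E)%E).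
  apply: ge0_le_integral; first exact: measurableT.
  - by move=> x _; rewrite lee_fin mulr_ge0 ?expR_ge0 ?sqr_ge0.
  - apply/measurable_EFinP; apply: measurable_funM.
      apply: (@measurableT_comp _ _ _ _ _ _ expR); first exact: measurable_expR.
      apply: measurable_funM; first exact: measurable_cst.
      by apply: measurable_jbracket; exact: pmeasurable_sub.
    by apply: measurable_funX; exact: measurable_normc.
  - by apply/measurable_EFinP; apply: measurable_funM me; exact: measurable_cst.
  - move=> x _; rewrite lee_fin.
    have h1 : normc (f x) ^+ 2 <= A ^+ 2 * expR (- (2 * th) * enorm (x - m)).
      rewrite (_ : - (2 * th) * enorm (x - m) = - th * enorm (x - m) * 2%:R); last by ring.
      rewrite expRM_natr -exprMn lerXn2r ?nnegrE ?normc_ge0//.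
      by rewrite mulr_ge0 ?expR_ge0.
    have h2 : expR (2 * (th / 2) * jbracket (x - m)) <= expR (th + th * enorm (x - m)).
      rewrite ler_expR (_ : 2 * (th / 2) = th); last by field.
      by have := ler_wpM2l (ltW th0) (jbracket_le (x - m)); rewrite mulrDr mulr1.
    apply: (le_trans (ler_pM (expR_ge0 _) (sqr_ge0 _) h2 h1)).
    rewrite mulrCA -[leRHS]mulrA ler_wpM2l ?sqr_ge0// -!expRD ler_expR.
    by set d := enorm _; clearbody d; lra.
rewrite -mul_ge0_integral// EFinD.
apply: (@le_trans _ _ (A ^+ 2 * expR th * B)%:E); last by rewrite leeDl.
by rewrite (EFinM (A ^+ 2 * expR th)) lee_wpmul2l.
Qed.

(** The sixth power of [t <= (3 / g) e^(g t / 3)] is [t^6 <= (3 / g)^6 e^(2 g t)]. *)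
Lemma exp_moment_poly (C g : R) (m : R * R) (f : plane -> R[i]) : 0 < g -> 0 <= C ->
  cmeasurable_fun f ->
  (\int[leb2]_x (expR (2 * g * jbracket (x - m)) * normc (f x) ^+ 2)%:E <= C%:E)%E ->
  (\int[leb2]_x (jbracket (x - m) `^ (2 * 3) * normc (f x) ^+ 2)%:E
    <= ((3 / g) ^+ 6 * C)%:E)%E.
Proof.
move=> g0 C0 mf hC.
have k0 : 0 <= (3 / g) ^+ 6 by rewrite exprn_ge0// divr_ge0// ltW.
have mj : measurable_fun setT (fun x : plane => jbracket ((x : R * R) - m)).
  by apply: measurable_jbracket; exact: pmeasurable_sub.
have mn : measurable_fun setT (fun x => normc (f x) ^+ 2).
  by apply: measurable_funX; exact: measurable_normc.
have me : measurable_fun setT (fun x : plane =>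
    expR (2 * g * jbracket ((x : R * R) - m)) * normc (f x) ^+ 2).
  apply: measurable_funM => //.
  apply: (@measurableT_comp _ _ _ _ _ _ expR); first exact: measurable_expR.
  by apply: measurable_funM; first exact: measurable_cst.
have e0 (x : plane) : 0 <= expR (2 * g * jbracket ((x : R * R) - m)) * normc (f x) ^+ 2.
  by rewrite mulr_ge0 ?expR_ge0 ?sqr_ge0.
apply: (@le_trans _ _ (\int[leb2]_x ((3 / g) ^+ 6 *
    (expR (2 * g * jbracket (x - m)) * normc (f x) ^+ 2))%:E)%E).
  apply: ge0_le_integral; first exact: measurableT.
  - by move=> x _; rewrite lee_fin mulr_ge0 ?powR_ge0 ?sqr_ge0.
  - apply/measurable_EFinP; apply: measurable_funM => //.
    exact: (measurableT_comp (measurable_powR _)).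
  - by apply/measurable_EFinP; apply: measurable_funM me; exact: measurable_cst.
  - move=> x _; rewrite lee_fin [leRHS]mulrA ler_wpM2r ?sqr_ge0//.
    have j0 := jbracket_ge0 (x - m); set t := jbracket _ in j0 *.
    rewrite -natrM powR_mulrn//.
    rewrite (_ : 2 * g * t = g / 3 * t * 6%:R); last by field.
    have h : g / 3 * t <= expR (g / 3 * t).
      by apply: le_trans (expR_ge1Dx _); rewrite lerDr.
    have g3 : 0 <= 3 / g by rewrite divr_ge0// ltW.
    have h2 : t <= 3 / g * expR (g / 3 * t).
      apply: le_trans (ler_wpM2l g3 h).
      by rewrite le_eqVlt; apply/orP; left; apply/eqP; field; rewrite gt_eqF.
    rewrite expRM_natr -exprMn; apply: lerXn2r => //.
    by rewrite nnegrE mulr_ge0 ?expR_ge0.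
by rewrite -mul_ge0_integral// (EFinM ((3 / g) ^+ 6)) lee_wpmul2l.
Qed.

End Moments.

Theorem theorem1 (R : realType) (P : (R * R -> R[i]) -> (R * R -> R[i]))
    (hP : orthogonal_projector (@lebesgue2 R) P)
    (hK : exp_localized_kernel P) :
  admits_exp_localized_wannier_basis P <->
  (exists2 s : R, 5 / 2 < s & admits_s_localized_wannier_basis P s).
Proof.
split.
  move=> [I [psi [bpsi [C [g [m [C0 g0 hC]]]]]]].
  (* Every [s > 5/2] is possible here; 3 makes the exponent [2 * s] a natural number. *)
  exists 3; first by rewrite ltr_pdivrMr// -natrM ltr_nat.
  have [[Lpsi _] _ _] := bpsi.
  exists I, psi; split=> //; exists ((3 / g) ^+ 6 * C), m; split.
    by rewrite mulr_gt0// exprn_gt0// divr_gt0.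
  move=> a; apply: (exp_moment_poly g0 (ltW C0) _ (hC a)).
  exact: L2_measurable (Lpsi a).
move=> [s s52 [I [psi [_ bpsi [C2 [m [C20 hm]]]]]]].
have [K KP [C [g [C0 g0 Kdec]]]] := hK.
(* The index type carries no decidable equality; [{classic I}] supplies one for the Gram matrix
   computations. *)
have [chi [A [th [th0 bchi hchi]]]] := @exp_bounded_wannier_basis R {classic I}
  P K C g C0 g0 KP Kdec hP psi m s C2 s52 C20 bpsi hm.
have [B B0 hB] := exp_bounded_moment A th0.
have [[Lchi _] _ _] := bchi.
exists I, chi; split; first exact: bchi.
exists B, (th / 2), m; split=> //; first by rewrite divr_gt0.
by move=> a; apply: hB; [exact: L2_measurable (Lchi a)|exact: hchi].
Qed.
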